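(* Let $D$ be a Prüfer domain and let $X\subseteq\mathrm{Max}(D)$ be a discrete splitting set of $D$. If $\mathrm{Crit}_X(D)=\emptyset$, then there is a commutative diagram of groups $$\begin{array}{ccc}\mathrm{Inv}_X(D)&\xrightarrow{\ \subseteq\ }&\mathrm{Div}_X(D)\\ \downarrow&&\downarrow\\ \mathcal C_c(X,\mathbb Z)&\longrightarrow&\mathcal C_c(E_X,\mathbb Z)\end{array}$$ such that the vertical arrows are isomorphisms. In particular, $\mathrm{Div}_X(D)$ and $\mathrm{Div}_X(D)/\mathrm{Inv}_X(D)$ are free groups.
   Context: $K$ is the quotient field of $D$; fractional ideals are nonzero. $\mathrm{Inv}(D)$ is the group of invertible fractional ideals of $D$. For a fractional ideal $I$, $(D:I):=\{x\in K\mid xI\subseteq D\}$ and $I^v:=(D:(D:I))$; $I$ is divisorial if $I=I^v$ and $v$-invertible if $(IJ)^v=D$ for some fractional ideal $J$. $\mathrm{Div}(D)$ is the group of $v$-invertible divisorial fractional ideals under the $v$-product $I\times_vJ:=(IJ)^v$. For $X\subseteq\mathrm{Spec}(D)$, $X^\uparrow:=\{P\in\mathrm{Spec}(D)\mid Q\subseteq P\text{ for some }Q\in X\}$. The inverse topology on $\mathrm{Spec}(D)$ is the topology having as a subbasis of open sets the sets $\mathcal V(I)=\{P\in\mathrm{Spec}(D)\mid I\subseteq P\}$, for $I$ a finitely generated ideal. $X$ is a splitting set if $X=X^\uparrow$ and $X$ is open in the inverse topology (equivalently, $X=X^\uparrow$ and $\mathrm{Spec}(D)\setminus X$ is quasi-compact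 in the Zariski topology); it is discrete if $P\neq P^2$ for every $P\in X$. The support of a fractional ideal $I$ is $\mathrm{supp}(I):=\{P\in\mathrm{Spec}(D)\mid ID_P\neq D_P\}$; $\mathrm{Inv}_X(D):=\{I\in\mathrm{Inv}(D)\mid\mathrm{supp}(I)\subseteq X\}$ and $\mathrm{Div}_X(D):=\{I\in\mathrm{Div}(D)\mid\mathrm{supp}(I),\mathrm{supp}((D:I))\subseteq X\}$ (a group under $\times_v$). A maximal ideal $M\in X$ is critical with respect to $X$ if there is no radical (integral) ideal $I\in\mathrm{Inv}_X(D)$ with $I\subseteq M$; $\mathrm{Crit}_X(D)$ is the set of such $M$. $X$ carries the (subspace) inverse topology, in which it is Hausdorff. For a topological space $Y$, $\mathcal C_c(Y,\mathbb Z)$ is the group of continuous functions $f\colon Y\to\mathbb Z$ ($\mathbb Z$ discrete) with compact support, the support being the closure of $f^{-1}(\mathbb Z\setminus\{0\})$. $E_X$ is the Gleason cover of $X$: the (unique up to homeomorphism over $X$) extremally disconnected space $E_X$ with a perfect irreducible continuous surjection $\pi\colon E_X\to X$. The bottom arrow is the canonical embedding $f\mapsto f\circ\pi$ (the embedding of $\mathcal C_c(X,\mathbb Z)$ in its $\ell$-group completion). *)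

(* Defs.v *)
From HB Require Import structures.
From mathcomp Require Import all_boot all_order all_algebra.
From mathcomp Require Import all_classical topology.
From mathcomp Require Import freeg.

Set Implicit Arguments.
Unset Strict Implicit.
Unset Printing Implicit Defensive.

Import GRing.Theory.
Local Open Scope classical_set_scope.
Local Open Scope ring_scope.

Local Notation "x %:F" := (@FracField.tofrac _ x).

Definition set_mul (R : comNzRingType) (I J : set R) : set R :=
  [set x | exists2 s : seq (R * R),
    forall p, p \in s -> I p.1 /\ J p.2 & x = \sum_(p <- s) p.1 * p.2].

Definition ideal_gen (R : comNzRingType) (s : seq R) : set R :=
  [set x | exists a : nat -> R, x = \sum_(i < size s) a i * s`_i].

(* [idealr_closed] means proper ideal. *)
Record Spec (R : comNzRingType) := MkSpec {
  spec_set :> set R ;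
  specP : idealr_closed [in spec_set] /\ prime_idealr_closed [in spec_set] }.

HB.instance Definition _ (R : comNzRingType) := gen_eqMixin (Spec R).
HB.instance Definition _ (R : comNzRingType) := gen_choiceMixin (Spec R).

(* The topology carried by [Spec R] is the inverse topology, not the Zariski
   topology.  A set [X : set (Spec R)], seen as a type, then carries the
   corresponding subspace topology. *)
HB.instance Definition _ (R : comNzRingType) :=
  isSubBaseTopological.Build (Spec R) (range (@ideal_gen R))
    (fun I => [set P : Spec R | I `<=` P]).

Definition Max (R : comNzRingType) : set (Spec R) :=
  [set M | forall J : set R, idealr_closed [in J] -> M `<=` J -> J = M].

Definition up_set (R : comNzRingType) (X : set (Spec R)) : set (Spec R) :=
  [set P | exists2 Q, X Q & Q `<=` P].

Definition splitting_set (R : comNzRingType) (X : set (Spec R)) : Prop :=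
  X = up_set X /\ open X.

Definition discrete_splitting_set (R : comNzRingType) (X : set (Spec R)) :
  Prop := splitting_set X /\ forall P, X P -> P <> set_mul P P :> set R.

(* Every ideal is allowed here, including the unit ideal. *)
Definition radical_ideal (R : comNzRingType) (I : set R) : Prop :=
  [/\ I 0, forall a x y, I x -> I y -> I (a * x + y)
    & forall x n, I (x ^+ n) -> I x].

Section Fractional.
Variable D : idomainType.
Local Notation K := {fraction D}.
Implicit Types (I J L : set K) (P : Spec D) (X : set (Spec D)).

(* [D] as a subset of its quotient field. *)
Definition dom_set : set K := range (@FracField.tofrac D).

Definition submod I : Prop :=
  [/\ I 0, forall x y, I x -> I y -> I (x + y)
    & forall (a : D) x, I x -> I (a%:F * x)].

Definition fractional I : Prop :=
  [/\ submod I, exists2 x, I x & x != 0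
    & exists2 d : D, d != 0 & forall x, I x -> dom_set (d%:F * x)].

Definition colon I : set K := [set x | forall y, I y -> dom_set (x * y)].
Definition vclos I : set K := colon (colon I).

Definition invertible I : Prop :=
  fractional I /\ exists2 J, fractional J & set_mul I J = dom_set.
Definition divisorial I : Prop := fractional I /\ vclos I = I.
Definition v_invertible I : Prop :=
  fractional I /\ exists2 J, fractional J & vclos (set_mul I J) = dom_set.

Definition localization P : set K :=
  [set x | exists a s : D, ~ spec_set P s /\ x = a%:F / s%:F].

Definition supp I : set (Spec D) :=
  [set P | set_mul I (localization P) <> localization P].

Definition Inv : set (set K) := [set I | invertible I].
Definition Div : set (set K) := [set I | divisorial I /\ v_invertible I].

Definition Inv_on X : set (set K) := [set I | Inv I /\ supp I `<=` X].
Definition Div_on X : set (set K) :=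
  [set I | [/\ Div I, supp I `<=` X & supp (colon I) `<=` X]].

Definition prufer : Prop :=
  forall s : seq D, ideal_gen s <> [set 0] ->
    invertible (@FracField.tofrac D @` ideal_gen s).

Definition Crit X : set (Spec D) :=
  [set M | [/\ X M, Max M &
    ~ exists I : set D, [/\ radical_ideal I,
        Inv_on X (@FracField.tofrac D @` I) & I `<=` M]]].

Lemma mem_mul I J x y : I x -> J y -> set_mul I J (x * y).
Proof.
move=> Ix Jy; exists [:: (x, y)]; last by rewrite big_seq1.
by move=> p; rewrite inE => /eqP ->.
Qed.

Lemma mul_submod I J : submod I -> submod (set_mul I J).
Proof.
case=> I0 ID IM; split.
- by exists [::] => //; rewrite big_nil.
- move=> _ _ [s hs ->] [t ht ->]; exists (s ++ t); last by rewrite big_cat.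
  by move=> p; rewrite mem_cat => /orP[/hs|/ht].
- move=> a _ [s hs ->]; exists [seq (a%:F * p.1, p.2) | p <- s].
    by move=> _ /mapP[p /hs[? ?] ->]; split=> //; apply: IM.
  by rewrite big_map mulr_sumr; apply: eq_bigr => p _; rewrite mulrA.
Qed.

Lemma mul_sub I J L : submod L ->
  (forall x y, I x -> J y -> L (x * y)) -> set_mul I J `<=` L.
Proof.
case=> L0 LD _ h _ [s hs ->]; rewrite big_seq.
by apply: (big_ind L) => // p /hs[? ?]; apply: h.
Qed.

Lemma mul_mono I I' J J' : I `<=` I' -> J `<=` J' ->
  set_mul I J `<=` set_mul I' J'.
Proof. by move=> hI hJ x [s hs ->]; exists s => // p /hs[/hI ? /hJ]. Qed.

Lemma mul_com I J : set_mul I J = set_mul J I.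
Proof.
suff h (A B : set K) : set_mul A B `<=` set_mul B A by apply/seteqP; split; apply: h.
move=> _ [s hs ->]; exists [seq (p.2, p.1) | p <- s].
  by move=> _ /mapP[p /hs[? ?] ->].
by rewrite big_map; apply: eq_bigr => p _; rewrite mulrC.
Qed.

Lemma mul_assoc I J L : submod I -> submod J -> submod L ->
  set_mul I (set_mul J L) = set_mul (set_mul I J) L.
Proof.
move=> sI sJ sL.
have h (A B C : set K) : submod A ->
    set_mul A (set_mul B C) `<=` set_mul (set_mul A B) C.
  move=> sA; have sAB := mul_submod B sA.
  apply: mul_sub => [|x _ Ax [s hs ->]]; first exact: mul_submod.
  have [S0 SD _] := mul_submod C sAB; rewrite mulr_sumr big_seq.
  apply: (big_ind (set_mul (set_mul A B) C)) => // p /hs[? ?].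
  by rewrite mulrA; apply: mem_mul => //; apply: mem_mul.
apply/seteqP; split; first exact: h.
by rewrite (mul_com (set_mul I J)) (mul_com I J) (mul_com I) (mul_com J L); apply: h.
Qed.

Lemma dom_submod : submod dom_set.
Proof.
split; first by exists 0; rewrite // rmorph0.
- by move=> _ _ [a _ <-] [b _ <-]; exists (a + b); rewrite // rmorphD.
- by move=> a _ [b _ <-]; exists (a * b); rewrite // rmorphM.
Qed.

Lemma dom_1 : dom_set 1. Proof. by exists 1; rewrite // rmorph1. Qed.

Lemma mul_dom I : submod I -> set_mul dom_set I = I.
Proof.
move=> sI; apply/seteqP; split=> [|x Ix].
  by apply: mul_sub => // _ x [a _ <-] Ix; case: sI => _ _; apply.
by rewrite -[x]mul1r; apply: mem_mul => //; apply: dom_1.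
Qed.

Lemma colon_submod I : submod (colon I).
Proof.
have [D0 DD DM] := dom_submod; split=> [y _|x y hx hy z Iz|a x hx z Iz].
- by rewrite mul0r.
- by rewrite mulrDl; apply: DD; [apply: hx|apply: hy].
- by rewrite -mulrA; apply: DM; apply: hx.
Qed.

Lemma colon_anti I J : I `<=` J -> colon J `<=` colon I.
Proof. by move=> h x hx y /h; apply: hx. Qed.

Lemma sub_colonP I J : I `<=` colon J <-> set_mul I J `<=` dom_set.
Proof.
split=> [h|h x Ix y Jy]; last by apply: h; apply: mem_mul.
by apply: mul_sub; [apply: dom_submod|move=> x y /h; apply].
Qed.

Lemma mul_colon I : set_mul (colon I) I `<=` dom_set.
Proof. exact/sub_colonP. Qed.

Lemma sub_vclos I : I `<=` vclos I.
Proof. by move=> x Ix y hy; rewrite mulrC; apply: hy. Qed.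

Lemma vclos_mono I J : I `<=` J -> vclos I `<=` vclos J.
Proof. by move=> h; do 2!apply: colon_anti. Qed.

Lemma colon_vclos I : colon (vclos I) = colon I.
Proof. by apply/seteqP; split; [apply/colon_anti/sub_vclos|apply: sub_vclos]. Qed.

Lemma vclosK I : vclos (vclos I) = vclos I.
Proof. exact: (congr1 _ (colon_vclos I)). Qed.

Lemma colon_mulP I J x :
  colon (set_mul I J) x <-> forall y, J y -> colon I (x * y).
Proof.
split=> [h y Jy z Iz|h _ [s hs ->]].
  by rewrite -mulrA (mulrC y); apply: h; apply: mem_mul.
rewrite mulr_sumr big_seq; have [D0 DD _] := dom_submod.
apply: (big_ind dom_set) => // p /hs[? ?].
by rewrite (mulrC p.1) mulrA; apply: h.
Qed.

Lemma vclos_mull I J : vclos (set_mul (vclos I) J) = vclos (set_mul I J).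
Proof.
apply: (congr1 (@colon)); apply/seteqP.
by split=> x /colon_mulP h; apply/colon_mulP; move: h; rewrite colon_vclos.
Qed.

Lemma vclos_mulr I J : vclos (set_mul I (vclos J)) = vclos (set_mul I J).
Proof. by rewrite mul_com vclos_mull mul_com. Qed.

Lemma colon_dom : colon dom_set = dom_set.
Proof.
apply/seteqP; split=> [x h|x Dx y [a _ <-]].
  by rewrite -[x]mulr1; apply: h; apply: dom_1.
by rewrite mulrC; case: dom_submod => _ _; apply.
Qed.

Lemma vclos_dom : vclos dom_set = dom_set.
Proof. by rewrite /vclos !colon_dom. Qed.

Lemma frac_split (x : K) : exists a s : D, s != 0 /\ x * s%:F = a%:F.
Proof.
rewrite -[x]reprK.
case: (repr x) => [[a s] /= s0]; exists a, s; split=> //.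
unlock FracField.tofrac; rewrite -[LHS]FracField.pi_mul.
apply/eqmodP; rewrite /= FracField.equivfE /FracField.mulf /=.
by rewrite !numden_Ratio ?mulr1 ?oner_neq0 //= mulrC.
Qed.

Lemma dom_fractional : fractional dom_set.
Proof.
split; [exact: dom_submod|by exists 1; [apply: dom_1|apply: oner_neq0]|].
by exists 1; [apply: oner_neq0|move=> x; rewrite rmorph1 mul1r].
Qed.

Lemma mul_fractional I J :
  fractional I -> fractional J -> fractional (set_mul I J).
Proof.
case=> sI [x Ix x0] [d d0 hd] [sJ [y Jy y0] [e e0 he]]; split.
- exact: mul_submod.
- by exists (x * y); [apply: mem_mul|rewrite mulf_neq0].
exists (d * e); first by rewrite mulf_neq0.
have [D0 DD DM] := dom_submod.
move=> _ [s hs ->]; rewrite mulr_sumr big_seq.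
apply: (big_ind dom_set) => // p /hs[/hd [a _ ea] /he hb].
by rewrite rmorphM mulrACA -ea; apply: DM.
Qed.

Lemma colon_fractional I : fractional I -> fractional (colon I).
Proof.
case=> sI [x Ix x0] [d d0 hd]; split; first exact: colon_submod.
  by exists d%:F; rewrite ?tofrac_eq0.
have [a [s [s0 e]]] := frac_split x; exists a => [|y hy].
  by rewrite -tofrac_eq0 -e mulf_neq0 ?tofrac_eq0.
rewrite -e -mulrA mulrCA; case: dom_submod => _ _; apply.
by rewrite mulrC; apply: hy.
Qed.

Lemma vclos_fractional I : fractional I -> fractional (vclos I).
Proof. by move=> fI; do 2!apply: colon_fractional. Qed.

Lemma fractional_sub I : fractional I -> submod I. Proof. by case. Qed.

Lemma localization_submod P : submod (localization P).
Proof.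
have [[P0 P1 _] Pp] := specP P.
have N0 s : ~ spec_set P s -> s%:F != 0 :> K.
  move=> Ps; rewrite tofrac_eq0; apply/eqP => s0; apply: Ps.
  by rewrite s0; apply/set_mem.
split.
- exists 0, 1; split; last by rewrite rmorph0 mul0r.
  by move=> /mem_set; apply/negP.
- move=> _ _ [a [s [Ps ->]]] [b [t [Pt ->]]].
  exists (a * t + b * s), (s * t); split.
    by move=> /mem_set /Pp /orP[]/set_mem.
  by rewrite rmorphD !rmorphM addf_div ?N0.
- move=> c _ [a [s [Ps ->]]]; exists (c * a), s; split=> //.
  by rewrite rmorphM mulrA.
Qed.

Lemma supp_subP I X : supp I `<=` X <->
  forall P, ~ X P -> set_mul I (localization P) = localization P.
Proof.
split=> h P; first by move=> XP; apply: contrapT => /h.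
by move=> nP; apply: contrapT => /h.
Qed.

Lemma supp_dom X : supp dom_set `<=` X.
Proof. by apply/supp_subP => P _; apply/mul_dom/localization_submod. Qed.

Lemma localization_eq I J P : submod I -> submod J ->
  set_mul I J `<=` dom_set ->
  localization P `<=` set_mul I (localization P) ->
  localization P `<=` set_mul J (localization P) ->
  set_mul I (localization P) = localization P.
Proof.
move=> sI sJ IJ hI hJ; have sP := localization_submod P.
apply/seteqP; split=> // x /(mul_mono (@subset_refl _ I) hJ).
rewrite mul_assoc // => /(mul_mono IJ (@subset_refl _ (localization P))).
by rewrite mul_dom.
Qed.

Lemma Inv_colon I : Inv I -> set_mul I (colon I) = dom_set.
Proof.
case=> fI [J fJ e]; apply/seteqP; split; first by rewrite mul_com; apply: mul_colon.
by rewrite -e; apply: mul_mono => //; apply/sub_colonP; rewrite mul_com e.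
Qed.

Lemma Inv_on_dom X : Inv_on X dom_set.
Proof.
split; last exact: supp_dom.
split; first exact: dom_fractional.
exists dom_set; [exact: dom_fractional|exact/mul_dom/dom_submod].
Qed.

Lemma Inv_on_mul X I J : Inv_on X I -> Inv_on X J -> Inv_on X (set_mul I J).
Proof.
move=> [[fI [I' fI' eI]] /supp_subP XI] [[fJ [J' fJ' eJ]] /supp_subP XJ].
have [sI sJ sI' sJ'] := And4 (fractional_sub fI) (fractional_sub fJ)
  (fractional_sub fI') (fractional_sub fJ').
split; last first.
  apply/supp_subP => P XP; have sP := localization_submod P.
  by rewrite -mul_assoc // XJ // XI.
split; first exact: mul_fractional.
exists (set_mul J' I'); first exact: mul_fractional.
rewrite -mul_assoc //; last exact: mul_submod.
by rewrite (mul_assoc sJ) // eJ mul_dom.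
Qed.

Lemma Inv_on_colon X I : Inv_on X I -> Inv_on X (colon I).
Proof.
move=> [iI /supp_subP XI]; have e := Inv_colon iI; have [fI _] := iI.
have fC := colon_fractional fI.
have sI := fractional_sub fI; have sC := fractional_sub fC.
split; first by split=> //; exists I; rewrite // mul_com.
apply/supp_subP => P XP; have sP := localization_submod P.
by rewrite -{1}(XI P XP) mul_assoc // (mul_com _ I) e mul_dom.
Qed.

Lemma Inv_on_Div_on X I : Inv_on X I -> Div_on X I.
Proof.
move=> iI; have [II XI] := iI; have [IC XC] := Inv_on_colon iI.
have [fI _] := II; have [fC _] := IC.
have sI := fractional_sub fI; have sC := fractional_sub fC.
split=> //; split; last by split=> //; exists (colon I); rewrite // Inv_colon // vclos_dom.
split=> //; apply/seteqP; split; last exact: sub_vclos.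
rewrite -{1}[vclos I]mul_dom; last exact: colon_submod.
rewrite -(Inv_colon II) -mul_assoc //; last exact: colon_submod.
by rewrite -[X in _ `<=` X](mul_dom sI) mul_com; apply: mul_mono => //;
  rewrite mul_com; apply: mul_colon.
Qed.

Lemma Div_on_mul X I J :
  Div_on X I -> Div_on X J -> Div_on X (vclos (set_mul I J)).
Proof.
move=> [[_ [fI [I' fI' eI]]] /supp_subP XI /supp_subP XI'].
move=> [[_ [fJ [J' fJ' eJ]]] /supp_subP XJ /supp_subP XJ'].
have [sI sJ sI' sJ'] := And4 (fractional_sub fI) (fractional_sub fJ)
  (fractional_sub fI') (fractional_sub fJ').
have fIJ := mul_fractional fI fJ.
have sV := colon_submod (colon (set_mul I J)).
have sC := colon_submod (set_mul I J).
have sCI := colon_submod I; have sCJ := colon_submod J.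
have key P : ~ X P ->
    localization P `<=` set_mul (vclos (set_mul I J)) (localization P) /\
    localization P `<=` set_mul (colon (set_mul I J)) (localization P).
  move=> XP; have sP := localization_submod P; split.
    rewrite -{1}(XI P XP) -{1}(XJ P XP) mul_assoc //.
    by apply: mul_mono => //; apply: sub_vclos.
  rewrite -{1}(XI' P XP) -{1}(XJ' P XP) mul_assoc //.
  apply: mul_mono => //; apply/sub_colonP.
  have -> : set_mul (set_mul (colon I) (colon J)) (set_mul I J) =
      set_mul (set_mul (colon I) I) (set_mul (colon J) J).
    rewrite -!mul_assoc //; try exact: mul_submod.
    by rewrite (mul_assoc sCJ) // (mul_com (colon J) I) -mul_assoc.
  apply: (subset_trans (mul_mono (@mul_colon I) (@mul_colon J))).
  by rewrite mul_dom //; apply: dom_submod.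
split.
- split; first by split; [apply: vclos_fractional|rewrite vclosK].
  split; first exact: vclos_fractional.
  exists (set_mul J' I'); first exact: mul_fractional.
  rewrite vclos_mull -mul_assoc //; last exact: mul_submod.
  rewrite (mul_assoc sJ) // -vclos_mulr -(vclos_mull (set_mul J J')) eJ.
  by rewrite mul_dom // vclos_mulr.
- apply/supp_subP => P XP; have [h1 h2] := key P XP.
  apply: (@localization_eq _ (colon (set_mul I J))) => //.
  by apply/sub_colonP.
- rewrite colon_vclos; apply/supp_subP => P XP; have [h1 h2] := key P XP.
  apply: (@localization_eq _ (vclos (set_mul I J))) => //.
  by rewrite mul_com; apply/sub_colonP.
Qed.

Lemma Div_mul_colon I : Div I -> vclos (set_mul (colon I) I) = dom_set.
Proof.
move=> [_ [fI [J fJ e]]]; apply/seteqP; split.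
  by rewrite -[X in _ `<=` X]vclos_dom; apply/vclos_mono/mul_colon.
rewrite -e mul_com; apply/vclos_mono/mul_mono => //; apply/sub_colonP.
by rewrite mul_com -e; apply: sub_vclos.
Qed.

Lemma Div_on_colon X I : Div_on X I -> Div_on X (colon I).
Proof.
move=> [DI XI XC]; have [[fI eI] _] := DI.
have fC := colon_fractional fI.
split=> //; last by rewrite -/(vclos I) eI.
split; first by split=> //; apply: colon_vclos.
by split=> //; exists I => //; apply: Div_mul_colon.
Qed.

End Fractional.

Arguments dom_set {D}.

(* Both groups are commutative; their composition laws (the product of ideals,
   resp. the v-product) are written additively below, with neutral element [D]
   and with [(D : I)] as the inverse of [I]. *)
Definition inv_group (D : idomainType) (X : set (Spec D)) : Type :=
  set_type (Inv_on X).
Definition div_group (D : idomainType) (X : set (Spec D)) : Type :=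
  set_type (Div_on X).

Section Groups.
Variables (D : idomainType) (X : set (Spec D)).

HB.instance Definition _ := SubChoice.copy (inv_group X) (set_type (Inv_on X)).
HB.instance Definition _ := SubChoice.copy (div_group X) (set_type (Div_on X)).

Implicit Types (I J L : inv_group X) (A B C : div_group X).

Definition inv_zero : inv_group X := SigSub (mem_set (Inv_on_dom X)).
Definition inv_opp I : inv_group X :=
  SigSub (mem_set (Inv_on_colon (set_mem (valP I)))).
Definition inv_add I J : inv_group X :=
  SigSub (mem_set (Inv_on_mul (set_mem (valP I)) (set_mem (valP J)))).

Let inv_sub I : submod (val I).
Proof. have [[fI _] _] := set_mem (valP I); exact: fractional_sub fI. Qed.

Lemma inv_addA : associative inv_add.
Proof. by move=> I J L; apply: val_inj; rewrite /= mul_assoc //; apply: inv_sub. Qed.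
Lemma inv_addC : commutative inv_add.
Proof. by move=> I J; apply: val_inj; apply: mul_com. Qed.
Lemma inv_add0 : left_id inv_zero inv_add.
Proof. by move=> I; apply: val_inj; apply/mul_dom/inv_sub. Qed.
Lemma inv_addN : left_inverse inv_zero inv_opp inv_add.
Proof.
move=> I; apply: val_inj; rewrite /= mul_com; apply: Inv_colon.
by have [] := set_mem (valP I).
Qed.

HB.instance Definition _ :=
  GRing.isZmodule.Build (inv_group X) inv_addA inv_addC inv_add0 inv_addN.

Definition div_zero : div_group X :=
  SigSub (mem_set (Inv_on_Div_on (Inv_on_dom X))).
Definition div_opp A : div_group X :=
  SigSub (mem_set (Div_on_colon (set_mem (valP A)))).
Definition div_add A B : div_group X :=
  SigSub (mem_set (Div_on_mul (set_mem (valP A)) (set_mem (valP B)))).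

Let div_sub A : submod (val A).
Proof. have [[[fA _] _] _ _] := set_mem (valP A); exact: fractional_sub fA. Qed.

Lemma div_addA : associative div_add.
Proof.
by move=> A B C; apply: val_inj; rewrite /= vclos_mulr vclos_mull mul_assoc //;
  apply: div_sub.
Qed.
Lemma div_addC : commutative div_add.
Proof. by move=> A B; apply: val_inj; rewrite /= mul_com. Qed.
Lemma div_add0 : left_id div_zero div_add.
Proof.
move=> A; apply: val_inj; rewrite /= mul_dom; last exact: div_sub.
by have [[[_ e] _] _ _] := set_mem (valP A).
Qed.
Lemma div_addN : left_inverse div_zero div_opp div_add.
Proof.
move=> A; apply: val_inj; apply: Div_mul_colon.
by have [] := set_mem (valP A).
Qed.

HB.instance Definition _ :=
  GRing.isZmodule.Build (div_group X) div_addA div_addC div_add0 div_addN.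

Definition inv_to_div I : div_group X :=
  SigSub (mem_set (Inv_on_Div_on (set_mem (valP I)))).

Lemma inv_to_div_is_zmod_morphism : zmod_morphism inv_to_div.
Proof.
move=> I J; apply: val_inj; rewrite /= -[LHS]/(val (I - J)).
by have [[[_ ->]]] := Inv_on_Div_on (set_mem (valP (I - J))).
Qed.

HB.instance Definition _ := GRing.isZmodMorphism.Build
  (inv_group X) (div_group X) inv_to_div inv_to_div_is_zmod_morphism.

Definition inv_in_div : {pred div_group X} := [in range inv_to_div].

Lemma inv_in_div_zmod_closed : zmod_closed inv_in_div.
Proof.
split; first by apply/mem_set; exists 0; rewrite // raddf0.
move=> A B /set_mem[I _ <-] /set_mem[J _ <-].
by apply/mem_set; exists (I - J); rewrite // raddfB.
Qed.

HB.instance Definition _ := GRing.isZmodClosed.Build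
  (div_group X) inv_in_div inv_in_div_zmod_closed.

Definition div_mod_inv : zmodType := Quotient.quot inv_in_div.

End Groups.

Definition compactly_supported (Y : topologicalType) : set (Y -> int) :=
  [set f | continuous (f : Y -> discrete_topology int) /\
           compact (closure [set y | f y != 0])].

Definition Cc_pred (Y : topologicalType) : {pred Y -> int} :=
  [in @compactly_supported Y].

Record Cc (Y : topologicalType) := MkCc {
  Cc_fun :> Y -> int ;
  CcP : Cc_fun \in @Cc_pred Y }.

Section Cc.
Variable Y : topologicalType.

Lemma continuous_intP (f : Y -> int) :
  continuous (f : Y -> discrete_topology int) <->
  forall y, nbhs y [set z | f z = f y].
Proof.
split=> cf y.
  exact: (cf y _ (discrete_set1 (f y : discrete_topology int))).
by move=> U /principal_filterP Ufy; apply: filterS (cf y) => z /= ->.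
Qed.

Lemma Cc_pred_zmod_closed : zmod_closed (@Cc_pred Y).
Proof.
split.
  apply/mem_set; split.
    exact: (@cst_continuous Y (discrete_topology int) 0).
  rewrite (_ : [set _ | _] = set0) ?closure0; first exact: compact0.
  by apply/seteqP; split=> y //=; rewrite eqxx.
move=> f g /set_mem[cf kf] /set_mem[cg kg]; apply/mem_set; split.
  move/continuous_intP: cf => cf; move/continuous_intP: cg => cg.
  apply/continuous_intP => y; apply: filterS2 (cf y) (cg y) => z /= fz gz.
  by rewrite !fctE fz gz.
apply: (subclosed_compact (@closed_closure _ _) (compactU kf kg)).
rewrite -closureU; apply: closureS => y /=; apply: contra_neqP.
by move=> /not_orP[/= /negP/negPn/eqP F /negP/negPn/eqP G]; rewrite /= !fctE F G subr0.
Qed.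

HB.instance Definition _ := GRing.isZmodClosed.Build
  (Y -> int) (@Cc_pred Y) Cc_pred_zmod_closed.
HB.instance Definition _ := [isSub for @Cc_fun Y].
HB.instance Definition _ := [Choice of Cc Y by <:].
HB.instance Definition _ := [SubChoice_isSubZmodule of Cc Y by <:].

End Cc.

Definition extremally_disconnected (T : topologicalType) : Prop :=
  hausdorff_space T /\ forall U : set T, open U -> open (closure U).

Definition perfect_map (S T : topologicalType) (f : S -> T) : Prop :=
  [/\ continuous f, forall A, closed A -> closed (f @` A)
    & forall y, compact (f @^-1` [set y])].

Definition irreducible_map (S T : topologicalType) (f : S -> T) : Prop :=
  forall A, closed A -> f @` A = setT -> A = setT.

Definition gleason_cover (E T : topologicalType) (f : E -> T) : Prop :=
  [/\ extremally_disconnected E, perfect_map f, range f = setT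
    & irreducible_map f].

Definition free_abelian (G : zmodType) : Prop :=
  exists (T : choiceType) (f : {additive {freeg T / int} -> G}), bijective f.

(* Main.v *)
Require Import Defs.
From HB Require Import structures.
From mathcomp Require Import all_boot all_order all_algebra.
From mathcomp Require Import finmap.
From mathcomp Require Import all_classical topology.
From mathcomp Require Import wochoice.
From mathcomp Require Import freeg.
From mathcomp Require Import zify ring.

Set Implicit Arguments.
Unset Strict Implicit.
Unset Printing Implicit Defensive.

Import Order.TTheory GRing.Theory Num.Theory.
Local Open Scope classical_set_scope.
Local Open Scope ring_scope.
Local Open Scope quotient_scope.

(** For M in X the localization of D at M is a valuation ring, and its maximal
ideal has a generator t: a radical ideal of Inv_X(D) below M, which exists
since M is not critical, coincides with M locally ([radical_gen]).  No prime
strictly below M lies in X, because X consists of maximal ideals, so every I in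
Inv_X(D) equals t ^ n locally at M for some integer n ([ord_at_ex]).  These
exponents form a function nu_I on X.  It is continuous with compact support
because the sets V(J), J finitely generated, are open and, when they lie in X,
compact; radical ideals provide the characteristic functions of the compact open
sets.  So I |-> nu_I is an isomorphism of Inv_X(D) onto C_c(X, Z) that reverses
the order ([nuI_sub], [nuI_Cc], [nuI_onto]).

An ideal A in Div_X(D) is the union of the members of Inv_X(D) below it and the
intersection of those above it, so Div_X(D) consists of the Dedekind cuts of
Inv_X(D) ([div_mem], [div_inf], [cut_div]).  Let nu_A be the pointwise minimum
of the nu_C with C contained in A: an upper semicontinuous function, and A is
contained in C exactly when nu_C <= nu_A.  Two upper semicontinuous functions
with the same minorants in C_c(X, Z) agree on a dense open set
([vanish_of_minorants]).  Hence A |-> nu_A is additive modulo the functions that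
vanish on a dense open set, and it identifies Div_X(D) with T modulo such
functions, where T is the group spanned by the characteristic functions of the
closed sets contained in compact sets.

Composition with the Gleason cover pi preserves and reflects vanishing on a
dense open set, because pi is closed and irreducible ([vanish_comp]).  As E is
extremally disconnected, each class of T contains, after this composition,
exactly one member of C_c(E, Z), and every member is reached; this is the right
vertical arrow ([gleason_iso]).

The groups are free by Noebeling's theorem, in the form given to it by Bergman
([free_mod_idempotents]): a commutative ring spanned by idempotents is free
modulo an ideal with torsion-free quotient, and also modulo the sum of such an
ideal and a subring spanned by some of the idempotents.  Well-order the
idempotents and adjoin them one by one.  Adjoining w to a ring M adds w M, which
modulo what is already there is the quotient of M by the ideal of the f for
which w f is already there.  This quotient is torsion-free ([idempotent_pure]),
so the first assertion applies to it (by well-founded induction on w, in the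
proof of that assertion itself); the bases found at all stages together form a
basis ([free_mod_chain]).  The ideal is that of the functions vanishing on a
dense open set; the subring is zero for Div_X(D), and
it is C_c(X, Z) for the quotient by Inv_X(D). *)

(** * Free quotients along a well-ordered chain of subgroups *)

Lemma strict_well_order (T : eqType) : exists lt : T -> T -> Prop,
  [/\ well_founded lt, forall x y z, lt x y -> lt y z -> lt x z
    & forall x y, [\/ lt x y, x = y | lt y x]].
Proof.
have [R wR] := well_ordering_principle T.
have anti x y : R x y -> R y x -> x = y.
  move=> xy yx.
  have [|z [_ uz]] := wR (pred2 x y); first by exists x; rewrite inE eqxx.
  have [Rx Ry] : R x x /\ R y y.
    split; [have [|t [[+ lt] _]] := wR (pred1 x)|have [|t [[+ lt] _]] := wR (pred1 y)].
    - by exists x; rewrite inE.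
    - by rewrite inE => /eqP et; subst t; apply: lt; rewrite inE.
    - by exists y; rewrite inE.
    - by rewrite inE => /eqP et; subst t; apply: lt; rewrite inE.
  rewrite -(uz x); last first.
    by split; rewrite ?inE ?eqxx // => t; rewrite inE => /orP[]/eqP->.
  rewrite -(uz y) //.
  by split; rewrite ?inE ?eqxx ?orbT // => t; rewrite inE => /orP[]/eqP->.
have tot x y : R x y \/ R y x.
  have [|z [[]]] := wR (pred2 x y); first by exists x; rewrite inE eqxx.
  rewrite inE => /orP[]/eqP-> h _.
    by left; apply: h; rewrite inE eqxx orbT.
  by right; apply: h; rewrite inE eqxx.
have trans x y z : R x y -> R y z -> R x z.
  move=> xy yz.
  have [|t [[+ ht] _]] := wR (pred3 x y z); first by exists x; rewrite inE eqxx.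
  have [hx hy hz] := And3 (ht x) (ht y) (ht z).
  move: hx hy hz; rewrite !inE !eqxx !orbT => /(_ isT) hx /(_ isT) hy /(_ isT) hz.
  case/or3P => /eqP e; subst t => //.
    by rewrite (anti _ _ xy hx).
  by rewrite -(anti _ _ yz hy).
exists (fun x y => R x y /\ x <> y); split.
- move=> x; apply: contrapT => nx.
  have [|z [[+ hz] _]] := wR [pred y | `[< ~ Acc (fun x y => R x y /\ x <> y) y >]].
    by exists x; rewrite inE.
  rewrite inE; apply; constructor => y [yz nyz].
  apply: contrapT => ny; apply: nyz; apply: anti => //; apply: hz.
  by rewrite inE.
- move=> x y z [xy nxy] [yz nyz]; split; first exact: trans yz.
  by move=> e; subst z; apply: nxy; apply: anti.
- move=> x y; have [->|/eqP nxy] := eqVneq x y; first by constructor 2.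
  by have [xy|yx] := tot x y; [constructor 1|constructor 3]; split=> // e; apply: nxy.
Qed.

Section FreeMod.
Variable V : zmodType.
Implicit Types (H M N B : set V).

Definition subgrp H := H 0 /\ forall x y, H x -> H y -> H (x - y).

Definition zspan B : set V := [set x | forall H, subgrp H -> B `<=` H -> H x].

Definition indep_mod N B := forall (s : seq V) (c : V -> int), uniq s ->
  (forall x, x \in s -> B x) -> N (\sum_(x <- s) x *~ c x) ->
  forall x, x \in s -> c x = 0.

(** M modulo its intersection with N is free, on the classes of B. Spanning is
stated with subgroups, so that only independence involves coefficients. *)
Definition free_mod M N := exists B, [/\ B `<=` M, indep_mod N B
  & forall H, subgrp H -> N `<=` H -> B `<=` H -> M `<=` H].

Lemma subgrpN H x : subgrp H -> H x -> H (- x).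
Proof. by case=> H0 HB Hx; rewrite -sub0r; apply: HB. Qed.

Lemma subgrpD H x y : subgrp H -> H x -> H y -> H (x + y).
Proof. by move=> zH Hx Hy; rewrite -[y]opprK; apply: zH.2 => //; apply: subgrpN. Qed.

Lemma subgrp_sum H (I : eqType) (s : seq I) (F : I -> V) : subgrp H ->
  (forall i, i \in s -> H (F i)) -> H (\sum_(i <- s) F i).
Proof.
move=> zH h; rewrite big_seq; apply: (big_ind H) => //; first by case: zH.
by move=> x y; apply: subgrpD.
Qed.

Lemma subgrpMn H x n : subgrp H -> H x -> H (x *+ n).
Proof.
move=> zH Hx; elim: n => [|n IH]; first by rewrite mulr0n; case: zH.
by rewrite mulrS; apply: subgrpD.
Qed.

Lemma subgrpMz H x (k : int) : subgrp H -> H x -> H (x *~ k).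
Proof.
by move=> zH Hx; case: k => n; [|apply: subgrpN => //]; apply: subgrpMn.
Qed.

Lemma zspan_subgrp B : subgrp (zspan B).
Proof.
split=> [H [] //|x y hx hy H zH BH].
by apply: zH.2; [apply: hx|apply: hy].
Qed.

Lemma sub_zspan B : B `<=` zspan B.
Proof. by move=> x Bx H _; apply. Qed.

Lemma zspan_sub B H : subgrp H -> B `<=` H -> zspan B `<=` H.
Proof. by move=> zH BH x; apply. Qed.

Lemma zspanU M N x : subgrp M -> subgrp N -> zspan (M `|` N) x ->
  exists m n, [/\ M m, N n & x = m + n].
Proof.
move=> zM zN /(_ [set x | exists m n, [/\ M m, N n & x = m + n]]); apply; last first.
  move=> y []hy; [exists y, 0|exists 0, y]; rewrite ?addr0 ?add0r; split=> //.
    by case: zN.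
  by case: zM.
split; first by exists 0, 0; rewrite addr0; case: zM zN => ? ? [].
move=> _ _ [m [n [Mm Nn ->]]] [m' [n' [Mm' Nn' ->]]]; exists (m - m'), (n - n').
by split; [apply: zM.2|apply: zN.2|rewrite opprD addrACA].
Qed.

Lemma free_mod_widen M M' N : M `<=` M' -> M' `<=` zspan (M `|` N) ->
  free_mod M N -> free_mod M' N.
Proof.
move=> MM' M'M [B [BM iB sB]]; exists B; split=> //; first exact: subset_trans MM'.
move=> H zH NH BH; apply: (subset_trans M'M); apply: zspan_sub => //.
by move=> x [/(sB _ zH NH BH)|/NH].
Qed.

Lemma free_mod_sub M N : M `<=` N -> free_mod M N.
Proof.
move=> MN; exists set0; split=> //; first by move=> s c _ h _ x /h.
by move=> H _ NH _; apply: subset_trans NH.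
Qed.

Lemma seq_max (W : Type) (lt : W -> W -> Prop) (T : eqType) (g : T -> W) :
  (forall x y z, lt x y -> lt y z -> lt x z) ->
  (forall x y, [\/ lt x y, x = y | lt y x]) ->
  forall x (s : seq T), exists2 y, y \in x :: s &
    forall z, z \in x :: s -> g z = g y \/ lt (g z) (g y).
Proof.
move=> tr tot x s; elim: s x => [|a s IH] x.
  by exists x; rewrite ?mem_head // => z; rewrite inE => /eqP->; left.
have [y ys hy] := IH a.
have [lxy|exy|lyx] := tot (g x) (g y).
- exists y; first by rewrite inE ys orbT.
  by move=> z; rewrite inE => /orP[/eqP->|/hy //]; right.
- exists y; first by rewrite inE ys orbT.
  by move=> z; rewrite inE => /orP[/eqP->|/hy //]; left.
- exists x; first by rewrite mem_head.
  move=> z; rewrite inE => /orP[/eqP->|/hy[->|h]]; first by left.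
    by right.
  by right; apply: tr lyx.
Qed.

(** The bases of the layers [Q w] form a basis together: in a relation modulo
N, the terms of the highest layer give a relation modulo N and the lower
layers, so their coefficients vanish and a shorter relation remains. *)
Lemma free_mod_chain (W : eqType) (lt : W -> W -> Prop) (Q : W -> set V) N :
  well_founded lt -> (forall x y z, lt x y -> lt y z -> lt x z) ->
  (forall x y, [\/ lt x y, x = y | lt y x]) -> subgrp N ->
  (forall w, free_mod (Q w) (zspan (N `|` \bigcup_(v in lt^~ w) Q v))) ->
  free_mod (zspan (\bigcup_w Q w)) N.
Proof.
move=> wf tr tot zN fQ.
pose F w := zspan (N `|` \bigcup_(v in lt^~ w) Q v).
have [B hB] := choice fQ.
exists (\bigcup_w B w); split.
- apply: subset_trans (@sub_zspan _); apply: subset_bigcup => w _.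
  by case: (hB w).
- move=> s c; have [n] := ubnP (size s).
  elim: n s c => // n IH s c szs us sB sN x0 x0s.
  have /choice[g hg] : forall x, exists w, x \in s -> B w x.
    move=> x; have [/sB[w _ Bw]|xs] := boolP (x \in s); first by exists w.
    by have [w _ _] := sB x0 x0s; exists w.
  have [y ys ymax] : exists2 y, y \in s &
      forall z, z \in s -> g z = g y \/ lt (g z) (g y).
    by case: s x0s {szs us sB sN hg} => // a s' _; apply: seq_max.
  set w := g y.
  pose P x := g x == w.
  have sE : \sum_(x <- s) x *~ c x = \sum_(x <- [seq x <- s | P x]) x *~ c x +
     \sum_(x <- [seq x <- s | predC P x]) x *~ c x by rewrite (bigID P) !big_filter.
  have inN : F w (\sum_(x <- s) x *~ c x) by apply: sub_zspan; left.
  have low : F w (\sum_(x <- [seq x <- s | predC P x]) x *~ c x).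
    apply: (@subgrp_sum (F w)); first exact: zspan_subgrp.
    move=> x; rewrite mem_filter /= /P => /andP[/eqP nx xs].
    apply: (@subgrpMz (F w)); first exact: zspan_subgrp.
    apply: sub_zspan; right; exists (g x); first by have [] := ymax x xs.
    by have [h _ _] := hB (g x); apply/h/hg.
  have c0 x : x \in [seq x <- s | P x] -> c x = 0.
    have [_ iB _] := hB w; apply: iB; first exact: filter_uniq.
      by move=> z; rewrite mem_filter => /andP[/eqP <- /hg].
    have -> : \sum_(x <- [seq x <- s | P x]) x *~ c x =
        \sum_(x <- s) x *~ c x - \sum_(x <- [seq x <- s | predC P x]) x *~ c x.
      by rewrite sE addrK.
    by apply: (zspan_subgrp _).2.
  have [Px|nPx] := boolP (P x0); first by apply: c0; rewrite mem_filter Px.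
  apply: (IH ([seq x <- s | predC P x])); rewrite ?mem_filter /= ?nPx //.
  - apply: (@leq_trans (size s)); last by rewrite -ltnS.
    rewrite size_filter -(count_predC P s).
    rewrite -[X in (X < _)%N]add0n ltn_add2r -has_count; apply/hasP; exists y => //.
    by rewrite /P /w.
  - by rewrite filter_uniq.
  - by move=> z; rewrite mem_filter => /andP[_ /sB].
  - suff <- : \sum_(x <- s) x *~ c x = \sum_(x <- [seq x <- s | predC P x]) x *~ c x by [].
    rewrite sE [X in X + _]big1_seq ?add0r // => z /andP[_ /c0 ->].
    by rewrite mulr0z.
- move=> H zH NH BH; apply: zspan_sub => //.
  suff QH w : Q w `<=` H by move=> x [w _ /QH].
  elim/(well_founded_ind wf): w => w IH.
  have [_ _ sB] := hB w; apply: sB => //.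
    by apply: zspan_sub => // x [/NH|[v vw /IH]] //; apply.
  by move=> x Bx; apply: BH; exists w.
Qed.

Lemma free_mod_ext M N N1 : subgrp N -> subgrp N1 -> N `<=` N1 -> N1 `<=` M ->
  subgrp M -> free_mod N1 N -> free_mod M N1 -> free_mod M N.
Proof.
move=> zN zN1 NN1 N1M zM f1 f2.
pose Q (b : bool) := if b then M else N1.
have <- : zspan (\bigcup_w Q w) = M.
  apply/seteqP; split; last by move=> x Mx; apply: sub_zspan; exists true.
  by apply: zspan_sub => // x [[] _] //= /N1M.
have wf : well_founded (fun a b : bool => ~~ a && b).
  have h : Acc (fun a b : bool => ~~ a && b) false.
    by constructor=> y; rewrite andbF.
  case; last exact: h.
  by constructor=> -[] // _; exact: h.
apply: (free_mod_chain wf) => //.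
- by case=> -[] [].
- by case=> -[]; [constructor 2|constructor 3|constructor 1|constructor 2].
case; last first.
  have -> : zspan (N `|` \bigcup_(v in (fun a => ~~ a && false)) Q v) = N.
    apply/seteqP; split; last by move=> x Mx; apply: sub_zspan; left.
    by apply: zspan_sub => // x [//|[v]]; rewrite /= andbF.
  exact: f1.
have -> : zspan (N `|` \bigcup_(v in (fun a => ~~ a && true)) Q v) = N1.
  apply/seteqP; split.
    by apply: zspan_sub => // x [/NN1 //|[[] //]].
  by move=> x Mx; apply: sub_zspan; right; exists false.
exact: f2.
Qed.

End FreeMod.

(** * Rings generated by idempotents *)

Section Idempotents.
Variable R : comPzRingType.
Implicit Types (S M N G H : set R).

(** No unit is adjoined: C_c(X, Z) has one only when X is compact. *)
Definition nalg S : set R := [set x | forall H, subgrp H ->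
  (forall a b, H a -> H b -> H (a * b)) -> S `<=` H -> H x].

Definition idempotents S := forall s, S s -> s * s = s.

(** The last clause says that M modulo its intersection with N is
torsion-free. *)
Definition pure_ideal M N := [/\ subgrp N,
  forall m n, M m -> N n -> N (m * n)
  & forall p x, prime p -> M x -> N (x *+ p) -> N x].

Lemma nalg_subgrp S : subgrp (nalg S).
Proof.
split=> [H [H0 _] _ _ //|x y hx hy H zH mH SH].
by apply: zH.2; [apply: hx|apply: hy].
Qed.

Lemma nalg_mul S x y : nalg S x -> nalg S y -> nalg S (x * y).
Proof. by move=> hx hy H zH mH SH; apply: (mH); [exact: hx|exact: hy]. Qed.

Lemma sub_nalg S : S `<=` nalg S.
Proof. by move=> x Sx H _ _; apply. Qed.

Lemma nalg_sub S H : subgrp H -> (forall a b, H a -> H b -> H (a * b)) ->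
  S `<=` H -> nalg S `<=` H.
Proof. by move=> zH mH SH x; apply. Qed.

Lemma nalg_mono S G : S `<=` G -> nalg S `<=` nalg G.
Proof.
move=> SG; apply: nalg_sub; [exact: nalg_subgrp|exact: nalg_mul|].
by apply: subset_trans SG _; apply: sub_nalg.
Qed.

Lemma nalg_exp S x n : nalg S x -> nalg S (x ^+ n.+1).
Proof. by move=> Sx; elim: n => // n IH; rewrite exprS; apply: nalg_mul. Qed.

Lemma nalg1_ideal S m x : nalg (1 |` S) m -> nalg S x -> nalg S (m * x).
Proof.
have zS := nalg_subgrp S.
have: nalg (1 |` S) `<=` [set m | nalg (1 |` S) m /\ forall x, nalg S x -> nalg S (m * x)].
  apply: nalg_sub.
  - split; first by split=> [|y]; rewrite ?mul0r; [case: (nalg_subgrp (1 |` S))|case: zS].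
    move=> a b [Sa ha] [Sb hb]; split; first exact: (nalg_subgrp _).2.
    by move=> y Sy; rewrite mulrBl; apply: zS.2; [apply: ha|apply: hb].
  - move=> a b [Sa ha] [Sb hb]; split; first exact: nalg_mul.
    by move=> y Sy; rewrite -mulrA; apply: ha; apply: hb.
  - move=> a Sa; split; first exact: sub_nalg.
    case: Sa => [->|Sa] y Sy; first by rewrite mul1r.
    by apply: nalg_mul => //; apply: sub_nalg.
by move=> h /h[_]; apply.
Qed.

Lemma zspan_mul S : (forall a b, S a -> S b -> zspan S (a * b)) ->
  forall a b, zspan S a -> zspan S b -> zspan S (a * b).
Proof.
move=> h a b ha hb; have zS := zspan_subgrp S.
have: zspan S `<=` [set a | zspan S (a * b)].
  apply: zspan_sub => [|x Sx].
    by split=> [|x y]; rewrite /= ?mul0r ?mulrBl; [case: zS|apply: zS.2].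
  have: zspan S `<=` [set b | zspan S (x * b)].
    apply: zspan_sub => [|y Sy]; last exact: h.
    by split=> [|y z]; rewrite /= ?mulr0 ?mulrBr; [case: zS|apply: zS.2].
  exact.
exact.
Qed.

Lemma nalg_zspan S :
  (forall a b, S a -> S b -> S (a * b)) -> nalg S `<=` zspan S.
Proof.
move=> h; apply: nalg_sub; [exact: zspan_subgrp| |exact: sub_zspan].
by apply: zspan_mul => a b Sa Sb; apply: sub_zspan; exact: h.
Qed.

(** Modulo p, raising to the power p is additive and fixes the generators. *)
Lemma nalg_frobenius S p x : idempotents S -> prime p -> nalg S x ->
  exists2 y, nalg S y & x ^+ p = x + y *+ p.
Proof.
move=> iS pp; have zS := nalg_subgrp S; have p0 := prime_gt0 pp.
have add a b : nalg S a -> nalg S b ->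
    exists2 y, nalg S y & (a + b) ^+ p = a ^+ p + b ^+ p + y *+ p.
  move=> Sa Sb; rewrite exprDn; case: p pp p0 => // p pp _.
  rewrite big_ord_recl big_ord_recr /= subn0 expr0 mulr1 bin0 mulr1n.
  rewrite /bump /= add1n subnn binn expr0 mul1r mulr1n.
  rewrite addrA addrAC -addrA.
  suff [y Sy ->] : exists2 y, nalg S y & \sum_(i < p)
      a ^+ (p.+1 - bump 0 i) * b ^+ (bump 0 i) *+ 'C(p.+1, bump 0 i) = y *+ p.+1.
    by exists y => //; rewrite addrA.
  apply: (big_ind (fun s => exists2 y, nalg S y & s = y *+ p.+1)).
  - by exists 0; rewrite ?mul0rn; case: zS.
  - by move=> _ _ [y Sy ->] [z Sz ->]; exists (y + z); rewrite ?mulrnDl //; apply: (subgrpD zS).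
  - move=> i _; rewrite /bump /= add1n subSS.
    have /dvdnP[k ->] : (p.+1 %| 'C(p.+1, i.+1))%N.
      apply: prime_dvd_bin => //; apply/andP; split=> //.
      exact: ltn_ord.
    exists (a ^+ (p - i) * b ^+ i.+1 *+ k); last by rewrite mulrnA.
    apply: (subgrpMn _ zS) => //; apply: nalg_mul; last exact: nalg_exp.
    by rewrite -(subnSK (ltn_ord i)); apply: nalg_exp.
suff: nalg S `<=` [set x | nalg S x /\ exists2 y, nalg S y & x ^+ p = x + y *+ p].
  by move=> h /h[].
apply: nalg_sub.
- have closedD a b : [set x | nalg S x /\ exists2 y, nalg S y & x ^+ p = x + y *+ p] a ->
     [set x | nalg S x /\ exists2 y, nalg S y & x ^+ p = x + y *+ p] b ->
     [set x | nalg S x /\ exists2 y, nalg S y & x ^+ p = x + y *+ p] (a + b).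
    move=> [Sa [y Sy ey]] [Sb [z Sz ez]]; split; first exact: (subgrpD zS).
    have [t St ->] := add a b Sa Sb; exists (y + z + t).
      by do !apply: (subgrpD zS) => //.
    by rewrite ey ez !mulrnDl !addrA; congr (_ + _); rewrite -!addrA; congr (_ + _); rewrite addrCA.
  split.
    by split; [case: zS|exists 0; [case: zS|rewrite mul0rn addr0 expr0n gtn_eqF]].
  move=> a b ha [Sb [z Sz ez]]; apply: closedD => //; split; first exact: (subgrpN zS).
  have [t St] := add b (- b) Sb (subgrpN zS Sb).
  rewrite subrr expr0n gtn_eqF //= ez => e.
  exists (- z - t); first by apply: (nalg_subgrp S).2 => //; apply: (subgrpN zS).
  have /addr0_eq <- : (b + z *+ p + t *+ p) + (- b) ^+ p = 0 by rewrite addrAC.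
  by rewrite !opprD mulrnBl mulNrn addrA.
- move=> a b [Sa [y Sy ey]] [Sb [z Sz ez]]; split; first exact: nalg_mul.
  exists (a * z + y * b + y * z *+ p).
    by apply: (subgrpD zS); [apply: (subgrpD zS)|apply: (subgrpMn _ zS)]; exact: nalg_mul.
  rewrite exprMn ey ez mulrDl !mulrDr !mulrnDl !mulrnAr !mulrnAl !addrA.
  by [].
- move=> s Ss; split; first exact: sub_nalg.
  exists 0; first by case: zS.
  rewrite mul0rn addr0; case: p pp {p0 add} => // p _.
  by elim: p => // p IH; rewrite exprS IH iS.
Qed.

Lemma sub_idempotents S G : S `<=` G -> idempotents G -> idempotents S.
Proof. by move=> SG iG s /SG /iG. Qed.

(** Torsion-freeness of each stage of the tower. Put h = w f, so that h ^ 2 =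
f h. From p h = g modulo N follows g ^ 2 = p f g modulo N, so p divides g ^ p;
as g ^ p = g modulo p by [nalg_frobenius], p divides g, and h lies in the
subring generated by S' modulo N because N is pure. *)
Lemma idempotent_pure S S' N w p f g n : idempotents S -> S' `<=` S ->
  pure_ideal (nalg (1 |` S)) N -> S w -> prime p -> nalg (1 |` S') f ->
  nalg S' g -> N n -> (w * f) *+ p = n + g ->
  exists n' g', [/\ N n', nalg S' g' & w * f = n' + g'].
Proof.
move=> iS S'S [zN mN pN] Sw pp Mf' Tg Nn e.
have iS' := sub_idempotents S'S iS.
have zM := nalg_subgrp (1 |` S).
have MT : nalg S' `<=` nalg (1 |` S) by apply: nalg_mono => x /S'S; right.
have Mf : nalg (1 |` S) f.
  by apply: nalg_mono Mf' => x [->|/S'S]; [left|right].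
have Mw : nalg (1 |` S) w by apply: sub_nalg; right.
set h := w * f; have Mh : nalg (1 |` S) h by apply: nalg_mul.
have hh : h * h = f * h by rewrite /h mulrACA iS // mulrCA mulrA.
have Mg : nalg (1 |` S) g := MT _ Tg.
have gE : g = h *+ p - n by rewrite e addrAC subrr add0r.
have Mn : nalg (1 |` S) n.
  have -> : n = h *+ p - g by rewrite e addrK.
  by apply: zM.2 => //; apply: (subgrpMn _ zM).
(* g ^ 2 = p f g modulo N *)
have gg : exists2 n1, N n1 & g * g = (f * g) *+ p + n1.
  exists (((f - h) *+ p - g) * n).
    apply: mN => //; apply: zM.2 => //; apply: (subgrpMn _ zM); exact: zM.2.
  have hg : h * g = f * g + (f - h) * n.
    rewrite {1}gE mulrBr mulrnAr hh -mulrnAr e mulrDr mulrBl.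
    by rewrite [f * n + _]addrC addrA.
  by rewrite {1}gE mulrBl mulrnAl hg mulrnDl [in RHS]mulrBl mulrnAl (mulrC n) addrA.
case: gg => n1 Nn1 gg.
have [q pE] : exists q, p = q.+2 by case: p pp {e gE gg} => [|[|q]] // _; exists q.
have [y Ty gp] := nalg_frobenius iS' pp Tg.
(* multiply by g ^ (p - 2) *)
have [n2 Nn2 gpE] : exists2 n2, N n2 & g ^+ p = (f * g ^+ q.+1) *+ p + n2.
  exists (g ^+ q * n1).
    case: q pE => [|q] _; first by rewrite expr0 mul1r.
    by apply: mN => //; apply: nalg_exp.
  rewrite {1}pE -addn2 exprD expr2 gg mulrDr mulrnAr; congr (_ *+ _ + _).
  by rewrite mulrCA -exprSr.
(* the quotient of g = g ^ p - y p by p *)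
set g' := f * g ^+ q.+1 - y.
have Tg' : nalg S' g'.
  apply: (nalg_subgrp S').2 => //; apply: nalg1_ideal => //; exact: nalg_exp.
exists (h - g'), g'; split=> //; last by rewrite subrK.
apply: (pN p) => //.
  by apply: zM.2 => //; apply: MT.
rewrite mulrnBl e; have -> : g = g' *+ p + n2.
  by rewrite mulrnBl addrAC -gpE gp addrK.
by rewrite [_ + n2]addrC addrA addrK; exact: (subgrpD zN).
Qed.

Section Tower.
Variable lt : R -> R -> Prop.
Hypotheses (wf : well_founded lt) (tr : forall x y z, lt x y -> lt y z -> lt x z)
  (tot : forall x y, [\/ lt x y, x = y | lt y x]).

Definition below G w : set R := [set v | G v /\ lt v w].

(** The contribution of w to the ring generated by S and G. *)
Definition layer S G w : set R := [set x | G w /\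
  exists2 m, nalg (1 |` (S `|` below G w)) m & x = w * m].

(** A product of two elements from different layers lies in the higher one, so
the layers together with [nalg S] already span a ring. *)
Lemma nalg_layers S G (L : set R) : idempotents G ->
  nalg (S `|` (G `&` L)) `<=` zspan (nalg S `|` \bigcup_(w in L) layer S G w).
Proof.
move=> iG.
have S1 w : nalg S `<=` nalg (1 |` (S `|` below G w)).
  by apply: nalg_mono => s Ss; right; left.
have step a b w v : layer S G w a -> layer S G v b -> lt w v -> layer S G v (a * b).
  move=> [Gw [m Mm ->]] [Gv [m' Mm' ->]] wv; split=> //.
  exists (w * m * m'); last by rewrite mulrCA.
  apply: nalg_mul => //; apply: nalg_mul; first by apply: sub_nalg; right; right.
  apply: nalg_mono Mm => x [->|[Sx|[Gx xw]]]; [left|right; left|right; right] => //.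
  by split=> //; apply: tr wv.
have step0 a b v : nalg S a -> layer S G v b -> layer S G v (a * b).
  move=> Sa [Gv [m Mm ->]]; split=> //; exists (a * m); last by rewrite mulrCA.
  by apply: nalg_mul => //; apply: S1.
apply: nalg_sub.
- exact: zspan_subgrp.
- apply: zspan_mul => a b [Sa|[w Lw wa]] [Sb|[v Lv vb]]; apply: sub_zspan.
  + by left; apply: nalg_mul.
  + by right; exists v => //; apply: step0.
  + by right; exists w => //; rewrite mulrC; apply: step0.
  + right; have [wv|wv|vw] := tot w v.
    * by exists v => //; apply: step wa vb wv.
    * exists v => //; move: wa vb; rewrite wv => -[Gv [m Mm ->]] [_ [m' Mm' ->]].
      by split=> //; exists (m * m'); [apply: nalg_mul|rewrite mulrACA iG].
    * by exists w => //; rewrite mulrC; apply: step vb wa vw.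
- move=> x [Sx|[Gx Lx]]; apply: sub_zspan; first by left; apply: sub_nalg.
  right; exists x => //; split=> //; exists 1; last by rewrite mulr1.
  by apply: sub_nalg; left.
Qed.

(** Multiplication by w identifies the layer of w, modulo what lies below,
with the quotient of M by the ideal of the f for which w f lies below, and
this ideal is pure by [idempotent_pure]. *)
Lemma free_mod_layer S G N w : idempotents (S `|` G) ->
  pure_ideal (nalg (1 |` (S `|` G))) N -> G w ->
  (forall N', let M := nalg (1 |` (S `|` below G w)) in
     N' `<=` M -> pure_ideal M N' -> free_mod M N') ->
  free_mod (layer S G w) (zspan (N `|` nalg (S `|` below G w))).
Proof.
set S' := S `|` below G w; set T := nalg S'; set M := nalg (1 |` S').
move=> iSG pN Gw freeM; have [zN mN _] := pN.
have S'S : S' `<=` S `|` G by move=> x [|[]]; [left|right].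
have MM : M `<=` nalg (1 |` (S `|` G)).
  by apply: nalg_mono => x [->|/S'S]; [left|right].
have zM : subgrp M := nalg_subgrp _.
have zT : subgrp T := nalg_subgrp _.
set F := zspan (N `|` T); have zF : subgrp F := zspan_subgrp _.
have MF m x : M m -> F x -> F (m * x).
  move=> Mm /(zspanU zN zT)[n [t [Nn Tt ->]]]; rewrite mulrDr.
  apply: (subgrpD zF); apply: sub_zspan; [left|right]; first by apply: mN => //; apply: MM.
  exact: nalg1_ideal.
pose N' := [set f | M f /\ F (w * f)].
have [B [BM iB sB]] : free_mod M N'.
  apply: freeM => [f []//|]; split.
  - split; first by split; rewrite ?mulr0; [case: zM|case: zF].
    move=> a b [Ma Fa] [Mb Fb]; split; first exact: zM.2.
    by rewrite mulrBr; apply: zF.2.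
  - move=> m f Mm [Mf Ff]; split; first exact: nalg_mul.
    by rewrite mulrCA; apply: MF.
  - move=> p f pp Mf [_]; rewrite mulrnAr => /(zspanU zN zT)[n [g [Nn Tg e]]].
    split=> //.
    have [|n' [g' [Nn' Tg' ->]]] := idempotent_pure iSG S'S pN _ pp Mf Tg Nn e.
      by right.
    by apply: (subgrpD zF); apply: sub_zspan; [left|right].
exists ((fun x => w * x) @` B); split.
- by move=> _ [x Bx <-]; split=> //; exists x => //; apply: BM.
- move=> s c us sB0 Fs x xs.
  have /choice[g hg] : forall y, exists x, y \in s -> B x /\ w * x = y.
    move=> y; have [/sB0[z Bz <-]|_] := boolP (y \in s); first by exists z.
    by exists 0.
  have gK : {in s, cancel g (fun x => w * x)} by move=> y /hg[].
  have uinj : {in s &, injective g} by apply: can_in_inj gK.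
  pose c' y := c (w * y).
  have -> : c x = c' (g x) by rewrite /c' gK.
  apply: (iB (map g s) c').
  + by rewrite map_inj_in_uniq.
  + by move=> _ /mapP[y /hg[By _] ->].
  + rewrite big_map; split.
      apply: (subgrp_sum zM) => y ys; apply: (subgrpMz _ zM); apply: BM.
      by have [] := hg y ys.
    rewrite mulr_sumr; suff -> : \sum_(i <- s) w * (g i *~ c' (g i)) = \sum_(x <- s) x *~ c x by [].
    by apply: eq_big_seq => y ys; rewrite mulrzAr /c' !gK.
  + exact: map_f.
- move=> H zH FH BH _ [_ [m Mm ->]].
  apply: (sB [set m | H (w * m)]) => //.
  + split; first by rewrite /= mulr0; case: zH.
    by move=> a b Ha Hb; rewrite /= mulrBr; apply: zH.2.
  + by move=> y [_ Fy]; apply: FH.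
  + by move=> y By; apply: BH; exists y.
Qed.

Lemma free_mod_tower S G N : idempotents (S `|` G) ->
  pure_ideal (nalg (1 |` (S `|` G))) N ->
  (forall w, G w -> forall N', let M := nalg (1 |` (S `|` below G w)) in
     N' `<=` M -> pure_ideal M N' -> free_mod M N') ->
  free_mod (nalg (S `|` G)) (zspan (N `|` nalg S)).
Proof.
move=> iSG pN freeM; have [zN mN _] := pN.
have iG : idempotents G by move=> g Gg; apply: iSG; right.
have LG w : layer S G w `<=` nalg (S `|` G).
  move=> _ [Gw [m Mm ->]]; rewrite mulrC; apply: nalg1_ideal; last first.
    by apply: sub_nalg; right.
  by apply: nalg_mono Mm => x [->|[Sx|[Gx _]]]; [left|right; left|right; right].
apply: (@free_mod_widen _ (zspan (\bigcup_w layer S G w))).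
- by apply: zspan_sub; [apply: nalg_subgrp|move=> x [w _ /LG]].
- rewrite -{1}(setIT G); apply: subset_trans (nalg_layers (L := setT) iG) _.
  apply: zspan_sub; first exact: zspan_subgrp.
  move=> x [Sx|Lx]; apply: sub_zspan; [right|left]; apply: sub_zspan => //.
  by right.
- apply: (free_mod_chain wf) => //; first exact: zspan_subgrp.
  move=> w; have [Gw|nGw] := pselect (G w); last first.
    by apply: free_mod_sub => x [].
  have -> : zspan (zspan (N `|` nalg S) `|` \bigcup_(v in lt^~ w) layer S G v) =
      zspan (N `|` nalg (S `|` below G w)).
    apply/seteqP; split; apply: zspan_sub; try exact: zspan_subgrp.
      move=> x [|[v vw [Gv [m Mm ->]]]].
        apply: zspan_sub; first exact: zspan_subgrp.
        move=> y [Ny|Sy]; apply: sub_zspan; [by left|right].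
        by apply: nalg_mono Sy => z; left.
      apply: sub_zspan; right; rewrite mulrC; apply: nalg1_ideal.
        apply: nalg_mono Mm => y [->|[Sy|[Gy yv]]]; [left|right; left|right; right] => //.
        by split=> //; apply: tr vw.
      by apply: sub_nalg; right.
    move=> x [Nx|]; first by do 2!(apply: sub_zspan; left).
    move=> /(nalg_layers (L := lt^~ w) iG).
    apply: zspan_sub; first exact: zspan_subgrp.
    move=> y [Sy|Ly]; apply: sub_zspan; [left; apply: sub_zspan; by right|by right].
  by apply: free_mod_layer => //; apply: freeM.
Qed.

(** As N is pure, a nonzero multiple of 1 lies in N only if 1 does. *)
Lemma free_mod_unit M N : M 1 -> subgrp M -> N `<=` M -> pure_ideal M N ->
  free_mod (zspan (N `|` nalg [set 1])) N.
Proof.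
move=> M1 zM NM [zN mN pN].
have one : nalg [set 1] `<=` [set x | exists k : int, x = 1 *~ k].
  apply: nalg_sub.
  - split; first by exists 0; rewrite mulr0z.
    by move=> _ _ [k ->] [l ->]; exists (k - l); rewrite mulrzBr.
  - move=> _ _ [k ->] [l ->]; exists (k * l).
    by rewrite mulrzAl mul1r -mulrzA mulrC.
  - by move=> _ ->; exists 1.
have [N1|nN1] := pselect (N 1).
  apply: free_mod_sub; apply: zspan_sub => // x [//|/one[k ->]].
  exact: (subgrpMz _ zN).
have pos n : (0 < n)%N -> N (1 *+ n) -> False.
  have [m] := ubnP n; elim: m n => // m IH [//|[|n]] nm _ Nn; first exact: nN1.
  have pp := @pdiv_prime n.+2 isT; have /dvdnP[q e] := pdiv_dvd n.+2.
  have q0 : (0 < q)%N by move: e; case: q.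
  apply: (IH q) => //.
    rewrite -ltnS; apply: leq_trans nm; rewrite ltnS e ltn_Pmulr //.
    exact: prime_gt1.
  apply: (pN (pdiv n.+2)) => //; first exact: (subgrpMn _ zM).
  by rewrite -mulrnA -e.
exists [set 1]; split.
- by move=> _ ->; apply: sub_zspan; right; apply: sub_nalg.
- move=> s c us s1 Ns x xs; have x1 : x = 1 := s1 x xs; rewrite x1 in xs *.
  have es : s = [:: 1].
    apply: perm_small_eq => //; apply: uniq_perm => // z.
    by rewrite inE; apply/idP/eqP => [/s1|->].
  move: Ns; rewrite es big_seq1; case: (c 1) => [[//|n]|n] Nn.
    by case: (pos n.+1).
  case: (pos n.+1) => //; rewrite -[_ *+ _]opprK; exact: (subgrpN zN).
- move=> H zH NH H1; apply: zspan_sub => // x [/NH//|/one[k ->]].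
  by apply: (subgrpMz _ zH); apply: H1.
Qed.

(** The tower is built over the multiples of 1, so that every stage is a
unital ring and the ideals that occur are pure ideals of unital rings. *)
Lemma free_mod_unital_step G N : idempotents G ->
  (forall w, G w -> forall N', let M := nalg (1 |` below G w) in
     N' `<=` M -> pure_ideal M N' -> free_mod M N') ->
  N `<=` nalg (1 |` G) -> pure_ideal (nalg (1 |` G)) N ->
  free_mod (nalg (1 |` G)) N.
Proof.
move=> iG freeM NM pN; have [zN _ _] := pN.
have idem A : idempotents A -> idempotents (1 |` A).
  by move=> iA x [->|/iA]; rewrite ?mulr1.
have e1 A : 1 |` (1 |` A) = 1 |` A by rewrite setUA setUid.
have z1 : subgrp (zspan (N `|` nalg [set 1])) := zspan_subgrp _.
apply: (@free_mod_ext _ _ _ (zspan (N `|` nalg [set 1]))) => //.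
- by move=> x Nx; apply: sub_zspan; left.
- apply: zspan_sub; first exact: nalg_subgrp.
  by move=> x [/NM|] //; apply: nalg_mono => y; left.
- exact: nalg_subgrp.
- apply: free_mod_unit NM pN; last exact: nalg_subgrp.
  by apply: sub_nalg; left.
- apply: free_mod_tower; first exact: idem.
    by rewrite e1.
  by move=> w Gw N' /=; rewrite e1; apply: freeM.
Qed.

(** Well-founded induction on w: the stages of the tower below w are of the
same form, for smaller elements. *)
Lemma free_mod_below G w N : idempotents G ->
  N `<=` nalg (1 |` below G w) -> pure_ideal (nalg (1 |` below G w)) N ->
  free_mod (nalg (1 |` below G w)) N.
Proof.
elim/(well_founded_ind wf): w G N => w IH G N iG.
have ib : idempotents (below G w) by apply: sub_idempotents iG => x [].
apply: free_mod_unital_step => // v [Gv vw] N'.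
(* the generators below v are the same in the smaller tower *)
suff -> : below (below G w) v = below G v by apply: IH.
apply/seteqP; split=> x; first by case=> -[].
by move=> [Gx xv]; split=> //; split=> //; apply: tr vw.
Qed.

End Tower.

(** The theorem of Noebeling and Bergman. With S empty it says that a ring
without unit spanned by idempotents is free modulo a pure ideal. *)
Theorem free_mod_idempotents S G N : idempotents (S `|` G) ->
  pure_ideal (nalg (1 |` (S `|` G))) N ->
  free_mod (nalg (S `|` G)) (zspan (N `|` nalg S)).
Proof.
move=> iSG pN; have [lt [wf tr tot]] := strict_well_order R.
apply: (free_mod_tower wf tr tot) => // w Gw N' /= N'M pN'.
apply: (free_mod_unital_step wf tr tot) => //.
  by apply: sub_idempotents iSG => x [|[]]; [left|right].
move=> v _ N'' /=; apply: (free_mod_below wf tr tot).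
by apply: sub_idempotents iSG => x [|[]]; [left|right].
Qed.

End Idempotents.

(** * From free quotients to free groups *)

Lemma inj_surj_bij (A B : Type) (f : A -> B) : injective f ->
  (forall y, exists x, f x = y) -> bijective f.
Proof.
move=> fi /choice[g gK]; exists g => // x; apply: fi; exact: gK.
Qed.

Section FreeAbelian.
Variables (V G : zmodType) (T N : set V) (rho : G -> V).
Hypotheses (zN : subgrp N) (rhoB : forall x y, N (rho x - rho y - rho (x - y)))
  (rho0 : forall x, N (rho x) -> x = 0) (rhoT : forall x, T (rho x))
  (Trho : forall v, T v -> exists x, N (v - rho x)).

Let graph : set (V * G) := [set p | N (p.1 - rho p.2)].

Let graph_subgrp : subgrp graph.
Proof.
have N00 : N (rho 0).
  have := rhoB 0 0; rewrite !subrr sub0r => /(subgrpN zN).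
  by rewrite opprK.
split; first by rewrite /graph /= sub0r; apply: (subgrpN zN).
move=> [v x] [w y]; rewrite /graph /= => hv hw.
have -> : v - w - rho (x - y) = (v - rho x) - (w - rho y) + (rho x - rho y - rho (x - y)).
  have -> : v - rho x - (w - rho y) = v - w - (rho x - rho y).
    by rewrite !opprB addrACA [RHS]addrACA [- rho x - w]addrC.
  by rewrite [RHS]addrA subrK.
by apply: (subgrpD zN) => //; apply: zN.2.
Qed.

(** G is isomorphic to T modulo N through a map rho that need not be additive
on the nose; the elements of the basis are lifted to G one by one. *)
Lemma free_abelian_mod : free_mod T N -> free_abelian G.
Proof.
move=> [B [BT iB sB]].
have /choice[e he] : forall b : B, exists x, N (val b - rho x).
  by move=> b; apply/Trho/BT/set_mem/valP.
pose f (D : {freeg B / int}) : G := \sum_(b <- dom D) e b *~ coeff b D.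
pose g (D : {freeg B / int}) : V := \sum_(b <- dom D) val b *~ coeff b D.
have fE D : f D = fglift (e : B -> zmodule G) D.
  by rewrite -{2}(Freeg_dom D) fglift_Freeg /prelift big_map.
have fB : zmod_morphism f.
  by move=> D D'; rewrite !fE; exact: (@lift_is_additive int B (zmodule G) e).
have gfD D : graph (g D, f D).
  have -> : (g D, f D) = \sum_(b <- dom D) (val b, e b) *~ coeff b D.
    by rewrite [RHS]surjective_pairing !raddf_sum; congr (_, _);
      apply: eq_bigr => b _; rewrite raddfMz.
  by apply: (subgrp_sum graph_subgrp) => b _; apply: (subgrpMz _ graph_subgrp); apply: he.
pose F := GRing.isZmodMorphism.Build _ _ f fB.
pose fm : {additive {freeg B / int} -> G} := HB.pack f F.
exists (B : choiceType), fm; apply: inj_surj_bij => [|x].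
- apply: raddf_inj => D fD0; apply/eqP; rewrite -dom_eq0; apply/eqP.
  have Ng : N (g D).
    have := gfD D; rewrite [f D]fD0 /graph /= => h.
    have := graph_subgrp.1; rewrite /graph /= => h0.
    rewrite -(subrK (rho 0) (g D)); apply: (subgrpD zN) => //.
    by move: h0; rewrite sub0r => /(subgrpN zN); rewrite opprK.
  case E : (dom D) => [//|b s].
  have bD : b \in dom D by rewrite E mem_head.
  pose c v := if insub v is Some b then coeff b D else 0.
  have cE (a : B) : c (val a) = coeff a D by rewrite /c valK.
  have := bD; rewrite mem_dom -cE (iB (map val (dom D)) c) ?eqxx //.
  + by rewrite map_inj_uniq ?uniq_dom //; apply: val_inj.
  + by move=> _ /mapP[a _ ->]; apply/set_mem/valP.
  + rewrite big_map; suff <- : g D = \sum_(j <- dom D) val j *~ c (val j) by [].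
    by apply: eq_bigr => a _; rewrite cE.
  + exact: map_f.
- have : [set v | exists D, N (v - rho (f D))] (rho x).
    apply: sB (rhoT x).
    + split; first by exists 0; have := gfD 0; rewrite /g dom0 big_nil.
      move=> v w [D hD] [D' hD']; exists (D - D'); rewrite fB.
      exact: (graph_subgrp.2 (v, _) (w, _)).
    + move=> v Nv; exists 0; have := gfD 0; rewrite /g dom0 big_nil /graph /= => h.
      by rewrite -[v]addr0 -addrA; apply: (subgrpD zN).
    + move=> v Bv; pose b : B := SigSub (mem_set Bv).
      exists << b >>; rewrite fE liftU scale1r; exact: he b.
  move=> [D hD]; exists D; apply/esym/eqP; rewrite -subr_eq0; apply/eqP/rho0.
  have := rhoB x (f D) => h.
  rewrite -[rho _](subKr (rho x - rho (f D))); exact: zN.2.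
Qed.

End FreeAbelian.

(** * Integer-valued functions on a topological space *)

Definition chi (T : Type) (S : set T) : T -> int := fun x => (x \in S)%:R.

Lemma chi1 (T : Type) (S : set T) x : S x -> chi S x = 1.
Proof. by move=> Sx; rewrite /chi mem_set. Qed.

Lemma chi0 (T : Type) (S : set T) x : ~ S x -> chi S x = 0.
Proof. by move=> Sx; rewrite /chi memNset. Qed.

Lemma chiI (T : Type) (S S' : set T) : chi S * chi S' = chi (S `&` S').
Proof.
apply/funext => x; rewrite /GRing.mul /=.
have [Sx|Sx] := pselect (S x); last by rewrite [chi S x]chi0 // mul0r chi0 // => -[].
have [Sx'|Sx'] := pselect (S' x); last by rewrite [chi S' x]chi0 // mulr0 chi0 // => -[].
by rewrite !chi1 ?mulr1.
Qed.

Lemma sumf_eval (T : Type) (I : Type) (s : seq I) (F : I -> T -> int) x :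
  (\sum_(i <- s) F i) x = \sum_(i <- s) F i x.
Proof. by elim/big_ind2: _ => // f a g b <- <-. Qed.

Lemma mulf_eval (T : Type) (f : T -> int) n x : (f *+ n) x = f x *+ n.
Proof. by elim: n => // n IH; rewrite !mulrS -IH. Qed.

Lemma count_lt (k m : nat) : (m <= k)%N -> (\sum_(i < k) (i < m)%:R = m%:Z :> int)%R.
Proof.
elim: k m => [|k IH] m mk; first by rewrite big_ord0; case: m mk.
rewrite big_ord_recr /=; move: mk; rewrite leq_eqVlt => /orP[/eqP->|mk].
  rewrite ltnSn (eq_bigr (fun=> 1)) => [|i _]; last by rewrite ltnS ltnW.
  by rewrite sumr_const card_ord; lia.
by rewrite IH // ltnNge -ltnS mk addr0.
Qed.

(** On U the sum counts the integers i with 0 <= i < f x + k. *)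
Lemma layer_cake (T : Type) (f : T -> int) (U : set T) (k : nat) :
  (forall x, `|f x| <= k%:Z) -> (forall x, ~ U x -> f x = 0) ->
  f = \sum_(i < k + k) chi ([set x | i%:Z + 1 - k%:Z <= f x] `&` U) - chi U *+ k.
Proof.
move=> fk fU; apply/funext => x; rewrite /GRing.add /= /GRing.opp /= sumf_eval mulf_eval.
have [Ux|nUx] := pselect (U x); last first.
  by rewrite fU // [chi U x]chi0 // mul0rn big1 => [//|i _]; rewrite chi0 // => -[].
rewrite [chi U x]chi1 //.
have [m mE] : exists m : nat, f x + k%:Z = m%:Z.
  by exists (absz (f x + k%:Z)); have := fk x; lia.
rewrite (eq_bigr (fun i : 'I_(k + k) => (i < m)%:R)) => [|i _].
  rewrite count_lt; last by have := fk x; lia.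
  by rewrite -mE natz addrK.
have [im|im] := ltnP i m; [rewrite chi1 //|rewrite chi0 //].
  have h : i%:Z + 1 - k%:Z <= f x by lia.
  by split.
move=> [h _]; have {}h : i%:Z + 1 - k%:Z <= f x := h; lia.
Qed.

Section Topology.
Variable T : topologicalType.
Implicit Types (K U F : set T) (f g u : T -> int).

(** Induction over a compact set. Otherwise the sets A for which P holds on
the complement of A in K form a proper filter, and a cluster point of it in K
contradicts the local hypothesis. *)
Lemma compact_ind K (P : set T -> Prop) : compact K -> P set0 ->
  (forall A B, P A -> P B -> P (A `|` B)) ->
  (forall A B, A `<=` B -> P B -> P A) ->
  (forall x, K x -> exists2 U, nbhs x U & P U) -> P K.
Proof.
move=> cK P0 PU PS loc; apply: contrapT => nPK.
pose Fl : set_system T := [set A | P (K `\` A)].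
have FF : ProperFilter Fl.
  split=> /=; first by rewrite /Fl /= setD0.
  split=> [|A B FA FB|A B AB FA]; rewrite /Fl /=.
  - by rewrite setDT.
  - by rewrite setDIr; apply: PU.
  - by apply: PS FA; apply: setDS.
have [|x [Kx clx]] := cK Fl FF; first by rewrite /Fl /= setDv.
have [U xU PU'] := loc x Kx.
have [|y []//] := clx (~` U) U _ xU.
by rewrite /Fl /=; apply: PS PU' => y [_ /contrapT].
Qed.

(** The negligible functions: modulo these, [nu a] below is additive in a. *)
Definition vanish : set (T -> int) :=
  [set f | exists O, [/\ open O, dense O & forall x, O x -> f x = 0]].

Lemma dense_openI U U' : open U -> dense U -> dense U' -> dense (U `&` U').
Proof.
move=> oU dU dU' O O0 oO; rewrite setIA; apply: dU'; first exact: dU.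
exact: openI.
Qed.

Lemma vanish_subgrp : subgrp vanish.
Proof.
split; first by exists setT; split=> [|O O0 _|]; [exact: openT|rewrite setIT|].
move=> f g [U [oU dU fU]] [U' [oU' dU' gU']]; exists (U `&` U'); split.
- exact: openI.
- exact: dense_openI.
- by move=> x [Ux U'x]; rewrite /GRing.add /= /GRing.opp /= fU // gU'.
Qed.

Lemma vanish_mul f g : vanish g -> vanish (f * g).
Proof.
move=> [U [oU dU gU]]; exists U; split=> // x Ux.
by rewrite /GRing.mul /= gU // mulr0.
Qed.

Lemma vanish_pure M : pure_ideal M vanish.
Proof.
split=> [|f g _|p f pp _ [U [oU dU fU]]]; [exact: vanish_subgrp|exact: vanish_mul|].
exists U; split=> // x /fU; rewrite mulf_eval => /eqP.
by rewrite mulrn_eq0 => /orP[/eqP e|/eqP //]; move: pp; rewrite e.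
Qed.

Lemma locally_constantP f : (forall n, open [set x | f x = n]) <->
  continuous (f : T -> discrete_topology int).
Proof.
split=> [h|/continuous_intP h n].
  by apply/continuous_intP => y; apply: open_nbhs_nbhs; split.
by rewrite openE => x /= <-; apply: h.
Qed.

Lemma locally_constant_open f (P : int -> Prop) :
  (forall n, open [set x | f x = n]) -> open [set x | P (f x)].
Proof.
move=> h; have -> : [set x | P (f x)] = \bigcup_(n in P) [set x | f x = n].
  by apply/seteqP; split=> x /= => [Pf|[n Pn ->] //]; exists (f x).
exact: bigcup_open.
Qed.

Lemma locally_constant_closed f (P : int -> Prop) :
  (forall n, open [set x | f x = n]) -> closed [set x | P (f x)].
Proof.
move=> h; rewrite -[X in closed X]setCK; apply: open_closedC.
exact: (locally_constant_open (fun n => ~ P n) h).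
Qed.

Lemma mem_CcP f : f \in @Cc_pred T <->
  (forall n, open [set x | f x = n]) /\ compact [set x | f x != 0].
Proof.
split.
  move=> /set_mem[/locally_constantP h cf]; split=> //.
  by rewrite ((closure_id _).1 (locally_constant_closed (P := fun n => n != 0) h)).
move=> [h cf]; apply/mem_set; split; first exact/locally_constantP.
by rewrite -((closure_id _).1 (locally_constant_closed (P := fun n => n != 0) h)).
Qed.

Lemma Cc_of_support f K : (forall n, open [set x | f x = n]) -> compact K ->
  (forall x, f x != 0 -> K x) -> f \in @Cc_pred T.
Proof.
move=> h cK fK; apply/mem_CcP; split=> //; apply: subclosed_compact fK => //.
exact: (locally_constant_closed (P := fun n => n != 0)).
Qed.

Lemma chi_Cc U : open U -> closed U -> compact U -> chi U \in @Cc_pred T.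
Proof.
move=> oU cU kU; apply: (Cc_of_support _ kU) => [n|x]; last first.
  by have [//|nUx] := pselect (U x); rewrite chi0 ?eqxx.
have -> : [set x | chi U x = n] = (U `&` [set _ | n = 1]) `|` (~` U `&` [set _ | n = 0]).
  apply/seteqP; split=> x /= => [<-|[] [Ux ->]]; [|exact: chi1|exact: chi0].
  by have [Ux|Ux] := pselect (U x); [left; rewrite chi1|right; rewrite chi0].
have o (Q : Prop) : open [set _ : T | Q].
  have [q|q] := pselect Q; [rewrite (_ : mkset _ = setT)|rewrite (_ : mkset _ = set0)];
    by [apply: openT|apply: open0|apply/seteqP; split=> x].
by apply: openU; apply: openI => //; apply: closed_openC.
Qed.

Lemma Cc_bounded (f : Cc T) : exists k : nat, forall x, `|f x| <= k%:Z.
Proof.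
have /mem_CcP[h c] := CcP f.
have [||||k hk] := @compact_ind [set x | f x != 0]
  (fun A => exists k : nat, forall x, A x -> `|f x| <= k%:Z) c.
- by exists 0%N.
- move=> A B [k hk] [l hl]; exists (k + l)%N => x [/hk|/hl]; lia.
- by move=> A B AB [k hk]; exists k => x /AB/hk.
- move=> x _; exists [set y | f y = f x]; first by apply: open_nbhs_nbhs; split.
  by exists (absz (f x)) => y ->; lia.
by exists k => x; have [/= ->|/hk //] := eqVneq (f x) 0.
Qed.

Lemma vanish_Cc0 (f : Cc T) : vanish f -> f = 0.
Proof.
move=> [U [oU dU fU]]; apply: val_inj; apply/funext => x.
have /mem_CcP[h _] := CcP f.
have [|y [/= <- /fU ->]//] := dU [set y | f y = f x] _ (h _).
by exists x.
Qed.

Lemma Cc_fun0 : Cc_fun (0 : Cc T) = 0.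
Proof. exact: (raddf0 val). Qed.

Lemma Cc_funB (f g : Cc T) : Cc_fun (f - g) = Cc_fun f - Cc_fun g.
Proof. exact: (raddfB val). Qed.

End Topology.

(** * Dedekind cuts of continuous functions *)

Definition compact_open_base (X : topologicalType) := forall (x : X) U,
  nbhs x U -> exists K, [/\ open K, closed K, compact K, K x & K `<=` U].

Definition usc (X : topologicalType) (u : X -> int) :=
  forall n : int, closed [set x | n <= u x].

Definition le_fun (T : Type) (f g : T -> int) := forall x, f x <= g x.

Section Minorants.
Variable X : topologicalType.
Hypothesis base : compact_open_base X.
Implicit Types (f g u v : X -> int).

Lemma usc_lt_open u n : usc u -> open [set x | u x < n].
Proof.
move=> uu; have := closed_openC (uu n); congr open.
by apply/seteqP; split=> x /=; rewrite ltNge => /negP.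
Qed.

(** A function bounded below attains its minimum on W, and near such a point
upper semicontinuity forces it to be constant. *)
Lemma usc_min u (W : set X) : usc u -> (exists k, forall x, k <= u x) ->
  open W -> W !=set0 -> exists n (W' : set X),
    [/\ open W', W' !=set0, W' `<=` W & forall x, W' x -> u x = n].
Proof.
move=> uu [k hk] oW [x Wx].
have ex : exists m : nat, `[< exists2 y, W y & u y = k + m%:Z >].
  exists (absz (u x - k)); apply/asboolP; exists x => //; have := hk x; lia.
case: (ex_minnP ex) => m /asboolP[y Wy yE] mmin.
exists (k + m%:Z), (W `&` [set z | u z < k + m%:Z + 1]); split.
- by apply: openI => //; apply: usc_lt_open.
- by exists y; split=> //=; rewrite yE ltrDl.
- by move=> z [].
- move=> z [Wz /= hz]; have := hk z => kz.
  have : (m <= absz (u z - k))%N.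
    by apply: mmin; apply/asboolP; exists z => //; lia.
  by lia.
Qed.

Lemma Cc_patch (f : Cc X) K n : open K -> closed K -> compact K ->
  exists g : Cc X, (forall x, K x -> g x = n) /\ (forall x, ~ K x -> g x = f x).
Proof.
move=> oK cK kK; have /mem_CcP[of_ kf] := CcP f.
pose g x := if x \in K then n else f x.
have gK x : K x -> g x = n by move=> Kx; rewrite /g mem_set.
have gnK x : ~ K x -> g x = f x by move=> Kx; rewrite /g memNset.
suff Cg : g \in @Cc_pred X by exists (MkCc Cg).
apply: (@Cc_of_support _ _ (K `|` [set x | f x != 0])).
- move=> m; have -> : [set x | g x = m] =
     (K `&` [set x | n = m]) `|` (~` K `&` [set x | f x = m]).
    apply/seteqP; split=> x /= => [<-|[] [Kx <-]]; last 2 first.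
    + exact: gK.
    + exact: gnK.
    by have [Kx|nKx] := pselect (K x); [left; rewrite gK|right; rewrite gnK].
  apply: openU; apply: openI => //; last exact: closed_openC.
  have [q|q] := pselect (n = m); [rewrite (_ : mkset _ = setT)|rewrite (_ : mkset _ = set0)];
    by [apply: openT|apply: open0|apply/seteqP; split=> x].
- exact: compactU.
- by move=> x; have [Kx|nKx] := pselect (K x); [left|rewrite gnK //; right].
Qed.

(** Every open set contains an open set on which u and v are constant, by
[usc_min] applied twice. If f0 is raised to the value of u on a compact open
subset of it, the result is still a minorant of u, hence one of v; so u <= v
there, and conversely. *)
Lemma vanish_of_minorants u v (f0 : Cc X) : usc u -> usc v ->
  le_fun f0 u -> le_fun f0 v ->
  (forall f : Cc X, le_fun f u <-> le_fun f v) -> vanish (u - v).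
Proof.
move=> uu uv f0u f0v uvE; have [k hk] := Cc_bounded f0.
exists [set x | u x = v x]°; split; first exact: open_interior; last first.
  by move=> x /interior_subset /= e; rewrite /GRing.add /= /GRing.opp /= e subrr.
move=> W W0 oW.
have [|n [W1 [oW1 W10 W1W hn]]] := usc_min uu _ oW W0.
  by exists (- k%:Z) => x; have := f0u x; have := hk x; lia.
have [|m [W2 [oW2 [x W2x] W2W hm]]] := usc_min uv _ oW1 W10.
  by exists (- k%:Z) => x; have := f0v x; have := hk x; lia.
exists x; split; first by apply/W1W/W2W.
(* raise f0 to the value a of u' on a compact open neighborhood of x *)
have cmp u' v' a b : (forall f : Cc X, le_fun f u' -> le_fun f v') ->
    le_fun f0 u' -> (forall x, W2 x -> u' x = a) -> v' x = b -> a <= b.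
  move=> h f0u' ha <-.
  have [|K [oK cK kK Kx KW2]] := @base x W2; first by apply: open_nbhs_nbhs; split.
  have [g [g1 g2]] := Cc_patch f0 a oK cK kK.
  rewrite -(g1 x Kx); apply: h => y.
  have [Ky|nKy] := pselect (K y); last by rewrite g2.
  by rewrite g1 // ha //; apply: KW2.
have mn : n = m.
  apply/eqP; rewrite eq_le; apply/andP; split.
    apply: (cmp u v) => //; [by move=> f /uvE|by move=> y /W2W/hn|exact: hm].
  apply: (cmp v u) => //; [by move=> f /uvE|by apply: hn; apply: W2W].
apply: (@filterS _ _ _ W2); last by apply: open_nbhs_nbhs; split.
by move=> y W2y /=; rewrite hm // hn ?mn //; apply: W2W.
Qed.

Lemma minorants_of_vanish u v : usc v -> vanish (u - v) ->
  forall f : Cc X, le_fun f u -> le_fun f v.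
Proof.
move=> uv [O [oO dO hO]] f fu x.
have /mem_CcP[of_ _] := CcP f.
rewrite leNgt; apply/negP => lt.
have [||y [[/= vy fy] Oy]] := dO ([set y | v y < f x] `&` [set y | f y = f x]).
- by exists x.
- by apply: openI => //; apply: usc_lt_open.
have := fu y; rewrite fy; have : u y - v y = 0 by apply: hO.
by move: vy; lia.
Qed.

End Minorants.

Section StepFunctions.
Variable X : topologicalType.

(** Modulo the functions of [vanish] these span the group of all [nu a] below. *)
Definition chi_closed : set (X -> int) :=
  [set chi F | F in [set F | closed F /\ exists2 K, compact K & F `<=` K]].

Definition chi_clopen : set (X -> int) :=
  [set chi U | U in [set U | [/\ open U, closed U & compact U]]].

Lemma chi_closedM f g : chi_closed f -> chi_closed g -> chi_closed (f * g).
Proof.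
move=> [F [cF [K kK FK]] <-] [F' [cF' _] <-]; rewrite chiI; exists (F `&` F') => //.
by split; [apply: closedI|exists K => // x [/FK]].
Qed.

Lemma chi_clopenM f g : chi_clopen f -> chi_clopen g -> chi_clopen (f * g).
Proof.
move=> [U [oU cU kU] <-] [V [oV cV kV] <-]; rewrite chiI; exists (U `&` V) => //.
split; [exact: openI|exact: closedI|].
by apply: subclosed_compact kU _; [apply: closedI|move=> x []].
Qed.

Lemma chi_closed_idem : idempotents chi_closed.
Proof. by move=> _ [F _ <-]; rewrite chiI setIid. Qed.

Lemma chi_clopen_closed : chi_clopen `<=` chi_closed.
Proof. by move=> _ [U [oU cU kU] <-]; exists U => //; split=> //; exists U. Qed.

Lemma usc_chi (F : set X) : closed F -> usc (chi F).
Proof.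
move=> cF n.
have [n0|n0] := leP n 0.
  rewrite (_ : mkset _ = setT); first exact: closedT.
  apply/seteqP; split=> // x _; apply: (le_trans n0).
  by have [Fx|Fx] := pselect (F x); [rewrite chi1|rewrite chi0].
have [n1|n1] := leP n 1.
  have -> : [set x | n <= chi F x] = F; last by [].
  apply/seteqP; split=> x /=; last by move=> Fx; rewrite chi1.
  by move=> h; apply: contrapT => nFx; move: h; rewrite chi0 //; lia.
rewrite (_ : mkset _ = set0); first exact: closed0.
apply/seteqP; split=> // x /=.
have [Fx|Fx] := pselect (F x); [rewrite chi1 //|rewrite chi0 //]; lia.
Qed.

Lemma usc_add (u v : X -> int) : usc u -> usc v -> usc (fun x : X => u x + v x).
Proof.
move=> uu uv n.
rewrite -[X in closed X]setCK; apply: open_closedC.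
have -> : ~` [set x | n <= u x + v x] =
    \bigcup_(m in setT) ([set x | u x < m + 1] `&` [set x | v x < n - m]).
  apply/seteqP; split=> x /=.
    move=> /negP; rewrite -ltNge => h; exists (u x) => //.
    by split=> /=; [rewrite ltrDl|move: h; lia].
  by move=> [m _ [/= h1 h2]]; apply/negP; rewrite -ltNge; lia.
by apply: bigcup_open => m _; apply: openI; apply: usc_lt_open.
Qed.

End StepFunctions.

Section Completion.
Variable X : topologicalType.
Hypothesis base : compact_open_base X.
(* The minorants of [nu a] in C_c(X, Z) play the part of the invertible ideals
   that contain the divisorial ideal a. *)
Variables (G : zmodType) (nu : G -> X -> int).
Hypotheses (nu_usc : forall a, usc (nu a))
  (nu_bound : forall a, exists f0 f1 : Cc X, le_fun f0 (nu a) /\ le_fun (nu a) f1)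
  (nuD : forall a b (f : Cc X),
     le_fun f (nu (a + b)) <-> le_fun f (fun x => nu a x + nu b x))
  (nu_inj : forall a b,
     (forall f : Cc X, le_fun f (nu a) <-> le_fun f (nu b)) -> a = b)
  (nu_chi : forall F K, closed F -> compact K -> F `<=` K ->
     exists a, forall f : Cc X, le_fun f (nu a) <-> le_fun f (chi F)).

(** Both sides have the same minorants by [nuD]. *)
Lemma nu_vanishD a b : vanish (nu a + nu b - nu (a + b)).
Proof.
have [f0 [_ [f0a _]]] := nu_bound a; have [g0 [_ [g0b _]]] := nu_bound b.
have [h0 [_ [h0ab _]]] := nu_bound (a + b).
apply: (@vanish_of_minorants _ base _ _ h0) => //.
- exact: usc_add.
- by apply/nuD.
- by move=> f; split=> /nuD.
Qed.

Lemma nu_vanish_eq a b : vanish (nu a - nu b) -> a = b.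
Proof.
move=> h; apply: nu_inj => f; split; apply: minorants_of_vanish => //.
by rewrite -opprB; apply: (subgrpN (vanish_subgrp _)).
Qed.

Lemma nu_vanishB a b : vanish (nu a - nu b - nu (a - b)).
Proof.
have := nu_vanishD (a - b) b; rewrite subrK.
rewrite (_ : nu a - nu b - _ = - (nu (a - b) + nu b - nu a)).
  exact: (subgrpN (vanish_subgrp _)).
by rewrite opprB opprD [- nu (a - b) - _]addrC addrA.
Qed.

Lemma nu_vanish0 a : vanish (nu a) -> a = 0.
Proof.
move=> va; apply: nu_vanish_eq; apply: (vanish_subgrp _).2 => //.
have := nu_vanishB 0 0; rewrite !subrr sub0r => /(subgrpN (vanish_subgrp _)).
by rewrite opprK.
Qed.

Lemma nu_vanish_chi F K : closed F -> compact K -> F `<=` K ->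
  exists a, vanish (chi F - nu a).
Proof.
move=> cF kK FK; have [a ha] := nu_chi cF kK FK; exists a.
have [f0 [_ [f0a _]]] := nu_bound a.
apply: (@vanish_of_minorants _ base _ _ f0) => //; first exact: usc_chi.
  exact/ha.
by move=> f; split=> /ha.
Qed.

Lemma nu_chi_closed a : nalg (@chi_closed X) (nu a).
Proof.
have [f0 [f1 [h0 h1]]] := nu_bound a.
have /mem_CcP[o0 k0] := CcP f0; have /mem_CcP[o1 k1] := CcP f1.
have [l0 b0] := Cc_bounded f0; have [l1 b1] := Cc_bounded f1.
pose U := [set x | f0 x != 0] `|` [set x | f1 x != 0].
have zN := nalg_subgrp (@chi_closed X).
rewrite (@layer_cake _ (nu a) U (l0 + l1)).
- apply: zN.2.
    apply: (subgrp_sum zN) => i _; apply: sub_nalg; eexists; last by [].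
    split.
      apply: closedI; first exact: nu_usc.
      by apply: closedU; apply: (locally_constant_closed (P := fun n => n != 0)).
    by exists U; [apply: compactU|move=> x []].
  apply: (subgrpMn _ zN); apply: sub_nalg; exists U => //; split.
    by apply: closedU; apply: (locally_constant_closed (P := fun n => n != 0)).
  by exists U => //; apply: compactU.
- by move=> x; have := h0 x; have := h1 x; have := b0 x; have := b1 x; lia.
- move=> x /not_orP[/negP]; rewrite negbK => /eqP e0 /negP; rewrite negbK => /eqP e1.
  by have := h0 x; have := h1 x; rewrite e0 e1; lia.
Qed.

Lemma nu_onto f : nalg (@chi_closed X) f -> exists a, vanish (f - nu a).
Proof.
have zV := vanish_subgrp X.
move=> /(nalg_zspan (@chi_closedM X)).
apply: (@zspan_sub _ _ [set f | exists a, vanish (f - nu a)]); last first.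
  by move=> _ [F [cF [K kK FK]] <-]; apply: nu_vanish_chi kK FK.
split.
  exists 0; rewrite sub0r; apply: (subgrpN zV).
  have := nu_vanishB 0 0; rewrite !subrr sub0r => /(subgrpN zV).
  by rewrite opprK.
move=> {}f g [a ha] [b hb]; exists (a - b).
have -> : f - g - nu (a - b) = (f - nu a) - (g - nu b) + (nu a - nu b - nu (a - b)).
  have -> : f - nu a - (g - nu b) = f - g - (nu a - nu b).
    by rewrite !opprB addrACA [RHS]addrACA [- nu a - g]addrC.
  by rewrite [RHS]addrA subrK.
by apply: (subgrpD zV); [apply: zV.2|apply: nu_vanishB].
Qed.

Theorem completion_free : free_abelian G.
Proof.
apply: (@free_abelian_mod _ _ (nalg (@chi_closed X)) (vanish (T := X)) nu).
- exact: vanish_subgrp.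
- exact: nu_vanishB.
- exact: nu_vanish0.
- exact: nu_chi_closed.
- exact: nu_onto.
have := @free_mod_idempotents _ set0 (@chi_closed X) (vanish (T := X)).
rewrite set0U (_ : zspan _ = vanish (T := X)).
  by apply; [exact: chi_closed_idem|exact: vanish_pure].
have zV := vanish_subgrp X.
apply/seteqP; split; last by move=> x Vx; apply: sub_zspan; left.
apply: zspan_sub => // x [//|]; apply: nalg_sub => //.
by move=> f g _; apply: vanish_mul.
Qed.

Lemma Cc_chi_clopen (f : Cc X) : nalg (@chi_clopen X) f.
Proof.
have /mem_CcP[o k0] := CcP f; have [k hk] := Cc_bounded f.
have zN := nalg_subgrp (@chi_clopen X).
set U := [set x | f x != 0].
have clo (P : int -> Prop) : open [set x | P (f x)] /\ closed [set x | P (f x)].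
  by split; [apply: locally_constant_open|apply: locally_constant_closed].
have [oU cU] := clo (fun n => n != 0).
rewrite (@layer_cake _ f U k) //; last by move=> x /negP; rewrite negbK => /eqP.
apply: zN.2.
  apply: (subgrp_sum zN) => i _; apply: sub_nalg; eexists; last by [].
  have [oi ci] := clo (fun n => i%:Z + 1 - k%:Z <= n).
  split; [exact: openI|exact: closedI|].
  by apply: subclosed_compact k0 _; [apply: closedI|move=> x []].
by apply: (subgrpMn _ zN); apply: sub_nalg; exists U.
Qed.

Lemma chi_clopen_Cc f : nalg (@chi_clopen X) f -> exists g : Cc X, f = g.
Proof.
move=> /(nalg_zspan (@chi_clopenM X)).
suff h' : zspan (@chi_clopen X) `<=` [set f | exists g : Cc X, f = (g : X -> int)] by apply: h'.
apply: zspan_sub.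
  split=> [|_ _ [g ->] [g' ->]]; first by exists 0; rewrite Cc_fun0.
  by exists (g - g'); rewrite Cc_funB.
by move=> _ [U [oU cU kU] <-]; exists (MkCc (chi_Cc oU cU kU)).
Qed.

(** S plays the part of C_c(X, Z) in the group of cuts, and r picks
representatives of the classes modulo S. *)
Theorem completion_quotient_free (Q : zmodType) (r : Q -> G) (S : set G) :
  (forall x y, S (r x - r y - r (x - y))) -> (forall x, S (r x) -> x = 0) ->
  (forall a, exists x, S (a - r x)) ->
  (forall a, S a -> exists f : Cc X, nu a = f) ->
  (forall f : Cc X, exists2 a, S a & nu a = f) -> free_abelian Q.
Proof.
move=> rB r0 rS SC CS.
have zV := vanish_subgrp X.
have zC := nalg_subgrp (@chi_clopen X).
set N := zspan (vanish (T := X) `|` nalg (@chi_clopen X)).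
have zN : subgrp N := zspan_subgrp _.
have VN f : vanish f -> N f by move=> h; apply: sub_zspan; left.
have SN a : S a -> N (nu a).
  by move=> /SC[f ->]; apply: sub_zspan; right; apply: Cc_chi_clopen.
apply: (@free_abelian_mod _ _ (nalg (@chi_closed X)) N (nu \o r)) => //.
- move=> x y /=.
  have -> : nu (r x) - nu (r y) - nu (r (x - y)) =
      (nu (r x) - nu (r y) - nu (r x - r y)) +
      (nu (r x - r y) - nu (r (x - y)) - nu (r x - r y - r (x - y))) +
      nu (r x - r y - r (x - y)).
    by rewrite -[RHS]addrA subrK [RHS]addrA subrK.
  by apply: (subgrpD zN); [apply: (subgrpD zN); apply: VN; apply: nu_vanishB|apply: SN].
- move=> x /(zspanU zV zC)[v [f [Vv /chi_clopen_Cc[g ->]]]].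
  have [a Sa <-] := CS g => /= e; apply: r0.
  rewrite (nu_vanish_eq (a := r x) (b := a)) //.
  by rewrite e addrK.
- by move=> x /=; apply: nu_chi_closed.
- move=> v /nu_onto[a ha]; have [x hx] := rS a; exists x.
  have -> : v - (nu \o r) x = (v - nu a) + (nu a - nu (r x) - nu (a - r x)) + nu (a - r x).
    by rewrite -[RHS]addrA subrK [RHS]addrA subrK.
  apply: (subgrpD zN); last exact: SN.
  by apply: (subgrpD zN); apply: VN => //; apply: nu_vanishB.
have := @free_mod_idempotents _ (@chi_clopen X) (@chi_closed X) (vanish (T := X)).
rewrite (_ : _ `|` _ = @chi_closed X).
  by apply; [exact: chi_closed_idem|exact: vanish_pure].
by apply/seteqP; split=> [x [/chi_clopen_closed|]|x ?] //; right.
Qed.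

End Completion.

(** * Gleason covers *)

Section Perfect.
Variables (E X : topologicalType) (pi : E -> X).
Hypothesis perf : perfect_map pi.

Let ctn : continuous pi. Proof. by case: perf. Qed.
Let clo A : closed A -> closed (pi @` A). Proof. by case: perf => _ + _; apply. Qed.
Let fib y : compact (pi @^-1` [set y]). Proof. by case: perf => _ _. Qed.

Lemma open_preimage U : open U -> open (pi @^-1` U).
Proof. by apply: open_comp => e _; apply: ctn. Qed.

Lemma closed_preimage A : closed A -> closed (pi @^-1` A).
Proof. by apply: closed_comp => e _; apply: ctn. Qed.

(** Let x be a cluster point of the image filter. As pi is closed, the closure
of every member of the filter meets the fiber over x, and compactness of this
fiber yields a point common to all these closures. *)
Lemma compact_preimage K : compact K -> compact (pi @^-1` K).
Proof.
move=> cK F FF FK.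
have [x [Kx clx]] := cK (pi @ F) _ FK.
have base : ProperFilter (filter_from F (fun A => closure A `&` pi @^-1` [set x])).
  apply: filter_from_proper.
    apply: filter_from_filter; first by exists setT; apply: filterT.
    move=> A B FA FB; exists (A `&` B); first exact: filterI.
    by move=> e [/closureI[cA cB] ex].
  move=> A FA.
  have : closed (pi @` closure A) by apply: clo; apply: closed_closure.
  move=> /(_ x)[|e ce ex]; last by exists e.
  move=> N xN.
  have [|y [Ny]] := clx (pi @` closure A) N _ xN.
    rewrite /nbhs /=; apply: filterS FA => e Ae.
    by exists e => //; apply: subset_closure.
  by exists y.
have [|e [ex ce]] := @fib x _ base.
  by exists setT; [apply: filterT|move=> e []].
exists e; split; first by rewrite /= ex.
move=> A N FA eN.
have /nbhs_interior eN' := eN.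
have [|e2 [[cA2 _] Ne2]] := ce (closure A `&` pi @^-1` [set x]) (N°) _ eN'.
  by exists A.
by have [e3 []] := cA2 N Ne2; exists e3.
Qed.

Hypotheses (onto : range pi = setT) (irr : irreducible_map pi).

Lemma small_image_open (O : set E) : open O -> open (~` (pi @` (~` O))).
Proof. by move=> oO; apply: closed_openC; apply: clo; apply: open_closedC. Qed.

(** This is irreducibility: some fiber is contained in O. *)
Lemma small_image_nonempty (O : set E) : open O -> O !=set0 ->
  ~` (pi @` (~` O)) !=set0.
Proof.
move=> oO [e Oe]; apply: contrapT => h.
have := @irr (~` O) (open_closedC oO) => /(_ _)/seteqP[|_ /(_ e I)]; last by apply.
apply/seteqP; split=> // x _; apply: contrapT => nx; apply: h; by exists x.
Qed.

Lemma fiber_ex x : exists e, pi e = x.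
Proof. by have /seteqP[_ /(_ x I)[e _ <-]] := onto; exists e. Qed.

(** A dense open set D of E contains the fibers over the complement of the
image of its complement; irreducibility makes this open set of X dense. *)
Lemma vanish_comp (f : X -> int) : vanish (f \o pi) <-> vanish f.
Proof.
split=> [[D [oD dD hD]]|[D [oD dD hD]]].
  exists (~` (pi @` (~` D))); split; first exact: small_image_open.
    move=> W [x Wx] oW; have [e ex] := fiber_ex x.
    have oWD : open (pi @^-1` W `&` D) by apply: openI => //; apply: open_preimage.
    have [|y hy] := small_image_nonempty oWD.
      by apply: dD; [exists e; rewrite /= ex|apply: open_preimage].
    have [e' e'y] := fiber_ex y; exists y; split.
      apply: contrapT => nWy; apply: hy; exists e' => // -[].
      by rewrite /= e'y.
    by move=> [e2 nD e2y]; apply: hy; exists e2 => // -[].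
  move=> x hx; have [e ex] := fiber_ex x; rewrite -ex; apply: hD.
  by apply: contrapT => nD; apply: hx; exists e.
exists (pi @^-1` D); split; first exact: open_preimage; last by move=> e; apply: hD.
move=> O O0 oO.
have [x [hx Dx]] := dD _ (small_image_nonempty oO O0) (small_image_open oO).
have [e ex] := fiber_ex x; exists e; split; last by rewrite /= ex.
by apply: contrapT => nO; apply: hx; exists e.
Qed.

(** The interior of the preimage of F is closed since E is extremally
disconnected, and its complement in the closed set pi^-1(F) is nowhere dense. *)
Lemma chi_lift (ed : extremally_disconnected E) F K : closed F -> compact K ->
  F `<=` K -> exists g : Cc E, vanish (chi F \o pi - g).
Proof.
move=> cF kK FK; have cF' : closed (pi @^-1` F) by apply: closed_preimage.
set V := (pi @^-1` F)°.
have oV : open V by apply: open_interior.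
have cV : closed V.
  rewrite /V -[pi @^-1` F]setCK interiorC; apply: open_closedC.
  by apply: ed.2; apply: closed_openC.
have kV : compact V.
  apply: (subclosed_compact cV (compact_preimage kK)).
  by move=> e /interior_subset /= /FK.
exists (MkCc (chi_Cc oV cV kV)); exists (V `|` ~` (pi @^-1` F)); split.
- by apply: openU => //; apply: closed_openC.
- move=> O [e Oe] oO; have [OF|] := pselect (O `<=` pi @^-1` F).
    exists e; split=> //; left; apply: (filterS OF).
    by apply: open_nbhs_nbhs; split.
  by move=> /existsNP[e' /not_implyP[Oe' nF]]; exists e'; split; [exact: Oe'|right; exact: nF].
- move=> e; rewrite /GRing.add /= /GRing.opp /= => -[Ve|nF].
    by rewrite !chi1 ?subrr //; apply: interior_subset Ve.
  by rewrite !chi0 ?subrr // => /interior_subset.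
Qed.

(** The set of the points outside V whose image lies in pi(V) has empty
interior: an open subset would contain a whole fiber, but this fiber meets V. *)
Lemma chi_descend (V : set E) : open V -> closed V -> compact V ->
  [/\ closed (pi @` V), compact (pi @` V) & vanish (chi (pi @` V) \o pi - chi V)].
Proof.
move=> oV cV kV; split; first exact: clo.
  by apply: continuous_compact => //; apply: continuous_subspaceT.
exists (V `|` ~` (pi @^-1` (pi @` V))); split.
- by apply: openU => //; apply: closed_openC; apply: closed_preimage; apply: clo.
- move=> O O0 oO; apply: contrapT => h.
  have OV e : O e -> ~ V e /\ (pi @` V) (pi e).
    move=> Oe; split=> [Ve|]; first by apply: h; exists e; split=> //; left.
    by apply: contrapT => nV; apply: h; exists e; split=> //; right.
  have [x hx] := small_image_nonempty oO O0; have [e ex] := fiber_ex x.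
  have Oe : O e by apply: contrapT => nO; apply: hx; exists e.
  have [_ [v Vv vx]] := OV e Oe.
  apply: hx; exists v; last by rewrite vx.
  by move=> /OV[].
- move=> e; rewrite /GRing.add /= /GRing.opp /= => -[Ve|nF].
    by rewrite !chi1 ?subrr //; exists e.
  by rewrite !chi0 ?subrr // => Ve; apply: nF; exists e.
Qed.

End Perfect.

Section Gleason.
Variables (E X : topologicalType) (pi : E -> X) (G : zmodType) (nu : G -> X -> int).
Hypothesis gl : gleason_cover pi.
Hypotheses (nuB : forall a b, vanish (nu a - nu b - nu (a - b)))
  (nu0 : forall a, vanish (nu a) -> a = 0)
  (nu_closed : forall a, nalg (@chi_closed X) (nu a))
  (nu_chi : forall F K, closed F -> compact K -> F `<=` K ->
     exists a, vanish (chi F - nu a)).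

Let ed : extremally_disconnected E. Proof. by case: gl. Qed.
Let perf : perfect_map pi. Proof. by case: gl. Qed.
Let onto : range pi = setT. Proof. by case: gl. Qed.
Let irr : irreducible_map pi. Proof. by case: gl. Qed.

Lemma lift_ex a : exists g : Cc E, vanish (nu a \o pi - g).
Proof.
have zV := vanish_subgrp E.
pose S := [set f : X -> int | exists g : Cc E, vanish (f \o pi - g)].
suff h : nalg (@chi_closed X) `<=` S by apply: h.
apply: subset_trans (nalg_zspan (@chi_closedM X)) _; apply: zspan_sub; last first.
  by move=> _ [F [cF [K kK FK]] <-]; apply: chi_lift kK FK.
split.
  exists 0; rewrite Cc_fun0 subr0; exact: zV.1.
move=> f g [f' hf] [g' hg]; exists (f' - g').
have -> : (f - g) \o pi - Cc_fun (f' - g') = (f \o pi - f') - (g \o pi - g').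
  by rewrite Cc_funB; apply/funext => e; rewrite /GRing.add /= /GRing.opp /=; lia.
exact: zV.2.
Qed.

(** The value of psi at a is the only continuous function that agrees with nu
a on a dense open set, after composition with pi. *)
Theorem gleason_iso : exists psi : {additive G -> Cc E},
  bijective psi /\ forall a, vanish (nu a \o pi - psi a).
Proof.
have zV := vanish_subgrp E.
have [psi hpsi] := choice lift_ex.
have uniq a (g : Cc E) : vanish (nu a \o pi - g) -> psi a = g.
  move=> h; apply/eqP; rewrite -subr_eq0; apply/eqP; apply: vanish_Cc0.
  have -> : Cc_fun (psi a - g) = (nu a \o pi - g) - (nu a \o pi - psi a).
    by rewrite Cc_funB opprB [RHS]addrC addrA subrK.
  exact: zV.2.
have psiB : zmod_morphism psi.
  move=> a b; apply: uniq.
  have -> : nu (a - b) \o pi - Cc_fun (psi a - psi b) =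
      (nu a \o pi - psi a) - (nu b \o pi - psi b) - ((nu a - nu b - nu (a - b)) \o pi).
    by rewrite Cc_funB; apply/funext => e; rewrite /GRing.add /= /GRing.opp /=; lia.
  apply: zV.2; first exact: zV.2.
  by apply/(vanish_comp perf onto irr).
pose F := GRing.isZmodMorphism.Build _ _ psi psiB.
pose psim : {additive G -> Cc E} := HB.pack psi F.
exists psim; split=> //; apply: inj_surj_bij.
  apply: raddf_inj => a e; apply: nu0.
  apply/(vanish_comp perf onto irr); have := hpsi a.
  by rewrite [psi a]e Cc_fun0 subr0.
move=> g; have := nalg_zspan (@chi_clopenM E) (Cc_chi_clopen g).
suff h : zspan (@chi_clopen E) `<=` [set f | exists a, vanish (nu a \o pi - f)].
  by move=> /h[a /uniq]; exists a.
apply: zspan_sub.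
  split.
    by exists 0; have := hpsi 0; rewrite -[psi]/(psim : _ -> _) raddf0 Cc_fun0.
  move=> f f' [a ha] [b hb]; exists (a - b).
  have -> : nu (a - b) \o pi - (f - f') =
      (nu a \o pi - f) - (nu b \o pi - f') - ((nu a - nu b - nu (a - b)) \o pi).
    apply/funext => e.
    by rewrite /GRing.add /= /GRing.opp /=; lia.
  apply: zV.2; first exact: zV.2.
  by apply/(vanish_comp perf onto irr).
move=> _ [V [oV cV kV] <-].
have [cF kF hV] := chi_descend perf onto irr oV cV kV.
have [a ha] := nu_chi cF kF (@subset_refl _ _); exists a.
have -> : nu a \o pi - chi V = (chi (pi @` V) \o pi - chi V) - ((chi (pi @` V) - nu a) \o pi).
  by apply/funext => e; rewrite /GRing.add /= /GRing.opp /=; lia.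
by apply: zV.2 => //; apply/(vanish_comp perf onto irr).
Qed.

Lemma Cc_pullback (f : Cc X) : f \o pi \in @Cc_pred E.
Proof.
have /mem_CcP[o k] := CcP f; apply/mem_CcP; split=> [n|].
  exact: open_preimage (o n).
exact: compact_preimage k.
Qed.

End Gleason.

(** * Localizations of a Pruefer domain *)

Local Notation "x %:F" := (@FracField.tofrac _ x).
Local Notation loc := localization.

Section Primes.
Variable D : idomainType.
Implicit Types (P : Spec D) (a b s x y : D).

Lemma spec0 P : spec_set P 0.
Proof. by have [[/set_mem]] := specP P. Qed.

Lemma spec1 P : ~ spec_set P 1.
Proof. by have [[_ P1 _] _] := specP P; move=> /mem_set; apply/negP. Qed.

Lemma spec_lin P a x y : spec_set P x -> spec_set P y -> spec_set P (a * x + y).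
Proof.
by have [[_ _ h] _] := specP P; move=> Px Py; apply/set_mem/h; apply/mem_set.
Qed.

Lemma specMl P a x : spec_set P x -> spec_set P (a * x).
Proof. by move=> Px; rewrite -[_ * _]addr0; apply: spec_lin => //; apply: spec0. Qed.

Lemma specD P x y : spec_set P x -> spec_set P y -> spec_set P (x + y).
Proof. by move=> Px Py; rewrite -[x]mul1r; apply: spec_lin. Qed.

Lemma spec_prime P x y : spec_set P (x * y) -> spec_set P x \/ spec_set P y.
Proof.
by have [_ h] := specP P; move=> /mem_set /h /orP[]/set_mem; [left|right].
Qed.

Lemma spec_neq0 P s : ~ spec_set P s -> s%:F != 0.
Proof.
by move=> Ps; rewrite tofrac_eq0; apply/eqP => e; apply: Ps; rewrite e; apply: spec0.
Qed.

Lemma mkSpec (S : set D) : S 0 -> ~ S 1 ->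
  (forall a x y, S x -> S y -> S (a * x + y)) ->
  (forall x y, S (x * y) -> S x \/ S y) -> exists P : Spec D, P = S :> set D.
Proof.
move=> S0 S1 SL SP.
have h : idealr_closed [in S] /\ prime_idealr_closed [in S].
  split.
    split; [exact: mem_set|by apply/negP => /set_mem|].
    by move=> a x y /set_mem Sx /set_mem Sy; apply/mem_set/SL.
  by move=> x y /set_mem /SP[]h; apply/orP; [left|right]; apply/mem_set.
by exists (MkSpec h).
Qed.

Lemma ideal_gen_mem (s : seq D) y : y \in s -> ideal_gen s y.
Proof.
move=> ys; exists (fun i => (i == index y s)%:R).
have lt : (index y s < size s)%N by rewrite index_mem.
rewrite (bigD1 (Ordinal lt)) //= eqxx mul1r nth_index // big1 ?addr0 // => i ne.
rewrite (_ : _ == _ = false) ?mul0r //; apply: contra_neqF ne => /eqP e.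
exact: val_inj.
Qed.

Lemma ideal_gen_lin (s : seq D) a x y :
  ideal_gen s x -> ideal_gen s y -> ideal_gen s (a * x + y).
Proof.
move=> [c ->] [d ->]; exists (fun i => a * c i + d i).
rewrite mulr_sumr -big_split; apply: eq_bigr => i _ /=; ring.
Qed.

Lemma ideal_gen0 (s : seq D) : ideal_gen s 0.
Proof. by exists (fun=> 0); rewrite big1 // => i _; rewrite mul0r. Qed.

Lemma ideal_gen_sub (s : seq D) (H : set D) : H 0 ->
  (forall a x y, H x -> H y -> H (a * x + y)) -> (forall y, y \in s -> H y) ->
  ideal_gen s `<=` H.
Proof.
move=> H0 HL sH _ [a ->]; apply: (big_ind H) => //.
- by move=> x y Hx Hy; rewrite -[x]mul1r; apply: HL.
- move=> i _; rewrite -[_ * _]addr0; apply: HL => //.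
  by apply/sH/mem_nth.
Qed.

(** Zorn's lemma, applied to the sets S that become a proper ideal once C is
added; in this form the empty chain needs no special care. *)
Lemma maximal_ideal_ex (C : set D) : C 0 -> ~ C 1 ->
  (forall a x y, C x -> C y -> C (a * x + y)) ->
  exists M : Spec D, Max M /\ C `<=` M.
Proof.
move=> C0 C1 CL.
pose prop (S : set D) := [/\ S 0, ~ S 1 & forall a x y, S x -> S y -> S (a * x + y)].
have [F Fprop Ftot|S [[S0 S1 SL] Smax]] := @Zorn_bigcup D (fun S => prop (C `|` S)).
  split; first by left.
    move=> [//|[S FS S1]]; have [_ h _] := Fprop S FS; by apply: h; right.
  move=> a x y.
  have inF S : F S -> (C `|` S) `<=` C `|` \bigcup_(S in F) S.
    by move=> FS z [|Sz]; [left|right; exists S].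
  move=> [Cx|[S FS Sx]] [Cy|[S' FS' Sy]].
  - by left; apply: CL.
  - by apply: (inF S' FS'); have [_ _ h] := Fprop S' FS'; apply: h; [left|right].
  - by apply: (inF S FS); have [_ _ h] := Fprop S FS; apply: h; [right|left].
  - have [SS|SS] := Ftot S S' FS FS'.
      apply: (inF S' FS'); have [_ _ h] := Fprop S' FS'.
      by apply: h; right => //; apply: SS.
    apply: (inF S FS); have [_ _ h] := Fprop S FS.
    by apply: h; right => //; apply: SS.
set M := C `|` S.
have Mmax (J : set D) : prop J -> M `<=` J -> J = M.
  move=> pJ MJ; have CJ : C `|` J = J.
    by apply/seteqP; split=> x; [move=> [Cx|//]; apply: MJ; left|right].
  have := Smax J; rewrite CJ => h; apply: contrapT => nJM; apply: h => //; split.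
    by apply: subset_trans MJ => x; right.
  move=> JS; apply: nJM; apply/seteqP; split=> // x /JS; by right.
have SP x y : M (x * y) -> M x \/ M y.
  move=> Mxy; apply: contrapT => /not_orP[nx ny].
  pose J := [set z | exists a u, M u /\ z = a * x + u].
  have MJ : M `<=` J by move=> u Mu; exists 0, u; rewrite mul0r add0r.
  have Jx : J x by exists 1, 0; rewrite mul1r addr0.
  have JL a u v : J u -> J v -> J (a * u + v).
    move=> [b [w [Mw ->]]] [c [w' [Mw' ->]]]; exists (a * b + c), (a * w + w').
    by split; [apply: SL|ring].
  have [b [w [Mw e1]]] : J 1.
    apply: contrapT => nJ1; have eJ : J = M.
      by apply: Mmax => //; split=> //; apply: MJ.
    by apply: nx; rewrite -eJ.
  apply: ny; have -> : y = b * (x * y) + (y * w + 0).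
    by rewrite -[LHS]mul1r e1; ring.
  by apply: (SL) => //; apply: SL.
have [P PM] := mkSpec S0 S1 SL SP; exists P; split; last by rewrite PM => x; left.
move=> J [J0 J1 JL]; rewrite PM => MJ; apply: Mmax => //; split.
- exact: set_mem.
- by move=> /mem_set; apply/negP.
- by move=> a x y Jx Jy; apply/set_mem/JL; apply/mem_set.
Qed.

End Primes.

Section Localization.
Variable D : idomainType.
Local Notation K := {fraction D}.
Implicit Types (P : Spec D) (I J : set K) (x y z : K).

Let loc P := localization P.

Lemma tofrac_inj : injective (@FracField.tofrac D).
Proof. by move=> a b /eqP; rewrite tofrac_eq => /eqP. Qed.

Lemma loc_frac P x : loc P x -> exists a s : D, ~ spec_set P s /\ x * s%:F = a%:F.
Proof.
move=> [a [s [Ps ->]]]; exists a, s; split=> //.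
by rewrite divfK // (spec_neq0 Ps).
Qed.

Lemma frac_loc P x (a s : D) : ~ spec_set P s -> x * s%:F = a%:F -> loc P x.
Proof.
move=> Ps e; exists a, s; split=> //.
by rewrite -e mulfK // (spec_neq0 Ps).
Qed.

Lemma locM P x y : loc P x -> loc P y -> loc P (x * y).
Proof.
move=> /loc_frac[a [s [Ps ea]]] /loc_frac[b [t [Pt eb]]].
apply: (@frac_loc _ _ (a * b) (s * t)); first by move=> /spec_prime[].
by rewrite !tofracM -ea -eb mulrACA.
Qed.

Lemma loc_dom P (a : D) : loc P a%:F.
Proof. by apply: (@frac_loc _ _ a 1); [apply: spec1|rewrite tofrac1 mulr1]. Qed.

Lemma loc_domset P : dom_set `<=` loc P.
Proof. by move=> _ [a _ <-]; apply: loc_dom. Qed.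

Lemma loc0 P : loc P 0.
Proof. by have := loc_dom P 0; rewrite tofrac0. Qed.

Lemma loc1 P : loc P 1.
Proof. by have := loc_dom P 1; rewrite tofrac1. Qed.

Lemma locV P (s : D) : ~ spec_set P s -> loc P (s%:F)^-1.
Proof.
move=> Ps; apply: (@frac_loc _ _ 1 s) => //.
by rewrite mulVf ?tofrac1 // (spec_neq0 Ps).
Qed.

Lemma locX P x n : loc P x -> loc P (x ^+ n).
Proof.
move=> Px; elim: n => [|n IH]; first by rewrite expr0; apply: loc1.
by rewrite exprS; apply: locM.
Qed.

Lemma locD P x y : loc P x -> loc P y -> loc P (x + y).
Proof. by case: (localization_submod P) => _ h _; apply: h. Qed.

Lemma loc_mul_spec P x (y a : D) : spec_set P y -> loc P x -> x * y%:F = a%:F -> spec_set P a.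
Proof.
move=> Py /loc_frac[b [s [Ps e]]] e'.
have : spec_set P (s * a).
  rewrite (_ : s * a = b * y); first exact: specMl.
  by apply: tofrac_inj; rewrite !tofracM -e -e'; ring.
by move=> /spec_prime[].
Qed.

Lemma loc_mono P P' : P `<=` P' -> loc P' `<=` loc P.
Proof. by move=> PP' x [a [s [Ps ->]]]; exists a, s; split=> // /PP'. Qed.

(** The equality of the localizations of I and D at P, in terms of elements. *)
Definition locally_trivial I P := I `<=` loc P /\ exists s : D, ~ spec_set P s /\ I s%:F.

Lemma mul_loc_triv I P : submod I ->
  set_mul I (loc P) = loc P <-> locally_trivial I P.
Proof.
move=> sI; have [I0 ID IM] := sI; split=> [e|[IP [s [Ps Is]]]].
  split=> [x Ix|].
    by rewrite -e -[x]mulr1; apply: mem_mul => //; apply: loc1.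
  pose L : set K := [set x | exists s : D, ~ spec_set P s /\ I (x * s%:F)].
  have : set_mul I (loc P) `<=` L.
    apply: mul_sub.
      split=> [|x y [s [Ps Is]] [t [Pt It]]|a x [s [Ps Is]]].
      - by exists 1; split; [apply: spec1|rewrite mul0r].
      - exists (s * t); split; first by move=> /spec_prime[].
        rewrite (_ : _ * _ = t%:F * (x * s%:F) + s%:F * (y * t%:F)).
          by apply: ID; apply: IM.
        by rewrite tofracM; ring.
      - by exists s; split=> //; rewrite -mulrA; apply: IM.
    move=> x y Ix /loc_frac[a [s [Ps e']]]; exists s; split=> //.
    by rewrite -mulrA e' mulrC; apply: IM.
  rewrite e => /(_ 1 (loc1 P))[s]; rewrite mul1r => h; by exists s.
apply/seteqP; split.
  apply: mul_sub; first exact: localization_submod.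
  by move=> x y /IP; apply: locM.
move=> x Px; have -> : x = s%:F * ((s%:F)^-1 * x).
  by rewrite mulrA divff ?mul1r // (spec_neq0 Ps).
by apply: mem_mul => //; apply: locM => //; apply: locV.
Qed.

Lemma supp_sub_triv I (X : set (Spec D)) : submod I ->
  supp I `<=` X <-> forall P, ~ X P -> locally_trivial I P.
Proof.
move=> sI; rewrite supp_subP; split=> h P /h.
  by move=> /mul_loc_triv; apply.
by move=> /(mul_loc_triv _ sI).
Qed.

(** In an expression of 1 as a sum of products of elements of I and of its
inverse, one product is a unit at P, and its factor in I generates I there. *)
Lemma inv_loc_gen I P : invertible I -> exists c, [/\ I c, c != 0 & forall x, I x -> loc P (x / c)].
Proof.
move=> [fI [J fJ e]].
have IJ x y : I x -> J y -> dom_set (x * y) by move=> Ix Jy; rewrite -e; apply: mem_mul.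
have [c [j [b [Ic Jj Pb ecj]]]] :
    exists c j b, [/\ I c, J j, ~ spec_set P b & c * j = b%:F].
  apply: contrapT => nh.
  pose L : set K := [set z | exists2 a : D, z = a%:F & spec_set P a].
  have : set_mul I J `<=` L.
    apply: mul_sub.
      split=> [|_ _ [a -> Pa] [b -> Pb]|a _ [b -> Pb]].
      - by exists 0; rewrite ?tofrac0 //; apply: spec0.
      - by exists (a + b); rewrite ?tofracD //; apply: specD.
      - by exists (a * b); rewrite ?tofracM //; apply: specMl.
    move=> x y Ix Jy; have [a _ ea] := IJ x y Ix Jy; exists a => //.
    by apply: contrapT => nPa; apply: nh; exists x, y, a.
  rewrite e => /(_ _ (dom_1 D))[a ea Pa].
  have /tofrac_inj a1 : a%:F = 1%:F :> K by rewrite tofrac1.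
  by case: (spec1 (P := P)); rewrite -a1.
exists c; have bn0 := spec_neq0 Pb.
have c0 : c != 0 by apply: contraNneq bn0 => c0; rewrite -ecj c0 mul0r.
split=> // x Ix; have [d _ ed] := IJ x j Ix Jj.
by apply: (@frac_loc _ _ d b) => //; rewrite -ecj ed mulrA divfK.
Qed.

(** The conductor of x into D is contained in no maximal ideal. *)
Lemma dom_of_loc x : (forall M : Spec D, Max M -> loc M x) -> dom_set x.
Proof.
move=> h; pose C := [set a : D | dom_set (a%:F * x)].
have [D0 DD DM] := dom_submod D.
have [C1|nC1] := pselect (C 1); first by move: C1; rewrite /C /= tofrac1 mul1r.
have [||M [MM CM]] := maximal_ideal_ex (C := C) _ nC1.
- by rewrite /C /= tofrac0 mul0r.
- move=> a y z Cy Cz; rewrite /C /= tofracD tofracM mulrDl -mulrA.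
  by apply: DD => //; apply: DM.
have /loc_frac[a [s [Ms e]]] := h M MM.
by case: Ms; apply: CM; rewrite /C /= mulrC e; exists a.
Qed.

Hypothesis prD : prufer D.

(** Localizations of a Pruefer domain are valuation rings. For x = a / s the
ideal (a, s) is invertible, so 1 = a u + s v with all of a u, a v, s u, s v in
D; one of the two summands is a unit at P. *)
Lemma loc_total P x : loc P x \/ loc P x^-1.
Proof.
have [a [s [s0 e]]] := frac_split x.
have sF0 : s%:F != 0 :> K by rewrite tofrac_eq0.
have nz : ideal_gen [:: a; s] <> [set 0].
  move=> h; have : ideal_gen [:: a; s] s by apply: ideal_gen_mem; rewrite !inE eqxx orbT.
  by rewrite h => /eqP; apply/negP.
have [fI [J fJ eJ]] := prD nz.
have [[J0 JD JM] _ _] := fJ.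
pose L : set K := [set z | exists u v, [/\ J u, J v & z = a%:F * u + s%:F * v]].
have : set_mul (@FracField.tofrac D @` ideal_gen [:: a; s]) J `<=` L.
  apply: mul_sub.
    split=> [|_ _ [u [v [Ju Jv ->]]] [u' [v' [Ju' Jv' ->]]]|b _ [u [v [Ju Jv ->]]]].
    - by exists 0, 0; split=> //; rewrite !mulr0 addr0.
    - by exists (u + u'), (v + v'); split; [apply: JD|apply: JD|ring].
    - by exists (b%:F * u), (b%:F * v); split; [apply: JM|apply: JM|ring].
  move=> _ y [z [c ->] <-] Jy; exists ((c 0%N)%:F * y), ((c 1%N)%:F * y).
  split; [exact: JM|exact: JM|].
  by rewrite !big_ord_recl big_ord0 /= addr0 tofracD !tofracM; ring.
rewrite eJ => /(_ _ (dom_1 D))[u [v [Ju Jv e1]]].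
have inD (y : D) z : y \in [:: a; s] -> J z -> exists b : D, y%:F * z = b%:F.
  move=> ys Jz; have : dom_set (y%:F * z).
    by rewrite -eJ; apply: mem_mul => //; exists y => //; apply: ideal_gen_mem.
  by move=> [b _ <-]; exists b.
have [b eb] := inD a u (mem_head _ _) Ju.
have sin : s \in [:: a; s] by rewrite !inE eqxx orbT.
have [c ec] := inD s v sin Jv.
have [b' eb'] := inD s u sin Ju; have [c' ec'] := inD a v (mem_head _ _) Jv.
have [Pb|nPb] := pselect (spec_set P b); last first.
  right; have bn0 := spec_neq0 nPb.
  have x0 : x != 0 by apply: contraNneq bn0 => x0; rewrite -eb -e x0 !mul0r.
  apply: (@frac_loc _ _ b' b) => //; rewrite -eb -eb' -e.
  by rewrite !mulrA mulVf // mul1r.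
left; have Pc : ~ spec_set P c.
  move=> Pc; apply: (spec1 (P := P)); suff -> : 1 = b + c by apply: specD.
  by apply: tofrac_inj; rewrite tofrac1 tofracD -eb -ec.
apply: (@frac_loc _ _ c' c) => //; by rewrite -ec -ec' mulrA e.
Qed.

End Localization.

(** * Orders at the points of X *)

Section Uniformizers.
Variables (D : idomainType) (X : set (Spec D)).
Local Notation K := {fraction D}.
Hypotheses (prD : prufer D) (XM : X `<=` @Max D).
Implicit Types (M P : Spec D) (C I J : set K).

(** The elements divisible by all powers of y in the valuation ring at M form
a prime. It is strictly below M, so it is not maximal and lies outside X. *)
Lemma inf_prime M (y : D) : X M -> spec_set M y -> y != 0 -> exists P : Spec D,
  [/\ ~ X P, P `<=` M, ~ spec_set P y &
    forall x, spec_set P x <-> forall n, loc M (x%:F / y%:F ^+ n)].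
Proof.
move=> XM_ My y0; have yF0 : y%:F != 0 :> K by rewrite tofrac_eq0.
pose S := [set x : D | forall n, loc M (x%:F / y%:F ^+ n)].
have yV : ~ loc M (y%:F)^-1.
  move=> h; apply: (spec1 (P := M)).
  by apply: (loc_mul_spec My h); rewrite mulVf // tofrac1.
have [||||P PS] := @mkSpec _ S.
- by move=> n; rewrite tofrac0 mul0r; apply: loc0.
- by move=> /(_ 1%N); rewrite expr1 tofrac1 mul1r.
- move=> a x z Sx Sz n; rewrite tofracD tofracM mulrDl -mulrA.
  by apply: locD => //; apply: locM => //; apply: loc_dom.
- move=> x z Sxz; apply: contrapT => /not_orP[/existsNP[n nx] /existsNP[m nz]].
  have hz : loc M (z%:F / y%:F ^+ m)^-1 by case: (loc_total prD M (z%:F / y%:F ^+ m)).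
  have z0 : z%:F != 0 :> K.
    by apply/eqP => z0; apply: nz; rewrite z0 mul0r; apply: loc0.
  apply: nx; have := locM (Sxz (n + m)%N) hz; congr (localization M _).
  rewrite exprD tofracM -(mulf_div x%:F _ z%:F) mulfK //.
  by apply: mulf_neq0 => //; rewrite invr_neq0 // expf_neq0.
exists P; rewrite PS; have PM : S `<=` M.
  move=> x /(_ 1%N); rewrite expr1 => h.
  by apply: (loc_mul_spec My h); rewrite divfK.
have nSy : ~ S y.
  by move=> /(_ 2%N); rewrite expr2 invfM mulrA divff // mul1r.
split=> // XP; apply: nSy; suff -> : S = M by [].
have [[P0 P1 PL] _] := specP M.
have := XM XP; rewrite -PS => /(_ M); rewrite PS => -> //.
Qed.

(** Let a generate A at M, and let y in M be no multiple of a. As A is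
radical, no power of y is a multiple of a; so A is contained in the prime of
[inf_prime] for y, although A is locally trivial outside X. *)
Lemma radical_gen M (A : set D) : X M -> radical_ideal A ->
  Inv_on X (@FracField.tofrac D @` A) -> A `<=` M ->
  exists a, [/\ A a, a != 0 & forall y, spec_set M y -> loc M (y%:F / a%:F)].
Proof.
move=> XM_ [A0 AL Arad] [iA sA] AM.
have sbA : submod (@FracField.tofrac D @` A) by case: iA => -[].
have [_ [[a Aa <-] a0 hA]] := inv_loc_gen M iA.
exists a; split=> //; first by rewrite -tofrac_eq0.
have AMl b x : A x -> A (b * x) by move=> Ax; rewrite -[_ * _]addr0; apply: AL.
move=> y My; have [->|y0] := eqVneq y 0; first by rewrite tofrac0 mul0r; apply: loc0.
have yF0 : y%:F != 0 :> K by rewrite tofrac_eq0.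
have [[n hn]|hn] := pselect (exists n, loc M (y%:F ^+ n / a%:F)).
  have [b [s [Ms e]]] := loc_frac hn.
  have Asy : A (s * y ^+ n).
    rewrite (_ : s * _ = b * a); first exact: AMl.
    apply: tofrac_inj; rewrite !tofracM tofracXn -e.
    by rewrite mulrAC divfK // mulrC.
  have As : A (s * y).
    apply: (Arad _ n.+1); rewrite exprMn !exprSr.
    have -> : s ^+ n * s * (y ^+ n * y) = (s ^+ n * y) * (s * y ^+ n) by ring.
    exact: AMl Asy.
  have := hA (s * y)%:F; rewrite tofracM => /(_ _) h.
  have := locM (locV Ms) (h (ex_intro2 _ _ _ As (tofracM _ _))).
  by rewrite !mulrA mulVf ?mul1r // (spec_neq0 Ms).
have [P [nXP PM Py Pchar]] := inf_prime XM_ My y0.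
have [_ [s [Ps [x Ax /tofrac_inj e]]]] := (supp_sub_triv X sbA).1 sA P nXP.
case: Ps; rewrite -e; apply/Pchar => n.
have -> : x%:F / y%:F ^+ n = (x%:F / a%:F) * (y%:F ^+ n / a%:F)^-1.
  by rewrite invf_div mulrA divfK.
apply: locM; first by apply: hA; exists x.
by have [|//] := loc_total prD M (y%:F ^+ n / a%:F); move=> h; case: hn; exists n.
Qed.

Definition uniformizer M (t : D) :=
  [/\ spec_set M t, t != 0 & forall y, spec_set M y -> loc M (y%:F / t%:F)].

Lemma uniformizer_ex M : Crit X = set0 -> X M -> exists t, uniformizer M t.
Proof.
move=> cX XM_; have : ~ Crit X M by rewrite cX.
move=> /not_and3P[//|nM|/contrapT[A [rA iA AM]]]; first by case: nM; apply: XM.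
by have [a [Aa a0 ha]] := radical_gen XM_ rA iA AM; exists a; split=> //; apply: AM.
Qed.

Section Order.
Variables (M : Spec D) (t : D).
Hypotheses (XM_ : X M) (ut : uniformizer M t).
Let tau : K := t%:F.

Let tau0 : tau != 0. Proof. by case: ut => _ t0 _; rewrite tofrac_eq0. Qed.

Lemma loc_tauV : ~ loc M tau^-1.
Proof.
case: ut => Mt _ _ h; apply: (spec1 (P := M)).
by apply: (loc_mul_spec Mt h); rewrite mulVf // tofrac1.
Qed.

Lemma loc_tau n : loc M (tau ^ n) <-> 0 <= n.
Proof.
split=> [|]; last by case: n => // n _; apply: locX; apply: loc_dom.
case: n => // n h; case: loc_tauV.
have -> : tau^-1 = tau ^+ n * tau ^ Negz n.
  by rewrite NegzE -exprnN exprSr invfM mulVKf ?expf_neq0.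
by apply: locM => //; apply: locX; apply: loc_dom.
Qed.

(** C generates t ^ n times the local ring at M. Both inclusions are stated
with elements; c generates C locally. *)
Definition ord_at C n := (forall c, C c -> loc M (c / tau ^ n)) /\
  exists c, [/\ C c, c != 0 & loc M (tau ^ n / c)].

Lemma ord_at_sub C C' n n' : ord_at C n -> ord_at C' n' -> C `<=` C' -> n' <= n.
Proof.
move=> [_ [c [Cc c0 hc]]] [h' _] CC'; rewrite -subr_ge0; apply/loc_tau.
have := locM hc (h' c (CC' _ Cc)); congr (localization M _).
by rewrite expfzDr // -invr_expz mulrA divfK.
Qed.

Lemma ord_at_uniq C n n' : ord_at C n -> ord_at C n' -> n = n'.
Proof.
by move=> h h'; apply/eqP; rewrite eq_le; apply/andP; split;
  [apply: (ord_at_sub h' h)|apply: (ord_at_sub h h')].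
Qed.

Lemma ord_at_mul C C' n n' : ord_at C n -> ord_at C' n' ->
  ord_at (set_mul C C') (n + n').
Proof.
move=> [h [c [Cc c0 hc]]] [h' [c' [Cc' c'0 hc']]].
have e : tau ^ (n + n') = tau ^ n * tau ^ n' by rewrite expfzDr.
split; last first.
  exists (c * c'); split; [exact: mem_mul|exact: mulf_neq0|].
  by rewrite e invfM mulrACA; apply: locM.
have sL : submod [set z | loc M (z / tau ^ (n + n'))].
  have [L0 LD LM] := localization_submod M.
  split; rewrite /mkset; first by rewrite mul0r.
    by move=> x y hx hy; rewrite mulrDl; apply: LD.
  by move=> a x hx; rewrite -mulrA; apply: LM.
apply: (mul_sub sL) => x y Cx Cy; rewrite /mkset e invfM mulrACA.
by apply: locM; [apply: h|apply: h'].
Qed.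

(** Let c generate C at M. It is a unit at the prime of [inf_prime] for t,
because this prime lies outside X; hence c is, up to a unit, a power of t. *)
Lemma ord_at_ex C : Inv_on X C -> exists n, ord_at C n.
Proof.
move=> [iC sC]; have sbC : submod C by case: iC => -[].
have [c [Cc c0 hc]] := inv_loc_gen M iC.
suff [n [h1 h2]] : exists n, loc M (c / tau ^ n) /\ loc M (tau ^ n / c).
  exists n; split; last by exists c.
  move=> x /hc hx; have -> : x / tau ^ n = x / c * (c / tau ^ n) by rewrite mulrA divfK.
  exact: locM.
have [Mt t0 ht] := ut.
have [P [nXP PM Pt Pchar]] := inf_prime XM_ Mt t0.
have [CP [s [Ps Cs]]] := (supp_sub_triv X sbC).1 sC P nXP.
have Pc : loc P c by apply: CP.
have PcV : loc P c^-1.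
  rewrite (_ : c^-1 = (s%:F / c) * (s%:F)^-1).
    by apply: locM; [apply: (loc_mono PM); apply: hc|apply: locV].
  by rewrite mulrAC divff ?mul1r // (spec_neq0 Ps).
(* a unit at P that is integral at M is a power of t: divide by t as often as
   possible *)
have key (d : K) : d != 0 -> loc M d -> loc P d^-1 ->
    exists n : nat, loc M (d / tau ^+ n) /\ loc M (tau ^+ n / d).
  move=> d0 /loc_frac[a [r [Mr ea]]] /loc_frac[b [q [Pq eb]]].
  have Pa : ~ spec_set P a.
    move=> Pa; have : spec_set P (r * q).
      rewrite (_ : r * q = b * a); first exact: specMl.
      by apply: tofrac_inj; rewrite !tofracM -ea -eb mulrACA mulVf // mul1r mulrC.
    by move=> /spec_prime[/PM|].
  have r0 := spec_neq0 Mr.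
  have a0 : a%:F != 0 by rewrite (spec_neq0 Pa).
  have ex : exists n, `[< ~ loc M (a%:F / tau ^+ n) >].
    apply: contrapT => h; apply: Pa; apply/Pchar => n; apply: contrapT => hn.
    by apply: h; exists n; apply/asboolP.
  case: (ex_minnP ex) => -[|m] /asboolP nm mmin.
    by case: nm; rewrite expr0 divr1; apply: loc_dom.
  have hm : loc M (a%:F / tau ^+ m).
    by apply: contrapT => /asboolP/mmin; rewrite ltnn.
  exists m.
  have dE : d = a%:F / r%:F by rewrite -ea mulfK.
  have mX : tau ^+ m != 0 by apply: expf_neq0.
  split.
    by rewrite dE mulrAC; apply: locM => //; apply: locV.
  have [b' [s' [Ms' e']]] := loc_frac hm.
  have Mb' : ~ spec_set M b'.
    move=> /ht hb; apply: nm.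
    rewrite (_ : _ / _ = (b'%:F / tau) / s'%:F); first by apply: locM => //; apply: locV.
    rewrite -e' exprS; have s'0 := spec_neq0 Ms'.
    by rewrite [RHS]mulrAC mulfK // invfM mulrA mulrAC.
  rewrite (_ : _ / d = s'%:F * r%:F / b'%:F).
    by apply: locM; [apply: locM; apply: loc_dom|apply: locV].
  rewrite dE -e'; have s'0 := spec_neq0 Ms'.
  rewrite !invf_div invfM invf_div [s'%:F * _]mulrC mulrACA divff // mulr1.
  exact: mulrCA.
have [Mc|McV] := loc_total prD M c.
  by have [n [h1 h2]] := key c c0 Mc PcV; exists n%:Z.
have [|n [h1 h2]] := key c^-1 (invr_neq0 c0) McV; first by rewrite invrK.
exists (- n%:Z); rewrite -exprnN invrK.
split; first by move: h2; rewrite invrK mulrC.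
by move: h1; rewrite mulrC.
Qed.

Lemma ord_at_radical (A : set D) : radical_ideal A ->
  Inv_on X (@FracField.tofrac D @` A) -> A `<=` M ->
  ord_at (@FracField.tofrac D @` A) 1.
Proof.
move=> rA iA AM; have [a [Aa a0 ha]] := radical_gen XM_ rA iA AM.
have [Mt t0 ht] := ut.
split; rewrite expr1z; first by move=> _ [x Ax <-]; apply: ht; apply: AM.
exists a%:F; split; [by exists a|by rewrite tofrac_eq0|exact: ha].
Qed.

Lemma ord_at_spec C n : C `<=` dom_set -> ord_at C n ->
  (forall a, C a%:F -> spec_set M a) <-> 1 <= n.
Proof.
have [Mt t0 ht] := ut.
move=> CD [h [c [Cc c0 hc]]]; split=> [hM|n1].
  have [a _ ac] := CD c Cc.
  have Ma : spec_set M a by apply: hM; rewrite ac.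
  have h1 : loc M (tau ^ (n - 1)).
    have -> : tau ^ (n - 1) = tau ^ n / c * (c / tau).
      by rewrite expfzDr // exprN1 mulrA divfK.
    by apply: locM => //; rewrite -ac; apply: ht.
  by have /loc_tau := h1; lia.
move=> a Ca; have := h _ Ca => ha.
have : loc M (a%:F / tau).
  rewrite (_ : _ / _ = (a%:F / tau ^ n) * tau ^ (n - 1)).
    by apply: locM => //; apply/loc_tau; lia.
  by rewrite expfzDr // exprN1 mulrA divfK // expfz_neq0.
by move=> h'; apply: (loc_mul_spec Mt h'); rewrite divfK.
Qed.

End Order.
End Uniformizers.

(** * Finitely generated fractional ideals *)

Section FinitelyGenerated.
Variable D : idomainType.
Local Notation K := {fraction D}.
Implicit Types (X : set (Spec D)) (I J L : set K) (r : seq K).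

(** The smallest submodule containing r: inclusions are checked on generators,
and no coefficients have to be written down. *)
Definition fgen r : set K :=
  [set x | forall L, submod L -> (forall y, y \in r -> L y) -> L x].

Lemma fgen_submod r : submod (fgen r).
Proof.
split=> [L [L0 _ _] _|x y hx hy L sL rL|a x hx L sL rL] //.
  by have [_ LD _] := sL; apply: LD; [apply: hx|apply: hy].
by have [_ _ LM] := sL; apply: LM; apply: hx.
Qed.

Lemma mem_fgen r y : y \in r -> fgen r y.
Proof. by move=> yr L _; apply. Qed.

Lemma fgen_sub r L : submod L -> (forall y, y \in r -> L y) -> fgen r `<=` L.
Proof. by move=> sL rL x; apply. Qed.

Lemma fgen_mono r r' : {subset r <= r'} -> fgen r `<=` fgen r'.
Proof. by move=> rr; apply: fgen_sub; [apply: fgen_submod|move=> y /rr /mem_fgen]. Qed.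

Lemma fgen_tofrac (s : seq D) :
  fgen (map (@FracField.tofrac D) s) = @FracField.tofrac D @` ideal_gen s.
Proof.
apply/seteqP; split.
  apply: fgen_sub; last by move=> _ /mapP[y ys ->]; exists y => //; apply: ideal_gen_mem.
  split; first by exists 0; [apply: ideal_gen0|exact: tofrac0].
    move=> _ _ [x sx <-] [y sy <-]; exists (1 * x + y); first exact: ideal_gen_lin.
    by rewrite mul1r tofracD.
  move=> a _ [x sx <-]; exists (a * x + 0); last by rewrite addr0 tofracM.
  by apply: ideal_gen_lin => //; apply: ideal_gen0.
move=> _ [x sx <-] L [L0 LD LM] sL.
apply: (@ideal_gen_sub _ s [set x | L x%:F]) => //.
  by move=> a y z Ly Lz; rewrite /= tofracD tofracM; apply: LD => //; apply: LM.
by move=> y ys; apply: sL; apply: map_f.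
Qed.

Lemma inv_fgen I : invertible I -> exists2 r, I = fgen r & forall y, y \in r -> I y.
Proof.
move=> [fI [J fJ e]]; have [I0 ID IM] := fractional_sub fI.
have : set_mul I J 1 by rewrite e; apply: dom_1.
move=> [s hs e1]; exists (map fst s); last by move=> _ /mapP[p /hs[? _] ->].
apply/seteqP; split; last first.
  by apply: fgen_sub => // _ /mapP[p /hs[Ip _] ->].
move=> x Ix; have [F0 FD FM] := fgen_submod (map fst s).
rewrite -[x]mulr1 e1 mulr_sumr big_seq; apply: (big_ind (fgen (map fst s))) => //.
move=> p ps; have [_ Jp] := hs p ps.
have [a _ ea] : dom_set (x * p.2) by rewrite -e; apply: mem_mul.
by rewrite mulrCA mulrC -ea; apply: FM; apply: mem_fgen; apply: map_f.
Qed.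

Lemma common_denominator r : exists d (s : seq D), d != 0 /\
  map (fun x => d%:F * x) r = map (@FracField.tofrac D) s.
Proof.
elim: r => [|x r [d [s [d0 e]]]]; first by exists 1, [::]; rewrite oner_neq0.
have [a [b [b0 ex]]] := frac_split x.
exists (d * b), (d * a :: map (fun y => b * y) s); rewrite mulf_neq0 //; split=> //=.
rewrite !tofracM -mulrA (mulrC b%:F) ex; congr (_ :: _).
rewrite -[RHS]map_comp -(eq_map (f := (fun y => b%:F * y) \o (@FracField.tofrac D))).
  rewrite map_comp -e -map_comp; apply: eq_map => y /=.
  by rewrite [RHS]mulrCA mulrA.
by move=> y /=; rewrite tofracM.
Qed.

Lemma principal_inv (x : K) : x != 0 -> invertible [set x * y | y in dom_set].
Proof.
have fr (z : K) : z != 0 -> fractional [set z * y | y in dom_set].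
  move=> z0; have [D0 DD DM] := dom_submod D; split.
  - split; first by exists 0 => //; rewrite mulr0.
      by move=> _ _ [y Dy <-] [y' Dy' <-]; exists (y + y'); [apply: DD|rewrite mulrDr].
    by move=> a _ [y Dy <-]; exists (a%:F * y); [apply: DM|rewrite mulrCA].
  - by exists z => //; exists 1; [apply: dom_1|rewrite mulr1].
  - have [a [s [s0 e]]] := frac_split z; exists s => // _ [y Dy <-].
    by rewrite mulrA (mulrC s%:F) e; apply: DM.
move=> x0; split; first exact: fr.
exists [set x^-1 * y | y in dom_set]; first by apply: fr; rewrite invr_neq0.
have sD := dom_submod D; have [D0 DD DM] := sD.
apply/seteqP; split.
  apply: mul_sub => // _ _ [_ [a _ <-] <-] [y Dy <-].
  by rewrite mulrACA divff // mul1r; apply: DM.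
move=> y Dy; have -> : y = (x * 1) * (x^-1 * y) by rewrite mulr1 mulVKf.
by apply: mem_mul; [exists 1 => //; apply: dom_1|exists y].
Qed.

Lemma invertible_mul I J : invertible I -> invertible J -> invertible (set_mul I J).
Proof.
move=> iI iJ.
have h L : invertible L -> Inv_on setT L by [].
by have [] := Inv_on_mul (h _ iI) (h _ iJ).
Qed.

(** Clearing denominators leads back to finitely generated ideals of D. *)
Lemma fgen_inv r : prufer D -> (exists2 y, y \in r & y != 0) -> invertible (fgen r).
Proof.
move=> prD [y yr y0].
have [d [s [d0 e]]] := common_denominator r.
have dF0 : d%:F != 0 :> K by rewrite tofrac_eq0.
have : invertible (fgen (map (@FracField.tofrac D) s)).
  rewrite fgen_tofrac; apply: prD => s0.
  have : d%:F * y \in map (@FracField.tofrac D) s by rewrite -e; apply: map_f.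
  move=> /mapP[z zs ez]; have : ideal_gen s z by apply: ideal_gen_mem.
  rewrite s0 => z0; move: ez; rewrite z0 tofrac0 => /eqP.
  by rewrite mulf_eq0 (negPf dF0) (negPf y0).
move=> /(invertible_mul (principal_inv (invr_neq0 dF0))).
congr invertible; apply/seteqP; split.
  apply: mul_sub; first exact: fgen_submod.
  move=> _ x [_ [a _ <-] <-] hx.
  have [F0 FD FM] := fgen_submod r; rewrite mulrAC mulrC; apply: (FM).
  have sL : submod [set x | fgen r (d%:F^-1 * x)].
    split; rewrite /mkset; first by rewrite mulr0.
      by move=> u v hu hv; rewrite mulrDr; apply: FD.
    by move=> b u hu; rewrite mulrCA; apply: (FM).
  apply: (hx _ sL) => z; rewrite -e => /mapP[w wr ->]; rewrite /= mulKf //.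
  exact: mem_fgen.
apply: fgen_sub; first by apply: mul_submod; have [[sP _ _] _] := principal_inv (invr_neq0 dF0).
move=> z zr; have -> : z = (d%:F^-1 * 1) * (d%:F * z) by rewrite mulr1 mulKf.
apply: mem_mul; first by exists 1 => //; apply: dom_1.
by apply: mem_fgen; rewrite -e; apply: map_f.
Qed.

Lemma fgen_Inv_on X r : prufer D -> (exists2 y, y \in r & y != 0) ->
  (forall P, ~ X P -> locally_trivial (fgen r) P) -> Inv_on X (fgen r).
Proof.
move=> prD r0 h; split; first exact: fgen_inv.
by apply/supp_sub_triv => //; apply: fgen_submod.
Qed.

Lemma fgen_loc r P : (forall y, y \in r -> loc P y) -> fgen r `<=` loc P.
Proof. by apply: fgen_sub; apply: localization_submod. Qed.

End FinitelyGenerated.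

(** * The inverse topology *)

Section InverseTopology.
Variable D : idomainType.
Implicit Types (P Q : Spec D) (s : seq D) (X U : set (Spec D)).

Definition hull s : set (Spec D) := [set P | forall y, y \in s -> spec_set P y].

Lemma hullP s P : hull s P <-> ideal_gen s `<=` P.
Proof.
split=> [h|h y /ideal_gen_mem /h //].
by apply: ideal_gen_sub => //; [apply: spec0|move=> a x y; apply: spec_lin].
Qed.

Lemma hull_cat s s' : hull (s ++ s') = hull s `&` hull s'.
Proof.
apply/seteqP; split=> P.
  by move=> h; split=> y ys; apply: h; rewrite mem_cat ys ?orbT.
by move=> [h h'] y; rewrite mem_cat => /orP[/h|/h'].
Qed.

Lemma hull_open s : open (hull s).
Proof.
exists [set hull s]; last by apply/seteqP; split=> [P [_ ->] //|P hP]; exists (hull s).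
move=> _ ->; rewrite (_ : hull s = [set P : Spec D | ideal_gen s `<=` P]).
  by apply: finI_from1; exists s.
by apply/seteqP; split=> P /hullP.
Qed.

(** The sets V(s) are closed under finite intersection by [hull_cat], so they
form a basis and not only a subbasis. *)
Lemma spec_open_hull U P : open U -> U P -> exists s, hull s P /\ hull s `<=` U.
Proof.
move=> [D' D'fin <-] [B BD' BP].
have [F Fgen FB] := D'fin B BD'.
have [g hg] : exists g : set D -> seq D, forall i, i \in F -> ideal_gen (g i) = i.
  have : forall i : set D, exists s : seq D, i \in F -> ideal_gen s = i.
    move=> i; have [iF|niF] := pselect (i \in F); last by exists [::] => /niF.
    by have /set_mem[s _ <-] := Fgen i iF; exists s.
  by move=> /choice[g hg]; exists g => i; exact: hg.
pose s := flatten [seq g i | i <- enum_fset F].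
have hs Q : hull s Q <-> B Q.
  rewrite -FB; split=> [h i /= iF|h y /flatten_mapP[i iF yi]].
    rewrite -(hg i iF); apply/hullP => y yi; apply: h.
    by apply/flatten_mapP; exists i.
  have := h i iF; rewrite /= -{1}(hg i iF) => /hullP; exact.
exists s; split; first exact/hs.
by move=> Q /hs BQ; exists B.
Qed.

(** The limit of an ultrafilter of primes: the elements contained in almost
all of them form a prime. *)
Lemma ultra_spec (T : Type) (ev : T -> Spec D) (F : set_system T) :
  UltraFilter F -> exists P : Spec D,
    forall a, spec_set P a <-> F [set z | spec_set (ev z) a].
Proof.
move=> FU; have [FF _] := FU.
have [||||P PE] := @mkSpec _ [set a | F [set z | spec_set (ev z) a]].
- by apply: (@filterS _ F _ setT) => [z _|]; [apply: spec0|apply: filterT].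
- move=> h; have [z] := filter_ex h; exact: spec1.
- move=> a x y hx hy; apply: (@filterS2 _ F _ _ _ _ _ hx hy) => z.
  exact: spec_lin.
- move=> x y hxy.
  have [hx|hx] := in_ultra_setVsetC [set z | spec_set (ev z) x] FU; first by left.
  right; apply: (@filterS2 _ F _ _ _ _ _ hxy hx) => z /= /spec_prime[].
    by move=> h /(_ h).
  by [].
exists P => a; by rewrite PE.
Qed.

Lemma ultra_hull (T : Type) (ev : T -> Spec D) (F : set_system T) P s :
  Filter F -> (forall a, spec_set P a <-> F [set z | spec_set (ev z) a]) ->
  hull s P -> F [set z | hull s (ev z)].
Proof.
move=> FF hP; elim: s => [|a s IH] h; first by apply: filterS filterT => z _ y.
have ha : F [set z | spec_set (ev z) a] by apply/hP/h/mem_head.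
have hs : F [set z | hull s (ev z)].
  by apply: IH => y ys; apply: h; rewrite inE ys orbT.
apply: (@filterS2 _ F _ _ _ _ _ ha hs) => z za zs y.
by rewrite inE => /orP[/eqP->|/zs].
Qed.

Section Subspace.
Variable X : set (Spec D).

Definition hull_on s : set X := [set M : X | hull s (val M)].

Lemma hull_on_open s : open (hull_on s).
Proof. by exists (hull s); [apply: hull_open|]. Qed.

Lemma hull_on_nbhs (M : X) (U : set X) : nbhs M U ->
  exists s, hull_on s M /\ hull_on s `<=` U.
Proof.
rewrite nbhsE => -[V [[W oW WV] VM] VU].
have WM : W (val M) by move: VM; rewrite -WV.
have [s [sM sW]] := spec_open_hull oW WM.
exists s; split=> // N sN; apply: VU; rewrite -WV; exact: sW.
Qed.

(** The limit of an ultrafilter contains s if almost all of its members do,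
and then it belongs to X. *)
Lemma hull_on_compact s : hull s `<=` X -> compact (hull_on s).
Proof.
move=> sX; rewrite compact_ultra => F FU Fs.
have FF : ProperFilter F by case: FU.
have [P hP] := ultra_spec (fun M : X => val M) FU.
have sP : hull s P.
  by move=> y ys; apply/hP; apply: filterS Fs => M; apply.
pose M : X := SigSub (mem_set (sX P sP)).
exists M; split=> // U /hull_on_nbhs[s' [s'M s'U]].
by apply: filterS s'U _; apply: (@ultra_hull _ _ F P).
Qed.

(** For maximal ideals M and N, write 1 = a + b with a in M and b in N; then
V(a) and V(b) are disjoint. *)
Lemma spec_hausdorff : X `<=` @Max D -> hausdorff_space X.
Proof.
move=> XM M N h; apply: contrapT => MN.
have MM : Max (val M) by apply: XM; apply: set_mem; exact: valP.
have [a [b [Ma Nb ab]]] : exists a b : D,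
    [/\ spec_set (val M) a, spec_set (val N) b & 1 = a + b].
  pose J := [set z : D | exists a b, [/\ spec_set (val M) a, spec_set (val N) b & z = a + b]].
  have MJ : val M `<=` J by move=> a Ma; exists a, 0; rewrite addr0; split=> //; apply: spec0.
  have NJ : val N `<=` J by move=> a Ma; exists 0, a; rewrite add0r; split=> //; apply: spec0.
  apply: contrapT => nJ1.
  have idJ : idealr_closed [in J].
    split; [exact/mem_set/MJ/spec0|by apply/negP => /set_mem|].
    move=> c u v /set_mem[a [b [Ma Nb ->]]] /set_mem[a' [b' [Ma' Nb' ->]]].
    apply/mem_set; exists (c * a + a'), (c * b + b').
    by split; [apply: spec_lin|apply: spec_lin|ring].
  have eJ : J = spec_set (val M) by apply: MM.
  have NM : val N `<=` val M by move=> a /NJ; rewrite eJ.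
  have MN' : Max (val N) by apply: XM; apply: set_mem; exact: valP.
  have eMN : spec_set (val M) = spec_set (val N).
    by apply: MN' => //; case: (specP (val M)).
  apply: MN; apply: val_inj; move: (val M) (val N) eMN => [S hS] [S' hS'] /= e.
  by move: hS hS'; rewrite e => hS hS'; congr MkSpec; apply: Prop_irrelevance.
have [||Q [/= Qa Qb]] := h (hull_on [:: a]) (hull_on [:: b]).
- by apply: open_nbhs_nbhs; split; [apply: hull_on_open|move=> y; rewrite inE => /eqP->].
- by apply: open_nbhs_nbhs; split; [apply: hull_on_open|move=> y; rewrite inE => /eqP->].
apply: (spec1 (P := val Q)); rewrite ab.
by apply: specD; [apply: Qa|apply: Qb]; rewrite mem_head.
Qed.

End Subspace.
End InverseTopology.

(** * Invertible ideals as continuous functions *)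

Section InvIso.
Variables (D : idomainType) (X : set (Spec D)).
Local Notation K := {fraction D}.
Hypotheses (prD : prufer D) (XM : X `<=` @Max D) (cX : Crit X = set0).
Variables (t : X -> D).
Hypothesis ut : forall M : X, uniformizer (val M) (t M).
Variable nuI : inv_group X -> X -> int.
Hypothesis nuIP : forall (I : inv_group X) (M : X), ord_at (val M) (t M) (val I) (nuI I M).
Implicit Types (I J L : inv_group X) (M N : X).

Lemma inX M : X (val M). Proof. exact: set_mem (valP M). Qed.

Lemma inv_on_val I : Inv_on X (val I). Proof. exact: set_mem (valP I). Qed.

Lemma nuI_uniq I M n : ord_at (val M) (t M) (val I) n -> nuI I M = n.
Proof. by move=> h; apply: (ord_at_uniq (ut M) (nuIP I M) h). Qed.

Lemma nuID I J M : nuI (I + J) M = nuI I M + nuI J M.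
Proof. by apply: nuI_uniq; apply: (ord_at_mul (ut M) (nuIP I M) (nuIP J M)). Qed.

Lemma nuI0 M : nuI 0 M = 0.
Proof. by have := nuID 0 0 M; rewrite addr0; lia. Qed.

Lemma nuIN I M : nuI (- I) M = - nuI I M.
Proof. by have := nuID I (- I) M; rewrite subrr nuI0; lia. Qed.

Lemma nuIMz I k M : nuI (I *~ k) M = nuI I M * k.
Proof.
have fB : zmod_morphism (nuI^~ M) by move=> A B; rewrite nuID nuIN.
pose F := GRing.isZmodMorphism.Build _ _ _ fB.
pose fm : {additive inv_group X -> int} := HB.pack (nuI^~ M) F.
by have := raddfMz fm k I; rewrite mulrzz.
Qed.

(** For the converse, the quotient of I by J is contained in D locally at
every maximal ideal: at the points of X because its order is nonnegative
there, elsewhere because it is trivial. *)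
Lemma nuI_sub I J : val I `<=` val J <-> forall M, nuI J M <= nuI I M.
Proof.
split=> [IJ M|h]; first exact: (ord_at_sub (ut M) (nuIP I M) (nuIP J M) IJ).
have sJ : submod (val J) by have [[fJ _] _] := inv_on_val J; apply: fractional_sub.
have : val (I - J) `<=` dom_set.
  move=> x Ix; apply: dom_of_loc => P _.
  have [XP|nXP] := pselect (X P); last first.
    have [iIJ sIJ] := inv_on_val (I - J).
    have sb : submod (val (I - J)) by case: iIJ => -[].
    by have [h' _] := (supp_sub_triv X sb).1 sIJ P nXP; apply: h'.
  pose M : X := SigSub (mem_set XP).
  have [h' _] := nuIP (I - J) M.
  have := locM (h' x Ix) ((loc_tau (ut M) (nuI (I - J) M)).2 _).
  rewrite divfK; last by apply: expfz_neq0; rewrite tofrac_eq0; case: (ut M).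
  by apply; rewrite nuID nuIN subr_ge0.
move=> IJ; have -> : I = (I - J) + J by rewrite subrK.
rewrite -[val _]/(set_mul (val (I - J)) (val J)) -[X in _ `<=` X](mul_dom sJ).
exact: mul_mono.
Qed.

Lemma nuI_inj I J : (forall M, nuI I M = nuI J M) -> I = J.
Proof.
move=> h; apply: val_inj; apply/seteqP.
by split; apply/nuI_sub => M; rewrite h.
Qed.

Lemma inv_of_fgen (r : seq K) : (exists2 y, y \in r & y != 0) ->
  (forall P, ~ X P -> locally_trivial (fgen r) P) -> exists I, val I = fgen r.
Proof. by move=> r0 h; exists (SigSub (mem_set (fgen_Inv_on prD r0 h))). Qed.

Lemma inv_gens I : exists r : seq K, [/\ val I = fgen r,
   exists2 y, y \in r & y != 0 & forall P, ~ X P -> locally_trivial (fgen r) P].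
Proof.
have [iI sI] := inv_on_val I; have [r e _] := inv_fgen iI.
have [[_ [x Ix x0] _] _] := iI.
exists r; rewrite -e; split=> //.
  apply: contrapT => h; move: x0; suff -> : x = 0 by rewrite eqxx.
  move: Ix; rewrite e => /(_ [set 0]); apply => [|y yr].
    by split=> // [_ _ -> ->|a _ ->]; rewrite /mkset ?addr0 ?mulr0.
  by apply: contrapT => y0; apply: h; exists y => //; apply/eqP.
by apply/supp_sub_triv => //; have [[fI _] _] := inv_on_val I; apply: fractional_sub.
Qed.

(** The sum of the two ideals. *)
Lemma inv_min I J : exists L, forall M, nuI L M = Num.min (nuI I M) (nuI J M).
Proof.
have [r [eI [y yr y0] hI]] := inv_gens I.
have [r' [eJ _ hJ]] := inv_gens J.
have Ir : fgen r `<=` fgen (r ++ r') by apply: fgen_mono => z; rewrite mem_cat => ->.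
have Jr : fgen r' `<=` fgen (r ++ r').
  by apply: fgen_mono => z; rewrite mem_cat => ->; rewrite orbT.
have [||L eL] := @inv_of_fgen (r ++ r').
- by exists y => //; rewrite mem_cat yr.
- move=> P nXP; have [rP [s [Ps rs]]] := hI P nXP; have [rP' _] := hJ P nXP.
  split; last by exists s; split=> //; apply: Ir.
  by apply: fgen_loc => z; rewrite mem_cat => /orP[]/mem_fgen; [apply: rP|apply: rP'].
exists L => M; apply: nuI_uniq; rewrite eL.
have t0 : (t M)%:F != 0 :> K by rewrite tofrac_eq0; case: (ut M).
have low (A : inv_group X) (n : int) : n <= nuI A M ->
    forall x, val A x -> loc (val M) (x / (t M)%:F ^ n).
  move=> le x Ax; have [h _] := nuIP A M.
  have -> : x / (t M)%:F ^ n = (x / (t M)%:F ^ (nuI A M)) * (t M)%:F ^ (nuI A M - n).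
    by rewrite expfzDr // mulrA divfK ?expfz_neq0 // -invr_expz.
  by apply: locM; [apply: h|apply/(loc_tau (ut M)); rewrite subr_ge0].
split; last first.
  rewrite minEle; case: ifP => _.
    have [_ [c [Ic c0 hc]]] := nuIP I M; exists c; split=> //.
    by apply: Ir; rewrite -eI.
  have [_ [c [Jc c0 hc]]] := nuIP J M; exists c; split=> //.
  by apply: Jr; rewrite -eJ.
set n := Num.min _ _.
have sL : submod [set z : K | loc (val M) (z / (t M)%:F ^ n)].
  have [L0 LD LM] := localization_submod (val M).
  split; rewrite /mkset; first by rewrite mul0r.
    by move=> x z hx hz; rewrite mulrDl; apply: LD.
  by move=> a x hx; rewrite -mulrA; apply: LM.
apply: fgen_sub => // z; rewrite mem_cat => /orP[]/mem_fgen zr.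
  by apply: (low I); rewrite ?eI // /n ge_min lexx.
by apply: (low J); rewrite ?eJ // /n ge_min lexx orbT.
Qed.

(** The ideal I (I + D)^-1 is integral and finitely generated; its order is
the positive part of nu_I. *)
Lemma nuI_pos I : exists s, hull s `<=` X /\ forall M, 1 <= nuI I M <-> hull_on (X := X) s M.
Proof.
(* L = I + D, so that I - L stands for I (I + D)^-1 *)
have [L hL] := inv_min I 0.
have LI : val (I - L) `<=` dom_set.
  have h : val (I - L) `<=` val (0 : inv_group X).
    by apply/nuI_sub => M; rewrite nuI0 nuID nuIN hL nuI0; lia.
  exact: h.
have [r [eIL _ hr]] := inv_gens (I - L).
have [s es] : exists s : seq D, r = map (@FracField.tofrac D) s.
  have rD y : y \in r -> dom_set y.
    by move=> yr; apply: (LI); rewrite eIL; apply: mem_fgen.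
  elim: (r) rD => [|y r' IH] h; first by exists [::].
  have [a _ ea] := h y (mem_head _ _).
  have [|s e] := IH; first by move=> z zr; apply: h; rewrite inE zr orbT.
  by exists (a :: s); rewrite /= ea e.
have hullE P : hull s P <-> forall a : D, fgen r a%:F -> spec_set P a.
  rewrite es fgen_tofrac; split=> [/hullP h a [b sb /tofrac_inj <-]|h]; first exact: h.
  by apply/hullP => a sa; apply: h; exists a.
exists s; split=> [P /hullE h|M].
  apply: contrapT => nXP; have [_ [x [Px rx]]] := hr P nXP.
  by apply/Px/h.
have h1 := ord_at_spec (ut M) LI (nuIP (I - L) M).
rewrite (_ : (1 <= nuI I M) = (1 <= nuI (I - L) M)); last first.
  by rewrite nuID nuIN hL nuI0; lia.
rewrite -h1 eIL; split; first by move/hullE.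
by move=> /hullE.
Qed.

(** A radical ideal has order at most 1 everywhere. *)
Lemma nuI_radical M : exists A, [/\ val A `<=` dom_set,
  nuI A M = 1 & forall N, nuI A N = 0 \/ nuI A N = 1].
Proof.
have : ~ Crit X (val M) by rewrite cX.
move=> /not_and3P[/(_ (inX M))//|nM|/contrapT[A [rA iA AM]]].
  by case: nM; apply: XM; apply: inX.
pose a : inv_group X := SigSub (mem_set iA).
have aD : val a `<=` dom_set by move=> _ [x _ <-]; exists x.
exists a; split=> //; first by apply: nuI_uniq; apply: (ord_at_radical prD XM (inX M) (ut M)).
move=> N; have [h|h] := leP 1 (nuI a N).
  right; apply: nuI_uniq; apply: (ord_at_radical prD XM (inX N) (ut N)) => //.
  move=> x Ax; have := (ord_at_spec (ut N) aD (nuIP a N)).2 h x; apply.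
  by exists x.
left; have : 0 <= nuI a N.
  by have := (nuI_sub a 0).1 aD N; rewrite nuI0.
by move: h; lia.
Qed.

Lemma pos_open I : open [set M | 1 <= nuI I M].
Proof.
have [s [_ hs]] := nuI_pos I.
by rewrite (_ : mkset _ = hull_on s); [apply: hull_on_open|apply/seteqP; split=> M /hs].
Qed.

(** Let A be a radical ideal below M. Near M the order of A is 1, and there
nu_I = n as soon as I A^(1 - n) and A^(n + 1) I^-1 have positive order. *)
Lemma nuI_locally_constant I n : open [set M | nuI I M = n].
Proof.
rewrite openE => M /= hM.
have [A [_ AM A01]] := nuI_radical M.
have : nbhs M ([set N | 1 <= nuI A N] `&` ([set N | 1 <= nuI (I - A *~ (n - 1)) N]
   `&` [set N | 1 <= nuI (A *~ (n + 1) - I) N])).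
  apply: open_nbhs_nbhs; split; first by do 2?[apply: openI]; apply: pos_open.
  by rewrite /= !nuID !nuIN !nuIMz AM hM; lia.
apply: filterS => N [/= h1 [h2 h3]]; move: h2 h3.
have A1 : nuI A N = 1 by case: (A01 N) h1 => ->.
by rewrite /= !nuID !nuIN !nuIMz A1; lia.
Qed.

Lemma X_hausdorff : hausdorff_space X. Proof. exact: spec_hausdorff. Qed.

Lemma pos_compact I : compact [set M | 1 <= nuI I M].
Proof.
have [s [sX hs]] := nuI_pos I.
by rewrite (_ : mkset _ = hull_on s); [apply: hull_on_compact|apply/seteqP; split=> M /hs].
Qed.

Lemma nuI_Cc I : nuI I \in @Cc_pred X.
Proof.
apply/mem_CcP; split; first exact: nuI_locally_constant.
have -> : [set M | nuI I M != 0] = [set M | 1 <= nuI I M] `|` [set M | 1 <= nuI (- I) M].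
  apply/seteqP; split=> M /=; rewrite nuIN; last by case; lia.
  move=> h; have [h1|h1] : 1 <= nuI I M \/ 1 <= - nuI I M by lia.
    by left.
  by right.
by apply: compactU; apply: pos_compact.
Qed.

(** If V(s) is contained in U, take the sum of the ideal generated by s and of
a radical ideal below M. *)
Lemma nuI_local (M : X) (U : set X) : nbhs M U -> exists L, [/\ nuI L M = 1,
  forall N, nuI L N = 0 \/ nuI L N = 1 & forall N, nuI L N = 1 -> U N].
Proof.
move=> /hull_on_nbhs[s [sM sU]].
have [A [AD AM A01]] := nuI_radical M.
have [r [eA [y yr y0] hr]] := inv_gens A.
pose r' := map (@FracField.tofrac D) s ++ r.
have Ar : fgen r `<=` fgen r' by apply: fgen_mono => z; rewrite mem_cat => ->; rewrite orbT.
have rD : fgen r' `<=` dom_set.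
  apply: fgen_sub; first exact: dom_submod.
  move=> z; rewrite mem_cat => /orP[/mapP[a _ ->]|/mem_fgen]; first by exists a.
  by rewrite -eA; apply: AD.
have [||L eL] := @inv_of_fgen r'.
- by exists y => //; rewrite mem_cat yr orbT.
- move=> P nXP; have [rP [a [Pa ra]]] := hr P nXP; split.
    by move=> z /rD; apply: loc_domset.
  by exists a; split=> //; apply: Ar.
have LD : val L `<=` dom_set by rewrite eL.
have L01 N : nuI L N = 0 \/ nuI L N = 1.
  have : nuI L N <= nuI A N by apply: (nuI_sub A L).1; rewrite eL eA.
  have : 0 <= nuI L N by have := (nuI_sub L 0).1 LD N; rewrite nuI0.
  by have [->|->] := A01 N; lia.
have hs N : (forall a : D, val L a%:F -> spec_set (val N) a) <-> 1 <= nuI L N.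
  exact: (ord_at_spec (ut N) LD (nuIP L N)).
exists L; split=> //.
  have : 1 <= nuI L M; last by have [->|->] := L01 M.
  apply/hs => a; rewrite eL => La.
  have sub : submod (@FracField.tofrac D @` val M).
    split; first by exists 0; [apply: spec0|apply: tofrac0].
      by move=> _ _ [u Mu <-] [v Mv <-]; exists (u + v); [apply: specD|rewrite tofracD].
    by move=> b _ [u Mu <-]; exists (b * u); [apply: specMl|rewrite tofracM].
  have : [set x%:F | x in val M] a%:F; last by move=> [b Mb /tofrac_inj <-].
  apply: (La _ sub) => z; rewrite mem_cat => /orP[/mapP[b bs ->]|zr].
    by exists b => //; apply: sM.
  have [b _ eb] : dom_set z by apply: AD; rewrite eA; apply: mem_fgen.
  rewrite -eb; exists b => //.
  apply: (ord_at_spec (ut M) AD (nuIP A M)).2; first by rewrite AM.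
  by rewrite eb eA; apply: mem_fgen.
move=> N hN; apply: sU => b bs; apply: (hs N).2; first by rewrite hN.
by rewrite eL; apply: mem_fgen; rewrite mem_cat map_f.
Qed.

Lemma X_base : compact_open_base X.
Proof.
move=> M U /nuI_local[L [LM L01 LU]].
have kL := @pos_compact L.
exists [set M | 1 <= nuI L M]; split=> //.
- exact: pos_open.
- exact: compact_closed X_hausdorff kL.
- by rewrite /= LM.
- by move=> N /= hN; apply: LU; case: (L01 N) hN => ->.
Qed.

(** The set of the nu_I is a group closed under minima, hence under maxima, so
finite unions of the sets given by [nuI_local] yield every compact open set. *)
Lemma nuI_onto (f : Cc X) : exists I, nuI I = f.
Proof.
suff h : zspan (@chi_clopen X) `<=` [set g | exists I, nuI I = g].
  by apply: h; apply: nalg_zspan (Cc_chi_clopen f); apply: chi_clopenM.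
apply: zspan_sub.
  split; first by exists 0; apply/funext => M; rewrite nuI0.
  by move=> _ _ [I <-] [J <-]; exists (I - J); apply/funext => M; rewrite nuID nuIN.
move=> _ [U [oU cU kU] <-].
pose P A := exists I, [/\ forall N, nuI I N = 0 \/ nuI I N = 1,
  forall N, nuI I N = 1 -> U N & forall N, A N -> nuI I N = 1].
have [|||| I [I01 IU UI]] := @compact_ind _ U P kU.
- by exists 0; split=> // N; rewrite nuI0 //; left.
- move=> A B [I [I01 IU AI]] [J [J01 JU BJ]]; have [L hL] := inv_min I J.
  (* the maximum of nu_I and nu_J, as L realizes their minimum *)
  exists (I + J - L); split=> N; rewrite !nuID nuIN hL.
  + by have [->|->] := I01 N; have [->|->] := J01 N; [left|right|right|right].
  + have := IU N; have := JU N.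
    by case: (I01 N) => ->; case: (J01 N) => -> h1 h2 //.
  + by case=> [/AI ->|/BJ ->]; [have [->|->] := J01 N|have [->|->] := I01 N].
- by move=> A B AB [I [I01 IU BI]]; exists I; split=> // N /AB /BI.
- move=> M UM; have [|L [LM L01 LU]] := @nuI_local M U.
    by apply: open_nbhs_nbhs; split.
  exists [set N | nuI L N = 1].
    by apply: open_nbhs_nbhs; split=> //; apply: nuI_locally_constant.
  by exists L; split.
exists I; apply/funext => N.
have [UN|nUN] := pselect (U N); first by rewrite chi1 // UI.
by rewrite chi0 //; have [//|/IU] := I01 N.
Qed.

End InvIso.

(** * Divisorial ideals as Dedekind cuts *)

Section DivIso.
Variables (D : idomainType) (X : set (Spec D)).
Local Notation K := {fraction D}.
Hypotheses (prD : prufer D) (XM : X `<=` @Max D) (cX : Crit X = set0) (oX : open X).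
Variables (t : X -> D).
Hypothesis ut : forall M : X, uniformizer (val M) (t M).
Variable nuI : inv_group X -> X -> int.
Hypothesis nuIP : forall (I : inv_group X) (M : X), ord_at (val M) (t M) (val I) (nuI I M).
Implicit Types (C : inv_group X) (A B : div_group X) (M N : X).

Let isub C C' : val C `<=` val C' <-> forall M, nuI C' M <= nuI C M.
Proof. exact: nuI_sub. Qed.

Let isubm C : submod (val C).
Proof. by have [[fC _] _] := inv_on_val C; apply: fractional_sub. Qed.

Lemma vclos_inv C : vclos (val C) = val C.
Proof. by have [[[_ e] _] _ _] := Inv_on_Div_on (inv_on_val C). Qed.

(** Suppose that no finitely generated ideal inside I has all its primes in X.
Then some ultrafilter of primes outside X has a limit that contains the
integral part of I; the limit is again outside X, where I is trivial, a
contradiction. *)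
Lemma inv_below (I : set K) : fractional I -> supp I `<=` X ->
  exists C, val C `<=` I.
Proof.
move=> fI sI; have [sbI [x Ix x0] [d d0 hd]] := fI; have [I0 ID IM] := sbI.
have tI := (supp_sub_triv X sbI).1 sI.
have [s [Is sX]] : exists s : seq D, (forall y, y \in s -> I y%:F) /\ hull s `<=` X.
  apply: contrapT => nex.
  pose Fl := filter_from [set s : seq D | forall y, y \in s -> I y%:F]
    (fun s => hull s `&` ~` X).
  have FF : ProperFilter Fl.
    apply: filter_from_proper.
      apply: filter_from_filter; first by exists [::].
      move=> s s' hs hs'; exists (s ++ s').
        by move=> y; rewrite mem_cat => /orP[/hs|/hs'].
      by rewrite hull_cat => P [[? ?] ?].
    move=> s hs; apply: contrapT => h; apply: nex; exists s; split=> // P sP.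
    by apply: contrapT => nXP; apply: h; exists P.
  have [G [GU FG]] := ultraFilterLemma FF.
  have GF : ProperFilter G by case: GU.
  have [P hP] := ultra_spec (fun P : Spec D => P) GU.
  have GX : G (~` X) by apply: FG; exists [::] => // P [].
  have nXP : ~ X P.
    move=> XP; have [s0 [s0P s0X]] := spec_open_hull oX XP.
    have := ultra_hull (ev := fun P : Spec D => P) _ hP s0P => Gs.
    have [Q [/s0X]] := filter_ex (filterI (Gs _) GX); exact.
  have [_ [a [Pa Ia]]] := tI P nXP; apply: Pa; apply/hP; apply: FG.
  exists [:: a]; first by move=> y; rewrite inE => /eqP->.
  by move=> Q [h _]; apply: h; rewrite mem_head.
have [a _ ea] := hd x Ix.
have aF0 : a%:F != 0 by rewrite ea mulf_neq0 // tofrac_eq0.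
have [||C eC] := inv_of_fgen prD (X := X) (r := map (@FracField.tofrac D) (a :: s)).
- by exists a%:F => //; rewrite /= mem_head.
- move=> P nXP; split.
    by apply: fgen_loc => _ /mapP[b _ ->]; apply: loc_dom.
  have /existsNP[y /not_implyP[ys Py]] : ~ hull s P by move=> /sX.
  by exists y; split=> //; apply: mem_fgen; apply: map_f; rewrite inE ys orbT.
exists C; rewrite eC; apply: fgen_sub => // _ /mapP[b + ->].
by rewrite inE => /orP[/eqP->|/Is //]; rewrite ea; apply: IM.
Qed.

(** Adding x to C0 changes nothing outside X, where both C0 and I are trivial. *)
Lemma inv_between (I : set K) C0 x : submod I -> supp I `<=` X ->
  val C0 `<=` I -> I x -> exists C, val C `<=` I /\ val C x.
Proof.
move=> sbI sI C0I Ix; have tI := (supp_sub_triv X sbI).1 sI.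
have [r [e0 [y yr y0] hr]] := inv_gens C0.
have rI z : z \in x :: r -> I z.
  rewrite inE => /orP[/eqP->//|zr]; apply: C0I; rewrite e0; exact: mem_fgen.
have [||C eC] := inv_of_fgen prD (X := X) (r := x :: r).
- by exists y => //; rewrite inE yr orbT.
- move=> P nXP; have [IP _] := tI P nXP; have [_ [s [Ps rs]]] := hr P nXP; split.
    by apply: fgen_loc => z /rI /IP.
  by exists s; split=> //; apply: fgen_mono rs => z zr; rewrite inE zr orbT.
exists C; rewrite eC; split; last by apply: mem_fgen; rewrite mem_head.
exact: fgen_sub.
Qed.

Lemma div_on_val A : Div_on X (val A). Proof. exact: set_mem (valP A). Qed.

Lemma div_submod A : submod (val A).
Proof. by have [[[fA _] _] _ _] := div_on_val A; apply: fractional_sub. Qed.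

Lemma div_vclos A : vclos (val A) = val A.
Proof. by have [[[_ e] _] _ _] := div_on_val A. Qed.

Lemma div_below A : exists C, val C `<=` val A.
Proof. by have [[[fA _] _] sA _] := div_on_val A; apply: inv_below. Qed.

Lemma div_mem A x : val A x -> exists C, val C `<=` val A /\ val C x.
Proof.
have [C0 h0] := div_below A; have [_ sA _] := div_on_val A.
exact: inv_between (div_submod A) sA h0.
Qed.

Lemma sub_colon_inv A C : val C `<=` colon (val A) -> val A `<=` val (- C).
Proof.
move=> h; rewrite -(div_vclos A) -[val (- C)]/(colon (val C)).
exact: colon_anti.
Qed.

Lemma div_above A : exists C, val A `<=` val C.
Proof.
have [[[fA eA] _] _ sA] := div_on_val A.
have [C hC] := inv_below (colon_fractional fA) sA.
by exists (- C); apply: sub_colon_inv.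
Qed.

Lemma div_inf A x : (forall C, val A `<=` val C -> val C x) -> val A x.
Proof.
move=> h; rewrite -(div_vclos A) => y hy.
have [[[fA eA] _] _ sA] := div_on_val A.
have [C0 h0] := inv_below (colon_fractional fA) sA.
have [C [CA Cy]] := inv_between (colon_submod (val A)) sA h0 hy.
have := h (- C) (sub_colon_inv CA); rewrite -[val (- C)]/(colon (val C)); exact.
Qed.

(** The values are bounded below by those of an ideal above A. *)
Lemma nuA_ex A M : exists n, (exists2 C, val C `<=` val A & nuI C M = n) /\
  forall C, val C `<=` val A -> n <= nuI C M.
Proof.
have [C0 h0] := div_below A; have [C1 h1] := div_above A.
have low C : val C `<=` val A -> nuI C1 M <= nuI C M.
  by move=> CA; apply: (isub C C1).1; apply: subset_trans h1.
have ex : exists m : nat, `[< exists2 C, val C `<=` val A & nuI C M = nuI C1 M + m%:Z >].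
  exists (absz (nuI C0 M - nuI C1 M)); apply/asboolP; exists C0 => //.
  by have := low C0 h0; lia.
case: (ex_minnP ex) => m /asboolP[C CA eC] mmin.
exists (nuI C1 M + m%:Z); split; first by exists C.
move=> C' C'A; have lo := low C' C'A.
suff : (m <= absz (nuI C' M - nuI C1 M))%N by lia.
by apply: mmin; apply/asboolP; exists C' => //; lia.
Qed.

Variable nuA : div_group X -> X -> int.
Hypothesis nuAP : forall A M, (exists2 C, val C `<=` val A & nuI C M = nuA A M) /\
  forall C, val C `<=` val A -> nuA A M <= nuI C M.

(** A is the union of the C below it, and nu_A is the minimum of their nu_C. *)
Lemma nuA_sub A C : val A `<=` val C <-> forall M, nuI C M <= nuA A M.
Proof.
split=> [AC M|h x /div_mem[C' [C'A C'x]]].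
  have [[C' C'A <-] _] := nuAP A M; apply: (isub C' C).1.
  exact: subset_trans AC.
apply: (isub C' C).2 C'x => M; apply: (le_trans (h M)).
by have [_] := nuAP A M; apply.
Qed.

Lemma nuA_usc A : usc (nuA A).
Proof.
move=> n; rewrite -[X in closed X]setCK; apply: open_closedC.
have -> : ~` [set M | n <= nuA A M] =
    \bigcup_(C in [set C | val C `<=` val A]) [set M | nuI C M < n].
  apply/seteqP; split=> M /=.
    move=> /negP; rewrite -ltNge => h; have [[C CA eC] _] := nuAP A M.
    by exists C => //=; rewrite eC.
  move=> [C CA /= h]; apply/negP; rewrite -ltNge; apply: le_lt_trans h.
  by have [_] := nuAP A M; apply.
apply: bigcup_open => C _; have /mem_CcP[h _] := nuI_Cc prD XM cX ut nuIP C.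
exact: (locally_constant_open (fun m => m < n)).
Qed.

Definition phi C : Cc X := MkCc (nuI_Cc prD XM cX ut nuIP C).

Lemma phi_onto (f : Cc X) : exists C, phi C = f.
Proof.
have [C e] := nuI_onto prD XM cX ut nuIP f; exists C; exact: val_inj.
Qed.

Lemma nuA_sub_phi A C : val A `<=` val C <-> le_fun (phi C) (nuA A).
Proof. exact: nuA_sub. Qed.

Lemma nuA_bound A : exists f0 f1 : Cc X, le_fun f0 (nuA A) /\ le_fun (nuA A) f1.
Proof.
have [C0 h0] := div_below A; have [C1 h1] := div_above A.
exists (phi C1), (phi C0); split; first exact/nuA_sub.
by move=> M; have [_] := nuAP A M; apply.
Qed.

(** An ideal C contains the v-product as soon as it contains the product. It
contains the product iff it contains C1 C2 for all C1 below A and C2 below B,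
and at each point the minimum of nu_C1 + nu_C2 is nu_A + nu_B. *)
Lemma nuAD A B (f : Cc X) :
  le_fun f (nuA (A + B)) <-> le_fun f (fun x => nuA A x + nuA B x).
Proof.
have [C <-] := phi_onto f; rewrite -nuA_sub_phi.
rewrite -[val (A + B)]/(vclos (set_mul (val A) (val B))).
split=> [h M /=|h].
  have [[C1 C1A <-] _] := nuAP A M; have [[C2 C2B <-] _] := nuAP B M.
  rewrite -(nuID ut nuIP); apply: (isub (C1 + C2) C).1.
  rewrite -[val (C1 + C2)]/(set_mul (val C1) (val C2)).
  apply: subset_trans h; apply: subset_trans (@sub_vclos _ _).
  exact: mul_mono.
rewrite -(vclos_inv C); apply: vclos_mono; apply: mul_sub; first exact: isubm.
move=> x y /div_mem[C1 [C1A C1x]] /div_mem[C2 [C2B C2y]].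
have : val (C1 + C2) `<=` val C.
  apply/isub => M; apply: (le_trans (h M)); rewrite (nuID ut nuIP).
  have [_ /(_ C1 C1A) h1] := nuAP A M; have [_ /(_ C2 C2B) h2] := nuAP B M.
  exact: lerD.
by apply; apply: mem_mul.
Qed.

Lemma nuA_inj A B :
  (forall f : Cc X, le_fun f (nuA A) <-> le_fun f (nuA B)) -> A = B.
Proof.
move=> h.
have hC C : val A `<=` val C <-> val B `<=` val C by rewrite !nuA_sub_phi.
apply: val_inj; apply/seteqP; split=> x hx; apply: div_inf => C.
  by move=> /hC; apply.
by move=> /hC; apply.
Qed.

Lemma nuA_inv C : nuA (inv_to_div C) = nuI C.
Proof.
apply/funext => M; apply/eqP; rewrite eq_le; apply/andP; split.
  by have [_] := nuAP (inv_to_div C) M; apply.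
by have [[C' C'C <-] _] := nuAP (inv_to_div C) M; apply: (isub C' C).1.
Qed.

(** The intersection I of the upper bounds is divisorial, because invertible
ideals are. It is v-invertible once x I <= I implies that x lies in D. At a
point of X where x has a pole, the powers of x would give elements of I with
poles of arbitrarily high order, but I is bounded above. *)
Lemma cut_div (L : set (inv_group X)) C0 C1 : L C0 ->
  (forall C, L C -> val C `<=` val C1) ->
  exists A, forall C, val A `<=` val C <-> forall C', L C' -> val C' `<=` val C.
Proof.
move=> LC0 LC1.
pose ub C := forall C', L C' -> val C' `<=` val C.
pose I : set K := [set x | forall C, ub C -> val C x].
have lowI C : L C -> val C `<=` I by move=> LC x Cx C' ubC'; apply: ubC' Cx.
have upI C : ub C -> I `<=` val C by move=> ubC x; apply.
have sbI : submod I.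
  split=> [C _|x y hx hy C ubC|a x hx C ubC]; have [c0 cD cM] := isubm C; first exact: c0.
    by apply: cD; [apply: hx|apply: hy].
  by apply: cM; apply: hx.
have I1 := upI C1 LC1; have I0 := lowI C0 LC0.
have vI : vclos I = I.
  apply/seteqP; split; last exact: sub_vclos.
  by move=> x hx C ubC; rewrite -(vclos_inv C); apply: (vclos_mono (upI C ubC)) hx.
have fI : fractional I.
  have [[[_ [x Cx x0] _] _] _] := inv_on_val C0.
  have [[[_ _ [d d0 hd]] _] _] := inv_on_val C1.
  by split=> //; [exists x => //; apply: I0|exists d => // y /I1 /hd].
have trC C P : ~ X P -> locally_trivial (val C) P.
  have [_ sC] := inv_on_val C; exact: (supp_sub_triv X (isubm C)).1 sC P.
have suppI (J : set K) C C' : submod J -> val C `<=` J -> J `<=` val C' -> supp J `<=` X.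
  move=> sJ CJ JC'; apply/supp_sub_triv => // P nXP.
  have [_ [s [Ps Cs]]] := trC C P nXP; have [h _] := trC C' P nXP.
  by split; [apply: subset_trans JC' h|exists s; split=> //; apply: CJ].
(* x I <= I implies that x lies in D *)
have idem x : (forall y, I y -> I (x * y)) -> dom_set x.
  move=> xI; apply: dom_of_loc => P MP.
  have [XP|nXP] := pselect (X P); last first.
    have [_ [s [Ps Cs]]] := trC C0 P nXP; have [h _] := trC C1 P nXP.
    have := locM (h _ (I1 _ (xI _ (I0 _ Cs)))) (locV Ps).
    by rewrite mulfK // (spec_neq0 Ps).
  pose M : X := SigSub (mem_set XP).
  set tau : K := (t M)%:F.
  have tau0 : tau != 0 by rewrite tofrac_eq0; case: (ut M).
  have [//|xV] := loc_total prD P x.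
  have [x0|x0] := eqVneq x 0; first by rewrite x0; apply: loc0.
  apply: contrapT => nx.
  have xt : loc P (x^-1 / tau).
    have [a [s [Ps es]]] := loc_frac xV.
    have aP : spec_set P a.
      apply: contrapT => Pa; apply: nx; apply: (@frac_loc _ _ _ s a) => //.
      by rewrite -es mulVKf.
    have -> : x^-1 / tau = a%:F / tau / s%:F by rewrite -es mulrAC mulfK // (spec_neq0 Ps).
    by apply: locM; [have [_ _ h] := ut M; apply: h|apply: locV].
  have [_ [c [Cc c0 hc]]] := nuIP C0 M; have [h1 _] := nuIP C1 M.
  (* the powers of x keep c inside I, hence below C1 *)
  have xn n : I (x ^+ n * c).
    elim: n => [|n IH]; first by rewrite expr0 mul1r; apply: I0.
    by rewrite exprS -mulrA; apply: xI.
  pose n := absz (nuI C0 M - nuI C1 M); pose k := n.+1.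
  (* the exponent is negative by the choice of k *)
  have h2 : loc P (tau ^ (nuI C0 M - nuI C1 M - k%:Z)).
    have -> : tau ^ (nuI C0 M - nuI C1 M - k%:Z) =
       (tau ^ (nuI C0 M) / c) * ((x ^+ k * c) / tau ^ (nuI C1 M)) * (x^-1 / tau) ^+ k.
      rewrite !expfzDr // -!invr_expz -exprnP exprMn !exprVn.
      set p := tau ^ _; set q := (tau ^ _)^-1; set w := (tau ^+ k)^-1.
      have xk0 : x ^+ k != 0 by rewrite expf_neq0.
      have -> : p / c * (x ^+ k * c * q) * ((x ^+ k)^-1 * w) =
        (p * q * w) * (c^-1 * c) * (x ^+ k / x ^+ k) by ring.
      by rewrite mulVf // divff // !mulr1.
    apply: locM; last exact: locX.
    by apply: locM => //; apply: h1; apply: I1.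
  have := (loc_tau (ut M) _).1 h2; rewrite /k /n; lia.
have vinv : v_invertible I.
  split=> //; exists (colon I); first exact: colon_fractional.
  suff e : colon (set_mul I (colon I)) = dom_set by rewrite /vclos e colon_dom.
  apply/seteqP; split=> [x|x Dx].
    rewrite mul_com => /colon_mulP h; apply: idem => y Iy.
    by rewrite -vI; apply: h.
  have h : set_mul I (colon I) `<=` dom_set by rewrite mul_com; apply: mul_colon.
  by apply: (colon_anti h); rewrite colon_dom.
have dI : Div_on X I.
  split; first by [].
    exact: suppI I0 I1.
  apply: (@suppI _ (- C1) (- C0)); first exact: colon_submod.
    by rewrite -[val (- C1)]/(colon (val C1)); apply: colon_anti.
  by rewrite -[val (- C0)]/(colon (val C0)); apply: colon_anti.
exists (SigSub (mem_set dI)) => C; split=> [h C' LC'|]; last exact: upI.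
by apply: subset_trans h; apply: lowI.
Qed.

Lemma compact_cover_clopen (F : set X) : compact F ->
  exists U : set X, [/\ open U, closed U, compact U & F `<=` U].
Proof.
pose P (G : set X) := exists U : set X, [/\ open U, closed U, compact U & G `<=` U].
move=> cF; suff : P F by []; apply: (compact_ind cF).
- by exists set0; split=> //; [apply: open0|apply: closed0|apply: compact0].
- move=> G H [U [oU cU kU AU]] [V [oV cV kV BV]]; exists (U `|` V).
  by split; [apply: openU|apply: closedU|apply: compactU|apply: setUSS].
- by move=> G H GH [U [oU cU kU BU]]; exists U; split=> //; apply: subset_trans BU.
- move=> M _; have [U [oU cU kU UM _]] := X_base prD XM cX ut nuIP (filterT : nbhs M setT).
  by exists U; [apply: open_nbhs_nbhs; split|exists U; split].
Qed.

(** The cut whose upper bounds are the continuous functions above the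
characteristic function of F: the latter is their pointwise minimum, since a
point outside F has a compact open neighborhood disjoint from F. *)
Lemma nuA_chi (F K0 : set X) : closed F -> compact K0 -> F `<=` K0 ->
  exists A, forall f : Cc X, le_fun f (nuA A) <-> le_fun f (chi F).
Proof.
move=> cF kK FK.
have [U [oU cU kU KU]] := compact_cover_clopen kK.
have FU : F `<=` U by apply: subset_trans KU.
pose L := [set C | le_fun (chi F) (nuI C)].
have chi_le (V : set X) : F `<=` V -> open V -> closed V -> compact V ->
    exists2 C, L C & nuI C = chi V.
  move=> FV oV cV kV; have [C /(congr1 (@Cc_fun _)) /= eC] := phi_onto (MkCc (chi_Cc oV cV kV)).
  exists C => // M; rewrite eC.
  have [FM|nFM] := pselect (F M); first by rewrite !chi1 //; apply: FV.
  by rewrite [chi F M]chi0 // /chi; case: (M \in V).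
have [C0 LC0 eC0] := chi_le U FU oU cU kU.
have [|A hA] := @cut_div L C0 0 LC0.
  move=> C LC; apply/isub => M; rewrite (nuI0 ut nuIP); apply: le_trans (LC M).
  by rewrite /chi; case: (M \in F).
exists A => f; have [C <-] := phi_onto f; rewrite -nuA_sub_phi hA.
split=> [h M|h C' LC']; last by apply/isub => M; apply: le_trans (LC' M); apply: h.
have [FM|nFM] := pselect (F M).
  rewrite chi1 //; have := (isub C0 C).1 (h C0 LC0) M.
  by rewrite eC0 chi1 //; apply: FU.
rewrite chi0 //.
have [|V [oV cV kV VM VF]] := X_base prD XM cX ut nuIP (U := ~` F) (x := M).
  by apply: open_nbhs_nbhs; split=> //; apply: closed_openC.
have [||||C' LC' eC'] := chi_le (U `&` ~` V).
- by move=> N FN; split; [apply: FU|move=> /VF].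
- by apply: openI => //; apply: closed_openC.
- by apply: closedI => //; apply: open_closedC.
- apply: subclosed_compact kU _; first by apply: closedI => //; apply: open_closedC.
  by move=> N [].
have := (isub C' C).1 (h C' LC') M; rewrite eC' chi0 //.
by move=> [].
Qed.

End DivIso.

(** * The commutative square and the free groups *)

Theorem proposition7p2 (D : idomainType) (X : set (Spec D)) :
  prufer D -> X `<=` @Max D -> discrete_splitting_set X -> Crit X = set0 ->
  (forall (E : topologicalType) (pi : E -> X), gleason_cover pi ->
     exists (phi : {additive inv_group X -> Cc X})
            (psi : {additive div_group X -> Cc E})
            (j : {additive Cc X -> Cc E}),
       [/\ bijective phi, bijective psi,
           forall f : Cc X, (j f : E -> int) = (f : X -> int) \o pi
         & forall I : inv_group X, psi (inv_to_div I) = j (phi I)])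
  /\ free_abelian (div_group X)
  /\ free_abelian (div_mod_inv X).
Proof.
move=> prD XM [[_ oX] _] cX.
have /choice[t ut] : forall M : X, exists t, uniformizer (val M) t.
  by move=> M; have := (uniformizer_ex prD XM cX (inX M)); exact.
have /choice[nuI nuIP] : forall I : inv_group X, exists f : X -> int,
    forall M, ord_at (val M) (t M) (val I) (f M).
  move=> I; have /choice[f hf] : forall M : X, exists n, ord_at (val M) (t M) (val I) n.
    by move=> M; apply: (ord_at_ex prD XM (inX M) (ut M) (inv_on_val I)).
  by exists f.
have /choice[nuA nuAP] : forall A : div_group X, exists f : X -> int, forall M,
    (exists2 C, val C `<=` val A & nuI C M = f M) /\
    forall C, val C `<=` val A -> f M <= nuI C M.
  move=> A; have /choice[f hf] := nuA_ex prD oX ut nuIP A.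
  by exists f.
have base := X_base prD XM cX ut nuIP.
have usc_nu := nuA_usc prD XM cX ut nuIP nuAP.
have bound_nu := nuA_bound prD XM cX oX ut nuIP nuAP.
have nuD := nuAD prD XM cX oX ut nuIP nuAP.
have inj_nu := nuA_inj prD XM cX oX ut nuIP nuAP.
have chi_nu := nuA_chi prD XM cX oX ut nuIP nuAP.
have inv_nu := nuA_inv ut nuIP nuAP.
have onto := phi_onto prD XM cX ut nuIP.
split; last split.
- move=> E pi gl.
  have [psi [psi_bij psiE]] := gleason_iso gl (nu_vanishB base usc_nu bound_nu nuD)
    (@nu_vanish0 _ base _ _ usc_nu bound_nu nuD inj_nu)
    (nu_chi_closed usc_nu bound_nu) (@nu_vanish_chi _ base _ _ usc_nu bound_nu chi_nu).
  pose p := phi prD XM cX ut nuIP.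
  have pB : zmod_morphism p.
    move=> I J; apply: val_inj; apply/funext => M /=.
    by rewrite (nuID ut nuIP) (nuIN ut nuIP).
  pose q (f : Cc X) : Cc E := MkCc (Cc_pullback gl f).
  have qB : zmod_morphism q by move=> f g; apply: val_inj.
  pose pF := GRing.isZmodMorphism.Build _ _ p pB.
  pose qF := GRing.isZmodMorphism.Build _ _ q qB.
  exists (HB.pack_for {additive inv_group X -> Cc X} p pF), psi,
    (HB.pack_for {additive Cc X -> Cc E} q qF); split=> //.
    apply: inj_surj_bij => [I J e|f]; last exact: onto.
    apply: (nuI_inj ut nuIP) => M.
    by have := congr1 (fun f : Cc X => f M) e.
  move=> I; apply/eqP; rewrite eq_sym -subr_eq0; apply/eqP; apply: vanish_Cc0.
  by have := psiE (inv_to_div I); rewrite inv_nu Cc_funB.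
- exact: (completion_free base usc_nu bound_nu nuD inj_nu chi_nu).
- apply: (completion_quotient_free base usc_nu bound_nu nuD inj_nu chi_nu
    (r := fun x : div_mod_inv X => repr x) (S := range (@inv_to_div D X))).
  (* the representatives of a sum and the sum of representatives differ by an
     invertible ideal *)
  + move=> x y; apply: set_mem; rewrite -[_ \in _]/(_ \in inv_in_div (X := X)).
    by rewrite Quotient.idealrBE !raddfB /= !reprK.
  + move=> x Sx; have : repr x - 0 \in inv_in_div (X := X) by rewrite subr0; apply: mem_set.
    by rewrite Quotient.idealrBE => /eqP; rewrite reprK raddf0.
  + move=> a; exists (\pi_(div_mod_inv X) a); apply: set_mem.
    by rewrite -[_ \in _]/(_ \in inv_in_div (X := X)) Quotient.idealrBE reprK.
  + by move=> _ [I _ <-]; exists (phi prD XM cX ut nuIP I); rewrite inv_nu.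
  + move=> f; have [I <-] := onto f; exists (inv_to_div I); [by exists I|by rewrite inv_nu].
Qed.
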